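(* Let $N\ge 5$ be an integer and let $a_1,a_2\in\mathbb{R}^N$ with $a_1\ne a_2$. Then for every $u\in C_0^\infty(\mathbb{R}^N)$, $$\int_{\mathbb{R}^N}|\Delta u|^2\,dx\ \ge\ \frac{N^2(N-4)^2}{16}\int_{\mathbb{R}^N}\frac{|a_1-a_2|^4}{|x-a_1|^4|x-a_2|^4}|u|^2\,dx .$$ The constant $\frac{N^2(N-4)^2}{16}$ is sharp, i.e. it equals $$\inf_{u\in D^{2,2}(\mathbb{R}^N)\setminus\{0\}}\frac{\int_{\mathbb{R}^N}|\Delta u|^2dx}{\int_{\mathbb{R}^N}\frac{|a_1-a_2|^4}{|x-a_1|^4|x-a_2|^4}|u|^2dx},$$ and it cannot be attained in $D^{2,2}(\mathbb{R}^N)$, i.e. no nonzero $u\in D^{2,2}(\mathbb{R}^N)$ realizes this infimum.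
   Context: $C_0^\infty(\mathbb{R}^N)$ denotes the smooth compactly supported functions on $\mathbb{R}^N$. $D^{2,2}(\mathbb{R}^N)$ is the completion (closure) of $C_0^\infty(\mathbb{R}^N)$ with respect to the norm $\|u\|_{2,2}:=\|\Delta u\|_{L^2(\mathbb{R}^N)}$. *)

(* Defs.v *)
From HB Require Import structures.
From mathcomp Require Import all_boot all_order all_algebra.
From mathcomp Require Import all_classical all_reals all_analysis.
Set Implicit Arguments. Unset Strict Implicit. Unset Printing Implicit Defensive.
Import Order.TTheory GRing.Theory Num.Theory.
Import numFieldNormedType.Exports.
Local Open Scope classical_set_scope.
Local Open Scope ring_scope.

(* R^n is 'rV[R]_n: its library topology (sup norm) is the usual one; the
   Euclidean norm is enorm below.  Its sigma-algebra is the product one, i.e.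
   the Borel sets, generated by the coordinates as for n.-tuple. *)
Definition rV_display : measure_display. Proof. exact: default_measure_display. Qed.

Section measurable_rV.
Context (R : realType) (n : nat).

Let coord (i : 'I_n) (x : 'rV[R]_n) : measurableTypeR R := x ord0 i.

Let rV_set0 : g_sigma_preimage coord set0.
Proof. exact: sigma_algebra0. Qed.

Let rV_setC A : g_sigma_preimage coord A -> g_sigma_preimage coord (~` A).
Proof. exact: sigma_algebraC. Qed.

Let rV_bigcup (F : _^nat) : (forall i, g_sigma_preimage coord (F i)) ->
  g_sigma_preimage coord (\bigcup_i (F i)).
Proof. exact: sigma_algebra_bigcup. Qed.

HB.instance Definition _ := @isMeasurable.Build rV_display
  'rV[R]_n (g_sigma_preimage coord) rV_set0 rV_setC rV_bigcup.

Lemma measurable_coord (i : 'I_n) :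
  measurable_fun [set: 'rV[R]_n] (fun x : 'rV[R]_n => x ord0 i : measurableTypeR R).
Proof.
move=> _ Y mY; rewrite setTI; apply: sub_sigma_algebra => /=.
rewrite -bigcup_seq/=; exists i => /=; first by rewrite mem_index_enum.
by exists Y => //; rewrite setTI.
Qed.

Lemma measurable_fun_rV d (T : measurableType d) (f : T -> 'rV[R]_n) :
  (forall i, measurable_fun [set: T] (fun t => f t ord0 i : measurableTypeR R)) ->
  measurable_fun [set: T] f.
Proof.
move=> mf _ A mA; rewrite setTI.
suff : g_sigma_preimage coord `<=` [set B | measurable (f @^-1` B)] by apply.
apply: smallest_sub => [|B].
  split=> [|B mB|F mF] /=.
  - by rewrite preimage_set0.
  - by rewrite setTD preimage_setC; exact: measurableC.
  - by rewrite preimage_bigcup; apply: bigcup_measurable => k _; exact: mF.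
rewrite -bigcup_seq/= => -[i _ [C mC <-]].
by rewrite /= setTI; have := mf i measurableT _ mC; rewrite setTI.
Qed.

End measurable_rV.

Section lebesgue_rV.
Context (R : realType).

Definition rV_cons n (p : measurableTypeR R * 'rV[R]_n) : 'rV[R]_n.+1 :=
  \row_i (if unlift ord0 i is Some j then p.2 ord0 j else p.1).

Lemma rV_cons0 n p : @rV_cons n p ord0 ord0 = p.1.
Proof. by rewrite mxE unlift_none. Qed.

Lemma rV_consS n p j : @rV_cons n p ord0 (lift ord0 j) = p.2 ord0 j.
Proof. by rewrite mxE liftK. Qed.

Lemma measurable_rV_cons n : measurable_fun setT (@rV_cons n).
Proof.
apply: measurable_fun_rV => i; case: (unliftP ord0 i) => [j|] ->.
- under eq_fun do rewrite rV_consS.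
  exact: (measurableT_comp (measurable_coord j) measurable_snd).
- by under eq_fun do rewrite rV_cons0; exact: measurable_fst.
Qed.

Definition rV_uncons n (x : 'rV[R]_n.+1) : measurableTypeR R * 'rV[R]_n :=
  (x ord0 ord0, \row_j x ord0 (lift ord0 j)).

Lemma rV_consK n : cancel (@rV_cons n) (@rV_uncons n).
Proof.
move=> [t v]; rewrite /rV_uncons rV_cons0; congr pair.
by apply/rowP => j; rewrite mxE rV_consS.
Qed.

Lemma rV_unconsK n : cancel (@rV_uncons n) (@rV_cons n).
Proof.
move=> x; apply/rowP => i; case: (unliftP ord0 i) => [j|] ->.
- by rewrite rV_consS mxE.
- by rewrite rV_cons0.
Qed.

Lemma measurable_rV_uncons n : measurable_fun setT (@rV_uncons n).
Proof.
apply: measurable_fun_pair => /=; first exact: measurable_coord.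
apply: measurable_fun_rV => j; under eq_fun do rewrite mxE.
exact: measurable_coord.
Qed.

Section step.
Variables (n : nat) (m : {sigma_finite_measure set 'rV[R]_n -> \bar R}).

Definition lebesgue_cons : set 'rV[R]_n.+1 -> \bar R :=
  pushforward (lebesgue_measure \x m)%E (@rV_cons n).

Let lebesgue_cons0 : lebesgue_cons set0 = 0%E.
Proof. by rewrite /lebesgue_cons /pushforward preimage_set0 measure0. Qed.

Let lebesgue_cons_ge0 A : (0 <= lebesgue_cons A)%E.
Proof. by apply: integral_ge0 => t _; exact: measure_ge0. Qed.

Let lebesgue_cons_semi_sigma_additive : semi_sigma_additive lebesgue_cons.
Proof.
have mf := @measurable_rV_cons n.
rewrite /lebesgue_cons => F mF tF mUF; rewrite /pushforward preimage_bigcup.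
apply: (@measure_semi_sigma_additive _ _ _ (lebesgue_measure \x m)%E).
- by move=> k; rewrite -[X in measurable X]setTI; exact: mf.
- apply/trivIsetP => /= i j _ _ ij; rewrite -preimage_setI.
  by move/trivIsetP : tF => /(_ _ _ _ _ ij) ->//; rewrite preimage_set0.
- by rewrite -preimage_bigcup -[X in measurable X]setTI; exact: mf.
Qed.

HB.instance Definition _ := isMeasure.Build _ _ _ lebesgue_cons
  lebesgue_cons0 lebesgue_cons_ge0 lebesgue_cons_semi_sigma_additive.

Let lebesgue_cons_sigma_finite : sigma_finite setT lebesgue_cons.
Proof.
have /sigma_finiteP[F [TF ndF Foo]] := sigma_finiteT (@lebesgue_measure R).
have /sigma_finiteP[G [TG ndG Goo]] := sigma_finiteT m.
exists (fun k => @rV_uncons n @^-1` (F k `*` G k)).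
  rewrite -preimage_bigcup -(@preimage_setT _ _ (@rV_uncons n)).
  congr (_ @^-1` _); apply/seteqP; split=> // -[t v] _.
  have [i _ Ft] : (\bigcup_k F k) t by rewrite -TF.
  have [j _ Gv] : (\bigcup_k G k) v by rewrite -TG.
  exists (maxn i j) => //; split.
  - by move: Ft; exact/subsetPset/ndF/leq_maxl.
  - by move: Gv; exact/subsetPset/ndG/leq_maxr.
move=> k; have [mF Fk] := Foo k; have [mG Gk] := Goo k; split.
  rewrite -[X in measurable X]setTI; apply: measurable_rV_uncons => //.
  exact: measurableX.
rewrite /lebesgue_cons /pushforward -comp_preimage.
rewrite (_ : _ \o _ = id); last by apply/funext => p /=; rewrite rV_consK.
by rewrite preimage_id product_measure1E// lte_mul_pinfty// ge0_fin_numE.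
Qed.

HB.instance Definition _ := Measure_isSigmaFinite.Build _ _ _ lebesgue_cons
  lebesgue_cons_sigma_finite.

End step.

Fixpoint lebesgue_rV n : {sigma_finite_measure set 'rV[R]_n -> \bar R} :=
  match n with
  | 0 => dirac (0 : 'rV[R]_0)
  | n'.+1 => lebesgue_cons (lebesgue_rV n')
  end.

(* With sigma-finiteness, this characterizes Lebesgue measure on R^n. *)
Lemma lebesgue_rV_box n (a b : 'rV[R]_n) : (forall i, a ord0 i <= b ord0 i) ->
  lebesgue_rV n [set x : 'rV[R]_n | forall i, a ord0 i <= x ord0 i <= b ord0 i]
  = (\prod_(i < n) (b ord0 i - a ord0 i))%:E.
Proof.
elim: n => [|n IHn] in a b * => ab.
  rewrite big_ord0 /= diracE mem_set//= => -[].
  by [].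
rewrite /= /lebesgue_cons /pushforward big_ord_recl EFinM.
pose a' := \row_j a ord0 (lift ord0 j); pose b' := \row_j b ord0 (lift ord0 j).
rewrite [X in ((_ \x _) X)%E](_ : _ = `[a ord0 ord0, b ord0 ord0] `*`
    [set x : 'rV[R]_n | forall i, a' ord0 i <= x ord0 i <= b' ord0 i]); last first.
  apply/seteqP; split=> -[t v] /= => [H|[H0 H1] i].
    split; first by have := H ord0; rewrite rV_cons0 in_itv.
    by move=> i; have := H (lift ord0 i); rewrite rV_consS !mxE.
  case: (unliftP ord0 i) => [j|] ->; last first.
    by rewrite rV_cons0; move: H0; rewrite in_itv.
  by rewrite rV_consS; have := H1 j; rewrite !mxE.
rewrite product_measure1E//; last first.
  rewrite (_ : [set x | _] = \bigcap_(i in [set: 'I_n])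
      ((fun x : 'rV[R]_n => x ord0 i : measurableTypeR R) @^-1`
        `[a' ord0 i, b' ord0 i])); last first.
    by apply/seteqP; split=> x /= H i; have := H i; rewrite /= ?in_itv/=; auto.
  apply: fin_bigcap_measurable => // i _.
  by rewrite -[X in measurable X]setTI; exact: measurable_coord.
rewrite IHn => [|i]; last by rewrite !mxE.
congr (_ * _)%E.
  apply: etrans (lebesgue_measure_itv _) _; rewrite /= lte_fin.
  case: ltP => // ba; apply/eqP.
  by rewrite eqe eq_sym subr_eq0 eq_le ba ab.
by congr (_%:E); apply: eq_bigr => i _; rewrite !mxE.
Qed.

End lebesgue_rV.

Section sobolev.
Context (R : realType) (N : nat).
Implicit Types (u w phi : 'rV[R]_N -> R) (x a : 'rV[R]_N).

Local Notation leb := (@lebesgue_rV R N).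

Definition enorm x : R := Num.sqrt (\sum_(i < N) x ord0 i ^+ 2).

Definition partial (i : 'I_N) u : 'rV[R]_N -> R :=
  fun x => 'D_(delta_mx ord0 i : 'rV[R]_N) u x.

Definition laplacian u : 'rV[R]_N -> R :=
  fun x => \sum_(i < N) partial i (partial i u) x.

(* C^oo: the iterated partial derivatives of all orders exist and are continuous *)
Definition smooth u : Prop := forall s : seq 'I_N,
  continuous (foldr partial u s) /\
  forall i x, derivable (foldr partial u s) x (delta_mx ord0 i : 'rV[R]_N).

Definition test_function u : Prop :=
  smooth u /\ compact (closure [set x | u x != 0]).

(* D22 u w: u is in D^{2,2}(R^N) and w = Delta u.
   For N >= 5, the Sobolev inequality makes every sequence of test functions
   that is Cauchy for ||Delta .||_2 converge in L^1_loc, so the completion is a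
   space of functions (modulo equality a.e.): u is the L^1_loc limit of such a
   sequence (phi_k), and w is the L^2 limit of (Delta phi_k). Testing against
   C_0^oo shows that w is the distributional Laplacian of u, hence it is
   determined a.e. by u. *)
Definition D22 u w : Prop :=
  [/\ measurable_fun setT u, measurable_fun setT w &
    exists phi : nat -> 'rV[R]_N -> R,
      [/\ forall k, test_function (phi k),
          forall K : set 'rV[R]_N, compact K ->
            (\int[leb]_(x in K) (`|phi k x - u x|)%:E)%E @[k --> \oo] --> 0%E &
          (\int[leb]_x (`|laplacian (phi k) x - w x| ^+ 2)%:E)%E @[k --> \oo]
            --> 0%E]].

Definition nonzero u : Prop := ~ {ae leb, forall x, u x = 0}.

(* The junk value 0 at the two poles x = a1, a2 is irrelevant: they are null. *)
Definition weight a1 a2 x : R :=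
  enorm (a1 - a2) ^+ 4 / (enorm (x - a1) ^+ 4 * enorm (x - a2) ^+ 4).

Definition weighted_norm2 a1 a2 u : \bar R :=
  (\int[leb]_x (weight a1 a2 x * `|u x| ^+ 2)%:E)%E.

Definition norm2 w : \bar R := (\int[leb]_x (`|w x| ^+ 2)%:E)%E.

(* the quotient, for w = Delta u *)
Definition rayleigh a1 a2 u w : \bar R := (norm2 w / weighted_norm2 a1 a2 u)%E.

Definition rayleigh_inf a1 a2 : \bar R :=
  ereal_inf [set q | exists u w,
    [/\ D22 u w, nonzero u & q = rayleigh a1 a2 u w]].

End sobolev.

(* Main.v *)
From HB Require Import structures.
Require Import Defs.
From mathcomp Require Import all_boot all_order all_algebra.
From mathcomp Require Import ring lra.
From mathcomp Require Import all_classical all_reals all_analysis.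
From mathcomp Require Import measurable_realfun.
Import Order.TTheory GRing.Theory Num.Theory.
Import numFieldNormedType.Exports.
Set Implicit Arguments. Unset Strict Implicit. Unset Printing Implicit Defensive.
Local Open Scope classical_set_scope.
Local Open Scope ring_scope.

(** Put [s = (N - 4) / 4] and [Phi = (|x - a1|^2 |x - a2|^2)^(- s)].  Near each pole
    [Phi] behaves like the virtual extremal of the one-pole Rellich inequality, and
    [Delta^2 Phi / Phi] is exactly the claimed constant times the two-pole weight.

    The inequality is a completion of squares.  With [f = - Delta Phi / Phi], which is
    positive, [(Delta u)^2 - (Delta^2 Phi / Phi) u^2] equals
    [(Delta u + f u)^2 + 2 f |grad u - u grad Phi / Phi|^2] up to a divergence, whose
    integral vanishes ([integral_rellich_weight], [integral_divergence]).  Since [Phi]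
    is singular, the squared distances are first increased by [eps], in which case the
    resulting weight exceeds the regularised two-pole weight
    ([rellich_weight_bipolar]), and Fatou's lemma removes [eps] ([rellich_bipolar]).

    The constant is not attained, because the vector field behind the second square can
    be perturbed.  Adding [tau] times a field parallel to the gradient of
    [ln (|x - a1| / |x - a2|)] produces a term [tau * gain], positive off the poles, at
    a cost of order [tau ^ 2] times the two-pole weight, hence of order [tau ^ 2] times
    the energy ([rellich_bipolar_improved]).  Inequalities between a weighted norm and
    the energy pass from test functions to their completion ([D22_weighted]); for an
    extremal function the main terms cancel, the integral of [gain * u ^ 2] is [O(tau)],
    hence zero, and [u] vanishes almost everywhere ([rayleigh_neq]).

    The constant is optimal, as shown by [(|x - a1|^2 + e)^(- s)] cut off near [a1].
    Its energy is the sharp constant times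
    [J(e) = int (|x - a1|^2 + e)^(- N / 2) chi^2], plus an error controlled by
    [I(e) = int e (|x - a1|^2 + e)^(- N / 2 - 1) chi^2].  The divergence theorem turns
    [I(e)] into an integral over the region where the cutoff [chi] varies, so that
    [I(e)] lies between two positive constants for [e <= 1] ([flux_identity]); the same quantity
    bounds [J(e / 2) - J(e)] from below, so [J(e)] diverges while the error stays
    bounded ([concentrating_family]).  On a small ball around [a1] the factor of the
    weight due to [a2] is nearly constant, and the quotient tends to the constant
    ([rayleigh_inf_le]). *)

(** * Continuous functions on R^n and Lebesgue measure *)

Section topology_rV.
Context (R : realType) (n : nat).
Implicit Types (x : 'rV[R]_n) (M : R).

Lemma coord_le_norm x i : `|x ord0 i| <= `|x|.
Proof.
have /mapP[j _ ->] : `|x ord0 i| \in [seq `|x v.1 v.2| | v : 'I_1 * 'I_n].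
  by apply/mapP; exists (ord0, i) => //=; rewrite mem_enum.
by rewrite [leRHS]/Num.norm /= mx_normrE; apply/bigmax_geP; right => /=; exists j.
Qed.

Lemma norm_le_coord x M : 0 <= M -> (forall i, `|x ord0 i| <= M) -> `|x| <= M.
Proof.
move=> M0 h; rewrite [leLHS]/Num.norm /= mx_normrE; apply/bigmax_leP; split=> //.
by move=> [i j] _ /=; rewrite (ord1 i).
Qed.

Definition cube M : set 'rV[R]_n := [set x | forall i, `|x ord0 i| <= M].

Lemma cubeE M : cube M = [set x | forall i,
  (const_mx (- M) : 'rV[R]_n) ord0 i <= x ord0 i <= (const_mx M : 'rV[R]_n) ord0 i].
Proof.
by apply/seteqP; split=> x h i; have := h i; rewrite !mxE ler_norml.
Qed.

Lemma continuous_coord i : continuous (fun x : 'rV[R]_n => x ord0 i).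
Proof. exact: coord_continuous. Qed.

Lemma compact_cube M : compact (cube M).
Proof.
have := @rV_compact R n (fun=> `[- M, M]%classic) (fun=> @segment_compact _ _ _).
by congr compact; apply/seteqP; split=> x h i; have := h i; rewrite /= in_itv/= ler_norml.
Qed.

Lemma measurable_cube M : measurable (cube M).
Proof.
rewrite (_ : cube M = \bigcap_(i in [set: 'I_n])
    ((fun x : 'rV[R]_n => x ord0 i : measurableTypeR R) @^-1` `[- M, M])).
  apply: fin_bigcap_measurable => // i _.
  by rewrite -[X in measurable X]setTI; exact: measurable_coord.
by apply/seteqP; split=> x /= H i; have := H i; rewrite /= ?in_itv/= ler_norml; auto.
Qed.

Lemma lebesgue_cube_lty M : (lebesgue_rV R n (cube M) < +oo)%E.
Proof.
have [M0|M0] := lerP 0 M.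
  rewrite cubeE lebesgue_rV_box ?ltry// => i; rewrite !mxE; lra.
apply: (@le_lt_trans _ _ (lebesgue_rV R n (cube 0))).
  apply: le_measure; rewrite ?inE; do ?exact: measurable_cube.
  by move=> x h i; apply: (le_trans (h i)); exact: ltW.
by rewrite cubeE lebesgue_rV_box ?ltry// => i; rewrite !mxE oppr0.
Qed.

(** The balls with rational centre and rational radius form a countable basis
    consisting of cubes, so open sets are generated by the coordinates. *)
Lemma open_measurable_rV (U : set 'rV[R]_n) : open U -> measurable U.
Proof.
move=> oU.
pose c (a : 'rV[rat]_n * nat) : set 'rV[R]_n :=
  \bigcap_(i in [set: 'I_n]) ((fun x : 'rV[R]_n => x ord0 i : measurableTypeR R)
     @^-1` (ball (ratr (a.1 ord0 i) : R) (a.2.+1%:R^-1 : R))).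
have mc a : measurable (c a).
  apply: fin_bigcap_measurable => // i _; rewrite -[X in measurable X]setTI.
  by apply: measurable_coord => //; exact: measurable_ball.
have -> : U = \bigcup_(a in [set a | c a `<=` U]) c a.
  apply/seteqP; split=> [x Ux|x [a /= aU] ax]; last exact: aU.
  have /nbhs_ballP[e /= e0 xeU] : nbhs x U by exact: open_nbhs_nbhs.
  have [k ke] : exists k : nat, k.+1%:R^-1 < e / 2.
    have /ltr_add_invr[k]: (0 : R) < e / 2 by rewrite divr_gt0.
    by rewrite add0r; exists k.
  have /choice[q hq] : forall i : 'I_n, exists q : rat,
      `|x ord0 i - ratr q| < (k.+1%:R^-1 : R).
    move=> i; have /rat_in_itvoo[q] : x ord0 i - k.+1%:R^-1 < x ord0 i + k.+1%:R^-1.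
      by rewrite ltrBlDr -addrA ltrDl addr_gt0 ?invr_gt0.
    by rewrite in_itv/= => h; exists q; rewrite ltr_distlC.
  exists (\row_i q i, k) => /=.
    move=> z cz; apply: xeU; rewrite mx_norm_ball /ball_ /=.
    apply: (@le_lt_trans _ _ (k.+1%:R^-1 + k.+1%:R^-1)); last first.
      by rewrite [ltRHS]splitr ltrD.
    apply: norm_le_coord => [|i]; first by rewrite addr_ge0.
    have := cz i I; rewrite /= /ball /= mxE => zi; rewrite !mxE.
    rewrite (_ : x _ _ - z _ _ = (x ord0 i - ratr (q i)) + (ratr (q i) - z ord0 i)).
      by rewrite (le_trans (ler_normD _ _))// lerD ?ltW.
    ring.
  by move=> i _ /=; rewrite /ball /= mxE distrC.
rewrite bigcup_mkcond; apply: countable_bigcupT_measurable => [|a]; first exact: countableP.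
by case: ifPn.
Qed.

Lemma continuous_measurable_rV (f : 'rV[R]_n -> R) :
  continuous f -> measurable_fun setT f.
Proof.
move=> cf; apply: (measurability _ (RGenOpens.measurableE R)) => //.
move=> _ [_ [a [b ->] <-]]; rewrite setTI; apply: open_measurable_rV.
by move/continuousP : cf; apply; exact: interval_open.
Qed.

Lemma lebesgue_set1 (hn : (0 < n)%N) x : lebesgue_rV R n [set x] = 0%E.
Proof.
rewrite (_ : [set x] = [set y | forall i, x ord0 i <= y ord0 i <= x ord0 i]).
  rewrite lebesgue_rV_box//; case: n hn x => // m _ x.
  by rewrite big_ord_recl subrr mul0r.
apply/seteqP; split=> [y -> i|y h]; first by rewrite lexx.
by apply/rowP => i; apply/eqP; rewrite eq_le andbC; exact: h.
Qed.

Lemma measurable_rV_set1 x : measurable [set x].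
Proof.
rewrite -[X in measurable X]setCK; apply: measurableC.
apply: open_measurable_rV; apply: closed_openC; apply: accessible_closed_set1.
by apply: hausdorff_accessible; exact: norm_hausdorff.
Qed.

End topology_rV.

Section bounded_support.
Context (R : realType) (n : nat).
Implicit Types (f g : 'rV[R]_n -> R).

(** Support in a cube instead of a compact closure: integrability and the
    fundamental theorem of calculus only see the cube. *)
Definition bsupp f := exists M, forall x, ~ cube M x -> f x = 0.

Lemma bsuppM f g : bsupp f -> bsupp (fun x => f x * g x).
Proof. by move=> [M h]; exists M => x /h ->; rewrite mul0r. Qed.

Lemma bsuppMr f g : bsupp f -> bsupp (fun x => g x * f x).
Proof. by move=> [M h]; exists M => x /h ->; rewrite mulr0. Qed.

Lemma bsuppD f g : bsupp f -> bsupp g -> bsupp (fun x => f x + g x).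
Proof.
move=> [M h] [M' h']; exists (Num.max M M') => x hx; rewrite h ?h' ?addr0//.
- by move=> c; apply: hx => i; apply: (le_trans (c i)); rewrite le_max lexx orbT.
- by move=> c; apply: hx => i; apply: (le_trans (c i)); rewrite le_max lexx.
Qed.

Lemma bsupp_sum (I : Type) (r : seq I) (F : I -> 'rV[R]_n -> R) :
  (forall i, bsupp (F i)) -> bsupp (fun x => \sum_(i <- r) F i x).
Proof.
move=> h; elim: r => [|i r [M hM]]; first by exists 0 => x _; rewrite big_nil.
have [M' h'] := bsuppD (h i) (ex_intro _ M hM : bsupp (fun x => \sum_(i <- r) F i x)).
by exists M' => x /h'; rewrite big_cons.
Qed.

Lemma continuous_bounded_cube f M : continuous f ->
  exists B, forall x, cube M x -> `|f x| <= B.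
Proof.
move=> cf.
have /compact_bounded[B [_ hB]] :=
  continuous_compact (continuous_subspaceT cf) (@compact_cube R n M).
by exists (B + 1) => x hx; apply: hB; [rewrite ltrDl|exists x].
Qed.

Lemma integrable_cube f M : continuous f ->
  (lebesgue_rV R n).-integrable (cube M) (EFin \o f).
Proof.
move=> cf; apply: measurable_bounded_integrable.
- exact: measurable_cube.
- exact: lebesgue_cube_lty.
- by apply: measurable_funTS; exact: continuous_measurable_rV.
- have [B hB] := continuous_bounded_cube M cf.
  by exists B; split; rewrite ?num_real // => y By x hx; apply: (le_trans (hB _ hx)); exact: ltW.
Qed.

Lemma bsupp_restrict f M : (forall x, ~ cube M x -> f x = 0) ->
  (EFin \o f) \_ (cube M) = (EFin \o f).
Proof.
move=> h; apply/funext => x; rewrite patchE; case: ifPn => // /negP hx /=.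
by rewrite h// => c; apply: hx; rewrite inE.
Qed.

Lemma integrable_bsupp f : continuous f -> bsupp f ->
  (lebesgue_rV R n).-integrable setT (EFin \o f).
Proof.
move=> cf [M hM]; rewrite -(bsupp_restrict hM).
exact: (integrable_mkcond _ (@measurable_cube R n M)).1 (integrable_cube M cf).
Qed.

Lemma test_function_bsupp f : test_function f -> bsupp f.
Proof.
move=> [_ /compact_bounded[B [_ hB]]]; exists (B + 1) => x hx.
apply: contrapT => /eqP fx; apply: hx => i; apply: (le_trans (coord_le_norm _ _)).
by apply: hB; [rewrite ltrDl|exact: subset_closure].
Qed.

Lemma bsupp_test_function f : smooth f -> bsupp f -> test_function f.
Proof.
move=> sf [M hM]; split=> //; apply: (subclosed_compact _ (@compact_cube R n M)).
  exact: closed_closure.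
have clc := compact_closed (@norm_hausdorff R 'rV[R]_n) (@compact_cube R n M).
rewrite [X in _ `<=` X]((closure_id _).1 clc).
by apply: closure_subset => x /= /eqP fx; apply: contrapT => /hM.
Qed.

End bounded_support.

(** * Smooth functions *)

Section smooth_functions.
Context (R : realType) (N : nat).
Implicit Types (u v : 'rV[R]_N -> R) (i j : 'I_N).

Local Notation e i := (delta_mx ord0 i : 'rV[R]_N).

Definition pderivable u := forall i x, derivable u x (e i).

(** [smooth] speaks of all words in the partial derivatives.  Stability under products
    and compositions is an induction on the number of derivatives, for which this
    layered form is the right one ([smoothP]). *)
Fixpoint Ck k u : Prop := continuous u /\
  if k is k'.+1 then pderivable u /\ forall i, Ck k' (partial i u) else True.

Lemma Ck_cont k u : Ck k u -> continuous u.
Proof. by case: k => [|k] []. Qed.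

Lemma CkW k u : Ck k.+1 u -> Ck k u.
Proof.
elim: k u => [|k IH] u; first by case.
by move=> [cu [du h]]; do 2 split=> //; move=> i; exact/IH/h.
Qed.

Lemma smoothP u : smooth u <-> forall k, Ck k u.
Proof.
split=> [su k|h s].
  elim: k u su => [|k IH] u su; first by split=> //; exact: (su [::]).1.
  split; first exact: (su [::]).1.
  split=> [i x|i]; first exact: (su [::]).2.
  by apply: IH => s; have := su (rcons s i); rewrite foldr_rcons.
have : Ck (size s).+1 u by [].
elim/last_ind: s u {h} => [|s i IH] u; first by move=> [cu [du _]].
by rewrite size_rcons foldr_rcons => -[_ [_ hi]]; exact/IH/hi.
Qed.

Lemma smooth_cont u : smooth u -> continuous u.
Proof. by move=> /smoothP/(_ 0%N)/Ck_cont. Qed.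

Lemma smooth_pderivable u : smooth u -> pderivable u.
Proof. by move=> /smoothP/(_ 1%N)[_ []]. Qed.

Lemma smooth_partial u i : smooth u -> smooth (partial i u).
Proof. by move=> /smoothP h; apply/smoothP => k; have [_ [_ hi]] := h k.+1; exact: hi. Qed.

Lemma is_partial u i x : pderivable u -> is_derive x (e i) u (partial i u x).
Proof. by move=> du; exact: derivableP. Qed.

Lemma partialE u i (g : 'rV[R]_N -> R) :
  (forall x, is_derive x (e i) u (g x)) -> partial i u = g.
Proof. by move=> h; apply/funext => x; rewrite /partial; have [_ ->] := h x. Qed.

Lemma pderivable_cst (c : R) : pderivable (fun _ => c).
Proof. by move=> i x; exact: derivable_cst. Qed.

Lemma partial_cst i (c : R) : partial i (fun _ => c) = (fun _ => 0).
Proof. by apply: partialE => x; exact: is_derive_cst. Qed.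

Lemma is_derive_coord i j x :
  is_derive x (e i) (fun y : 'rV[R]_N => y ord0 j) (i == j)%:R.
Proof.
have h : (fun t => t^-1 *: (((fun y : 'rV[R]_N => y ord0 j) \o shift x) (t *: e i)
    - x ord0 j)) @ 0^' --> ((i == j)%:R : R).
  apply: cvg_near_cst; near=> t => /=.
  rewrite !mxE addrK /= eq_sym.
  have t0 : t != 0 by near: t; exact: nbhs_dnbhs_neq.
  by rewrite [_ *: _]mulrA mulVf ?mul1r.
split; first by apply/cvg_ex; exists (i == j)%:R; exact: h.
by apply: cvg_lim => //; exact: h.
Unshelve. all: by end_near. Qed.

Lemma pderivableD u v : pderivable u -> pderivable v ->
  pderivable (fun x => u x + v x).
Proof. by move=> du dv i x; exact: derivableD. Qed.

Lemma partialD u v i : pderivable u -> pderivable v ->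
  partial i (fun x => u x + v x) = (fun x => partial i u x + partial i v x).
Proof.
by move=> du dv; apply: partialE => x; apply: is_deriveD; exact: is_partial.
Qed.

Lemma pderivableM u v : pderivable u -> pderivable v ->
  pderivable (fun x => u x * v x).
Proof. by move=> du dv i x; exact: derivableM. Qed.

Lemma partialM u v i : pderivable u -> pderivable v ->
  partial i (fun x => u x * v x) =
  (fun x => u x * partial i v x + partial i u x * v x).
Proof.
move=> du dv; apply: partialE => x.
have := is_deriveM (is_partial i x du) (is_partial i x dv).
by rewrite /GRing.scale /= [v x * _]mulrC.
Qed.

(** The restriction to the line through [x] directed by [e i] reduces the claim to the
    chain rule in one variable. *)
Lemma is_derive_comp_real (h : R -> R) u i x (dh du : R) :
  is_derive (u x) 1 h dh -> is_derive x (e i) u du ->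
  is_derive x (e i) (fun y => h (u y)) (dh * du).
Proof.
move=> Dh [dux duE]; pose phi t := u (t *: e i + x).
have Dphi : is_derive (0 : R) 1 phi du.
  split; first exact: (derivable1P u x (e i)).1 dux.
  rewrite -duE /derive (_ : (fun t => t^-1 *: ((phi \o shift 0) _ - _)) =
    (fun t => t^-1 *: ((u \o shift x) (t *: e i) - u x)))//.
  by apply/funext => t; rewrite /= /phi addr0 scale0r add0r [_%:A]mulr1.
have phi0 : phi 0 = u x by rewrite /phi scale0r add0r.
have [dc cE] : is_derive (0 : R) 1 (h \o phi) (dh * du).
  by apply: is_derive1_comp; rewrite phi0.
split; first exact: (derivable1P (fun y => h (u y)) x (e i)).2 dc.
rewrite -cE /derive [in RHS](_ : (fun t => t^-1 *: (((h \o phi) \o shift 0) _ - _)) =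
  (fun t => t^-1 *: (((fun y => h (u y)) \o shift x) (t *: e i) - h (u x))))//.
by apply/funext => t; rewrite /= /phi addr0 scale0r add0r [_%:A]mulr1.
Qed.

Section comp.
Variables (h dh : R -> R) (u : 'rV[R]_N -> R).
Hypothesis Dh : forall x, is_derive (u x) 1 h (dh (u x)).

Lemma pderivable_comp : pderivable u -> pderivable (fun x => h (u x)).
Proof.
by move=> du i x; have [] := is_derive_comp_real (Dh x) (is_partial i x du).
Qed.

Lemma partial_comp i : pderivable u ->
  partial i (fun x => h (u x)) = (fun x => dh (u x) * partial i u x).
Proof.
move=> du; apply: partialE => x.
exact: (is_derive_comp_real (Dh x) (is_partial i x du)).
Qed.

Lemma continuous_comp_real : continuous u -> continuous (fun x => h (u x)).
Proof.
move=> cu x; apply: (@continuous_comp _ _ _ u h); first exact: cu.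
have [dhx _] := Dh x.
exact/differentiable_continuous/derivable1_diffP.
Qed.

End comp.

Lemma Ck_cst k c : Ck k (fun _ => c).
Proof.
elim: k c => [|k IH] c; first by split=> // x; exact: cst_continuous.
split; first by move=> x; exact: cst_continuous.
by split=> [|i]; [exact: pderivable_cst|rewrite partial_cst].
Qed.

Lemma CkD k u v : Ck k u -> Ck k v -> Ck k (fun x => u x + v x).
Proof.
elim: k u v => [|k IH] u v [cu hu] [cv hv].
  by split=> // x; exact: (cvgD (cu x) (cv x)).
split; first by move=> x; exact: (cvgD (cu x) (cv x)).
case: hu hv => du hu [dv hv]; split=> [|i]; first exact: pderivableD.
by rewrite partialD//; apply: IH; [exact: hu|exact: hv].
Qed.

Lemma CkM k u v : Ck k u -> Ck k v -> Ck k (fun x => u x * v x).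
Proof.
elim: k u v => [|k IH] u v hu hv; move: (hu) (hv) => [cu hu'] [cv hv'].
  by split=> // x; exact: (cvgM (cu x) (cv x)).
split; first by move=> x; exact: (cvgM (cu x) (cv x)).
case: hu' hv' => du hu' [dv hv']; split=> [|i]; first exact: pderivableM.
by rewrite partialM//; apply: CkD; apply: IH;
  [exact: CkW|exact: hv'|exact: hu'|exact: CkW].
Qed.

Lemma smooth_cst c : smooth (fun _ : 'rV[R]_N => c).
Proof. by apply/smoothP => k; exact: Ck_cst. Qed.

Lemma smooth_coord j : smooth (fun x : 'rV[R]_N => x ord0 j).
Proof.
apply/smoothP => -[|k]; first by split=> //; exact: continuous_coord.
split; first exact: continuous_coord.
split=> [i x|i]; first by have [] := is_derive_coord i j x.
rewrite (_ : partial i _ = fun _ => (i == j)%:R); first exact: Ck_cst.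
by apply: partialE => x; exact: is_derive_coord.
Qed.

Lemma smoothD u v : smooth u -> smooth v -> smooth (fun x => u x + v x).
Proof. by move=> /smoothP hu /smoothP hv; apply/smoothP => k; exact: CkD. Qed.

Lemma smoothM u v : smooth u -> smooth v -> smooth (fun x => u x * v x).
Proof. by move=> /smoothP hu /smoothP hv; apply/smoothP => k; exact: CkM. Qed.

Lemma smoothN u : smooth u -> smooth (fun x => - u x).
Proof.
move=> su; rewrite (_ : (fun x => - u x) = (fun x => -1 * u x)).
  exact: (smoothM (smooth_cst _) su).
by apply/funext => x; rewrite mulN1r.
Qed.

Lemma smoothB u v : smooth u -> smooth v -> smooth (fun x => u x - v x).
Proof. by move=> su sv; exact: (smoothD su (smoothN sv)). Qed.

Lemma smoothX u k : smooth u -> smooth (fun x => u x ^+ k).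
Proof.
move=> su; elim: k => [|k IH]; first exact: smooth_cst.
rewrite (_ : (fun x => _) = (fun x => u x * u x ^+ k)); first exact: (smoothM su IH).
by apply/funext => x; rewrite exprS.
Qed.

Lemma smooth_sum (I : Type) (r : seq I) (F : I -> 'rV[R]_N -> R) :
  (forall k, smooth (F k)) -> smooth (fun x => \sum_(i <- r) F i x).
Proof.
move=> h; elim: r => [|i r IH].
  rewrite (_ : (fun x => _) = (fun x => 0)); first exact: smooth_cst.
  by apply/funext => x; rewrite big_nil.
rewrite (_ : (fun x => _) = (fun x => F i x + \sum_(i <- r) F i x)); first exact: (smoothD (h i) IH).
by apply/funext => x; rewrite big_cons.
Qed.

(** The partial derivatives contain the exponential again, so each order of
    differentiability yields the next one; likewise for the inverse below. *)
Lemma smooth_expR u : smooth u -> smooth (fun x => expR (u x)).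
Proof.
move=> /smoothP hu; apply/smoothP => k; have := hu k; elim: k => [|k IH] h.
  by split=> //; apply: (continuous_comp_real (dh := expR)) => //; case: h.
move: (h) => [cu [du h']]; split; first exact: (continuous_comp_real (dh := expR)).
split=> [|i]; first exact: (pderivable_comp (dh := expR)).
rewrite (partial_comp (dh := expR))//; apply: CkM; last exact: h'.
exact/IH/CkW.
Qed.

Lemma is_derive1_inv (t : R) : t != 0 -> is_derive t 1 (fun y => y^-1) (- t ^- 2).
Proof.
move=> t0; have := @is_deriveV R (@id R) t 1 1 t0 (is_derive_id _ _).
by rewrite /GRing.scale /= mulr1.
Qed.

Lemma smooth_inv u : smooth u -> (forall x, u x != 0) ->
  smooth (fun x => (u x)^-1).
Proof.
move=> /smoothP hu u0; apply/smoothP => k.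
have D x : is_derive (u x) 1 (fun y => y^-1) (- (u x) ^- 2) by exact: is_derive1_inv.
have D' := continuous_comp_real (dh := fun t => - t ^- 2) D.
have := hu k; elim: k => [|k IH] h.
  by split=> //; apply: D'; case: h.
move: (h) => [cu [du h']]; split; first exact: D'.
split=> [|i]; first exact: (pderivable_comp (dh := fun t => - t ^- 2)).
rewrite (partial_comp (dh := fun t => - t ^- 2))//; apply: CkM; last exact: h'.
rewrite (_ : (fun x => - _) = (fun x => -1 * ((u x)^-1 * (u x)^-1))).
  by apply: CkM; [exact: Ck_cst|apply: CkM; exact/IH/CkW].
by apply/funext => x; rewrite expr2 invfM mulN1r.
Qed.

Lemma smooth_ln u : smooth u -> (forall x, 0 < u x) ->
  smooth (fun x => ln (u x)).
Proof.
move=> su u0; have /smoothP hi : smooth (fun x => (u x)^-1).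
  by apply: smooth_inv => // x; rewrite gt_eqF.
have D x : is_derive (u x) 1 (@ln R) ((u x)^-1) by exact: is_derive1_ln.
have D' := continuous_comp_real (dh := fun t => t^-1) D (smooth_cont su).
apply/smoothP => -[|k]; first by split.
move/smoothP : (su) => hu; have [cu [du h']] := hu k.+1; split=> //.
split=> [|i]; first exact: (pderivable_comp (dh := fun t => t^-1)).
by rewrite (partial_comp (dh := fun t => t^-1))//; apply: CkM; [exact: hi|exact: h'].
Qed.

Lemma laplacianE u x : laplacian u x = \sum_(i < N) partial i (partial i u) x.
Proof. by []. Qed.

End smooth_functions.

(* [done] and unification would otherwise unfold these down to limits. *)
#[global] Opaque smooth pderivable partial laplacian.

(** * The divergence theorem *)

Section divergence.
Context (R : realType).

(** Along an affine map, a derivative in the image direction pulls back: this is how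
    partial derivatives restrict to the slices of [rV_cons]. *)
Lemma is_derive_affine (V V' W : normedModType R) (L : V -> V') (f : V' -> W)
    (x v : V) (v' : V') (d : W) :
  (forall h : R, L (h *: v + x) = h *: v' + L x) ->
  is_derive (L x) v' f d -> is_derive x v (f \o L) d.
Proof.
move=> LE [df dE].
have E : (fun t : R => t^-1 *: (((f \o L) \o shift x) (t *: v) - (f \o L) x)) =
         (fun t => t^-1 *: ((f \o shift (L x)) (t *: v') - f (L x))).
  by apply/funext => t; rewrite /= LE.
by split; [rewrite /derivable E|rewrite -dE /derive E].
Qed.

Lemma is_derive_outside n (X dX : 'rV[R]_n -> R) i M x :
  (forall x, is_derive x (delta_mx ord0 i : 'rV[R]_n) X (dX x)) ->
  (forall x, ~ cube M x -> X x = 0) -> ~ cube M x -> dX x = 0.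
Proof.
move=> DX X0 hx.
have e0 : (delta_mx ord0 i : 'rV[R]_n) != 0.
  by apply/eqP => /rowP/(_ i); rewrite !mxE !eqxx/= => /eqP; rewrite oner_eq0.
have oC : open (~` (cube M : set 'rV[R]_n)).
  apply: closed_openC.
  exact: (compact_closed (@norm_hausdorff R 'rV[R]_n) (@compact_cube R n M)).
have nX : \forall a \near x, cst (0 : R) a = X a.
  by apply: filterS (open_nbhs_nbhs (conj oC hx)) => y /X0.
have [_ <-] := DX x.
have D0 : is_derive x (delta_mx ord0 i : 'rV[R]_n) (cst (0 : R)) 0.
  exact: is_derive_cst.
by have [_ ->] := near_eq_is_derive nX D0.
Qed.

Lemma integral_derive_bsupp1 (g dg : R -> R) (M : R) : continuous dg ->
  (forall t : R, is_derive t 1 g (dg t)) ->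
  (forall t : R, M < `|t| -> g t = 0) -> (forall t : R, M < `|t| -> dg t = 0) ->
  (\int[lebesgue_measure]_t (dg t)%:E = 0)%E.
Proof.
move=> cdg Dg g0 dg0; pose K : R := `|M| + 1.
have KM : M < K by rewrite (le_lt_trans (ler_norm _))// ltrDl.
have K0 : 0 < K by rewrite ltr_wpDl.
have -> : (\int[lebesgue_measure]_t (dg t)%:E =
           \int[lebesgue_measure]_(t in `[(- K)%R, K%R]) (dg t)%:E)%E.
  rewrite [RHS]integral_mkcond; apply: eq_integral => t _.
  rewrite patchE; case: ifPn => // /negP ht; rewrite dg0//.
  apply: (lt_le_trans KM); rewrite leNgt; apply/negP => /ltW h.
  by apply: ht; rewrite inE /= in_itv/= -ler_norml.
have cg : continuous g.
  move=> t; apply/differentiable_continuous/derivable1_diffP.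
  by have [] := Dg t.
rewrite (@continuous_FTC2 _ dg g)//.
- by rewrite !g0 ?subee// ?normrN gtr0_norm.
- by rewrite gtrN.
- exact: continuous_subspaceT.
- split=> [t _||]; first by have [] := Dg t.
    by apply: cvg_at_right_filter; exact: cg.
  by apply: cvg_at_left_filter; exact: cg.
- by move=> t _; rewrite derive1E; have [] := Dg t.
Qed.

Lemma rV_cons_addl n (h t : R) (v : 'rV[R]_n) :
  rV_cons (h + t, v) = h *: delta_mx ord0 ord0 + rV_cons (t, v).
Proof.
apply/rowP => k; case: (unliftP ord0 k) => [j|] ->.
  by rewrite rV_consS [RHS]mxE rV_consS !mxE /= ?mulr0 ?add0r.
by rewrite rV_cons0 [RHS]mxE rV_cons0 !mxE /= mulr1.
Qed.

Lemma rV_cons_addr n (h t : R) (v w : 'rV[R]_n) j :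
  rV_cons (t, h *: delta_mx ord0 j + v) =
  h *: delta_mx ord0 (lift ord0 j) + rV_cons (t, v).
Proof.
apply/rowP => k; case: (unliftP ord0 k) => [l|] ->.
  by rewrite rV_consS [RHS]mxE rV_consS !mxE /= (inj_eq lift_inj).
by rewrite rV_cons0 [RHS]mxE rV_cons0 !mxE /= ?mulr0 ?add0r.
Qed.

Lemma continuous_rV_consl n (v : 'rV[R]_n) :
  continuous (fun t : R => rV_cons (t, v) : 'rV[R]_n.+1).
Proof.
move=> t; apply/cvgrPdist_le => e e0; apply/nbhs_ballP; exists e => //= s ts.
apply: norm_le_coord => [|k]; first exact: ltW.
rewrite [X in `|X|]mxE [in X in _ + X]mxE; case: (unliftP ord0 k) => [j|] ->.
  by rewrite !rV_consS subrr normr0 ltW.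
by rewrite !rV_cons0; exact: ltW.
Qed.

Lemma continuous_rV_consr n (t : R) :
  continuous (fun v : 'rV[R]_n => rV_cons (t, v) : 'rV[R]_n.+1).
Proof.
move=> v; have Fv : Filter (nbhs v) by exact: nbhs_filter.
apply/(@cvgrPdist_le _ _ _ _ Fv) => e e0; apply/nbhs_ballP; exists e => //= w.
rewrite mx_norm_ball /ball_ /= => vw.
apply: norm_le_coord => [|k]; first exact: ltW.
rewrite [X in `|X|]mxE [in X in _ + X]mxE; case: (unliftP ord0 k) => [j|] ->.
  rewrite !rV_consS (le_trans _ (ltW vw))//.
  by have := coord_le_norm (v - w) j; rewrite !mxE.
by rewrite !rV_cons0 subrr normr0 ltW.
Qed.

Lemma cube_rV_cons n M (t : R) (v : 'rV[R]_n) :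
  cube M (rV_cons (t, v)) <-> `|t| <= M /\ cube M v.
Proof.
split=> [h|[ht hv] k].
  split; first by have := h ord0; rewrite rV_cons0.
  by move=> j; have := h (lift ord0 j); rewrite rV_consS.
case: (unliftP ord0 k) => [j|] ->; first by rewrite rV_consS; exact: hv.
by rewrite rV_cons0.
Qed.

Lemma integral_lebesgue_rVS n (f : 'rV[R]_n.+1 -> R) :
  continuous f -> bsupp f ->
  (\int[lebesgue_rV R n.+1]_x (f x)%:E =
   \int[(lebesgue_measure \x lebesgue_rV R n)]_p (f (rV_cons p))%:E)%E /\
  ((lebesgue_measure \x lebesgue_rV R n)%E).-integrable setT
    (fun p => (f (rV_cons p))%:E).
Proof.
move=> cf bf.
have mf : measurable_fun setT (fun x => (f x)%:E).
  by apply/measurable_EFinP; exact: continuous_measurable_rV.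
have mc := @measurable_rV_cons R n.
have pushE (g : 'rV[R]_n.+1 -> \bar R) : (\int[lebesgue_rV R n.+1]_x g x =
    \int[pushforward (lebesgue_measure \x lebesgue_rV R n) (@rV_cons R n)]_x g x)%E.
  by apply: eq_measure_integral.
have intf : ((lebesgue_measure \x lebesgue_rV R n)%E).-integrable setT
    (fun p => (f (rV_cons p))%:E).
  apply/integrableP; split; first exact: (measurableT_comp mf mc).
  have /integrableP[_] := integrable_bsupp cf bf.
  rewrite pushE ge0_integral_pushforward//.
  exact: measurableT_comp.
split=> //; rewrite pushE integral_pushforward//.
Qed.

(** Fubini reduces the claim, along the coordinate in question, to the
    fundamental theorem of calculus on the line. *)
Lemma integral_derive_bsupp n (i : 'I_n) (X dX : 'rV[R]_n -> R) :
  continuous X -> continuous dX -> bsupp X ->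
  (forall x, is_derive x (delta_mx ord0 i : 'rV[R]_n) X (dX x)) ->
  (\int[lebesgue_rV R n]_x (dX x)%:E = 0)%E.
Proof.
elim: n i X dX => [[]//|n IH] i X dX cX cdX [M XM] DX.
have dXM x : ~ cube M x -> dX x = 0 by exact: is_derive_outside DX XM.
have [-> intdX] := integral_lebesgue_rVS cdX (ex_intro _ M dXM).
case: (unliftP ord0 i) => [j|] ij; last first.
  rewrite -integral21_prod_meas1//; apply: integral0_eq => v _.
  apply: (@integral_derive_bsupp1 (fun t => X (rV_cons (t, v)))
    (fun t => dX (rV_cons (t, v))) M).
  - by move=> t; apply: continuous_comp; [exact: continuous_rV_consl|exact: cdX].
  - move=> t; have := DX (rV_cons (t, v)); rewrite ij => D.
    apply: (is_derive_affine (L := fun t => rV_cons (t, v)) _ D) => h.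
    by rewrite [h *: 1]mulr1 rV_cons_addl.
  - by move=> t ht; apply: XM => /cube_rV_cons[]; rewrite leNgt ht.
  - by move=> t ht; apply: dXM => /cube_rV_cons[]; rewrite leNgt ht.
rewrite -integral12_prod_meas1//; apply: integral0_eq => t _.
apply: (IH j (fun v => X (rV_cons (t, v))) (fun v => dX (rV_cons (t, v)))).
- by move=> v; apply: continuous_comp; [exact: continuous_rV_consr|exact: cX].
- by move=> v; apply: continuous_comp; [exact: continuous_rV_consr|exact: cdX].
- by exists M => v hv; apply: XM => /cube_rV_cons[].
- move=> v; have := DX (rV_cons (t, v)); rewrite ij => D.
  apply: (is_derive_affine (L := fun v => rV_cons (t, v)) _ D) => h.
  by rewrite rV_cons_addr.
Qed.

Lemma integral_partial n (i : 'I_n) (u : 'rV[R]_n -> R) :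
  smooth u -> bsupp u -> (\int[lebesgue_rV R n]_x (partial i u x)%:E = 0)%E.
Proof.
move=> su bu; apply: (integral_derive_bsupp (smooth_cont su) _ bu).
  by apply: smooth_cont; exact: smooth_partial.
by move=> x; apply: is_partial; exact: smooth_pderivable.
Qed.

End divergence.

(** * Gradients and Laplacians *)

Ltac smooth_tac := lazymatch goal with
  | H : smooth ?f |- smooth ?f => exact H
  | H : smooth ?f |- smooth (fun x => ?f x) => exact H
  | H : forall i, smooth (?F i) |- smooth (fun x => ?F ?i x) => exact (H i)
  | H : forall i, smooth (?F i) |- smooth (?F ?i) => exact (H i)
  | |- smooth (fun x => @?a x + - @?b x) =>
      refine (smoothB (u := a) (v := b) _ _); smooth_tac
  | |- smooth (fun x => @?a x + @?b x) =>
      refine (smoothD (u := a) (v := b) _ _); smooth_tac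
  | |- smooth (fun x => @?a x * @?b x) =>
      refine (smoothM (u := a) (v := b) _ _); smooth_tac
  | |- smooth (fun x => - @?a x) => refine (smoothN (u := a) _); smooth_tac
  | |- smooth (fun x => (@?a x) ^+ ?k) => refine (smoothX k (u := a) _); smooth_tac
  | |- smooth (fun x => expR (@?a x)) => refine (smooth_expR (u := a) _); smooth_tac
  | |- smooth (fun x => \sum_(i <- ?r) @?F x i) =>
      refine (smooth_sum r (F := fun i x => F x i) _) => ?; smooth_tac
  | |- smooth (fun x => (x : matrix _ _ _) ord0 ?j) => exact: smooth_coord
  | |- smooth (fun x => partial ?i ?u x) => refine (smooth_partial i _); smooth_tac
  | |- smooth (partial ?i ?u) => refine (smooth_partial i _); smooth_tac
  | |- smooth (fun x => laplacian ?u x) =>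
      refine (smooth_sum _ (F := fun i => partial i (partial i u)) _) => ?; smooth_tac
  | |- smooth (fun _ => ?c) => exact: smooth_cst
  | _ => idtac
  end.

(* Keeps [ring] from comparing derivatives up to conversion. *)
Ltac generalize_partial := repeat match goal with
  | |- context [partial ?i ?u ?x] => move: (partial i u x) => ?
  end.

Section gradient.
Context (R : realType) (N : nat).
Implicit Types (u v w f : 'rV[R]_N -> R) (i : 'I_N) (x : 'rV[R]_N).

Definition gdot u v x : R := \sum_(i < N) partial i u x * partial i v x.

Lemma d_add u v i x : smooth u -> smooth v ->
  partial i (fun y => u y + v y) x = partial i u x + partial i v x.
Proof.
by move=> su sv; rewrite (partialD i (smooth_pderivable su) (smooth_pderivable sv)).
Qed.

Lemma d_mul u v i x : smooth u -> smooth v -> partial i (fun y => u y * v y) x =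
  u x * partial i v x + partial i u x * v x.
Proof.
by move=> su sv; rewrite (partialM i (smooth_pderivable su) (smooth_pderivable sv)).
Qed.

Lemma d_scale (c : R) u i x : smooth u ->
  partial i (fun y => c * u y) x = c * partial i u x.
Proof.
by move=> su; rewrite (d_mul _ _ (smooth_cst c) su) partial_cst mul0r addr0.
Qed.

Lemma d_opp u i x : smooth u -> partial i (fun y => - u y) x = - partial i u x.
Proof.
move=> su; rewrite (_ : (fun y => - u y) = (fun y => -1 * u y)).
  by rewrite d_scale// mulN1r.
by apply/funext => y; rewrite mulN1r.
Qed.

Lemma d_expR u i x : smooth u ->
  partial i (fun y => expR (u y)) x = expR (u x) * partial i u x.
Proof.
move=> su; rewrite (partial_comp (dh := expR) _ _ (smooth_pderivable su))//.
Qed.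

Lemma d_sub u v i x : smooth u -> smooth v ->
  partial i (fun y => u y - v y) x = partial i u x - partial i v x.
Proof. by move=> su sv; rewrite (d_add _ _ su (smoothN sv)) d_opp. Qed.

Lemma d_ln u i x : smooth u -> (forall y, 0 < u y) ->
  partial i (fun y => ln (u y)) x = (u x)^-1 * partial i u x.
Proof.
move=> su u0.
have D y : is_derive (u y) 1 (@ln R) ((u y)^-1) by exact: is_derive1_ln.
by rewrite (partial_comp (dh := fun t => t^-1) D)//; exact: smooth_pderivable.
Qed.

Lemma gdotC u v x : gdot u v x = gdot v u x.
Proof. by apply: eq_bigr => i _; rewrite mulrC. Qed.

Lemma gdotDl u v w x : smooth u -> smooth v ->
  gdot (fun y => u y + v y) w x = gdot u w x + gdot v w x.
Proof.
by move=> su sv; rewrite -big_split; apply: eq_bigr => i _; rewrite d_add// mulrDl.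
Qed.

Lemma gdotZl (c : R) u w x : smooth u ->
  gdot (fun y => c * u y) w x = c * gdot u w x.
Proof.
by move=> su; rewrite mulr_sumr; apply: eq_bigr => i _; rewrite d_scale// mulrA.
Qed.

Lemma gdotNl u w x : smooth u -> gdot (fun y => - u y) w x = - gdot u w x.
Proof.
by move=> su; rewrite -sumrN; apply: eq_bigr => i _; rewrite d_opp// mulNr.
Qed.

Lemma gdotMl u v w x : smooth u -> smooth v ->
  gdot (fun y => u y * v y) w x = u x * gdot v w x + v x * gdot u w x.
Proof.
move=> su sv; rewrite !mulr_sumr -big_split; apply: eq_bigr => i _ /=.
by rewrite (d_mul _ _ su sv); generalize_partial; ring.
Qed.

Lemma gdot_expl u w x : smooth u ->
  gdot (fun y => expR (u y)) w x = expR (u x) * gdot u w x.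
Proof.
by move=> su; rewrite mulr_sumr; apply: eq_bigr => i _; rewrite d_expR// mulrA.
Qed.

Lemma lapD u v x : smooth u -> smooth v ->
  laplacian (fun y => u y + v y) x = laplacian u x + laplacian v x.
Proof.
move=> su sv; rewrite -big_split; apply: eq_bigr => i _ /=.
rewrite (partialD i (smooth_pderivable su) (smooth_pderivable sv)).
exact: (d_add _ _ (smooth_partial i su) (smooth_partial i sv)).
Qed.

Lemma lapM u v x : smooth u -> smooth v ->
  laplacian (fun y => u y * v y) x =
  u x * laplacian v x + v x * laplacian u x + 2 * gdot u v x.
Proof.
move=> su sv; rewrite !mulr_sumr -!big_split; apply: eq_bigr => i _ /=.
have su' := smooth_partial i su; have sv' := smooth_partial i sv.
rewrite (partialM i (smooth_pderivable su) (smooth_pderivable sv)).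
rewrite (d_add _ _ (smoothM su sv') (smoothM su' sv)).
by rewrite (d_mul _ _ su sv') (d_mul _ _ su' sv); generalize_partial; ring.
Qed.

Lemma lapZ (c : R) u x : smooth u ->
  laplacian (fun y => c * u y) x = c * laplacian u x.
Proof.
move=> su; rewrite mulr_sumr; apply: eq_bigr => i _ /=.
rewrite (_ : partial i (fun y => c * u y) = (fun y => c * partial i u y)).
  exact: (d_scale _ _ _ (smooth_partial i su)).
by apply/funext => y; rewrite (d_scale _ _ _ su).
Qed.

Lemma lapN u x : smooth u -> laplacian (fun y => - u y) x = - laplacian u x.
Proof.
move=> su; rewrite (_ : (fun y => - u y) = (fun y => -1 * u y)).
  by rewrite lapZ// mulN1r.
by apply/funext => y; rewrite mulN1r.
Qed.

Lemma lap_expR u x : smooth u ->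
  laplacian (fun y => expR (u y)) x = expR (u x) * (laplacian u x + gdot u u x).
Proof.
move=> su; rewrite mulrDr !mulr_sumr -!big_split; apply: eq_bigr => i _ /=.
rewrite (partial_comp (dh := expR) _ _ (smooth_pderivable su)).
rewrite (d_mul _ _ (smooth_expR su) (smooth_partial i su)).
by rewrite (d_expR _ _ su); generalize_partial; ring.
Qed.

Lemma bsupp_partial u i : smooth u -> bsupp u -> bsupp (partial i u).
Proof.
move=> su [M hM]; exists M => x hx.
by apply: (is_derive_outside (X := u) (i := i) (M := M)) => // y;
  apply: is_partial; exact: smooth_pderivable.
Qed.

Lemma integral_divergence (X : 'I_N -> 'rV[R]_N -> R) :
  (forall i, smooth (X i)) -> (forall i, bsupp (X i)) ->
  (\int[lebesgue_rV R N]_x (\sum_(i < N) partial i (X i) x)%:E = 0)%E.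
Proof.
move=> sX bX; under eq_integral do rewrite -sumEFin.
rewrite integral_sum//.
  by rewrite big1// => i _; exact: integral_partial.
move=> i; apply: integrable_bsupp.
  by apply: smooth_cont; exact: smooth_partial.
exact: bsupp_partial.
Qed.

Lemma bsupp_laplacian u : smooth u -> bsupp u -> bsupp (laplacian u).
Proof.
move=> su bu; apply: (bsupp_sum _ (F := fun i => partial i (partial i u))) => i.
by apply: bsupp_partial; [exact: smooth_partial|exact: bsupp_partial].
Qed.

Lemma smooth_laplacian u : smooth u -> smooth (laplacian u).
Proof.
by move=> su; apply: (smooth_sum _ (F := fun i => partial i (partial i u))) => i;
  do 2 apply: smooth_partial.
Qed.

(** * The Rellich inequality of a positive function and a vector field *)

(** For [f = - Lap Phi / Phi] and [G = - f grad Phi / Phi] with [Phi > 0], this is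
    [Lap (Lap Phi) / Phi]. *)
Definition rellich_weight f (G : 'I_N -> 'rV[R]_N -> R) x :=
  2 * (\sum_(i < N) partial i (G i) x) - 2 * (\sum_(i < N) G i x ^+ 2) / f x
  - f x ^+ 2 - laplacian f x.

Lemma smooth_rellich_weight f G : smooth f -> (forall x, 0 < f x) ->
  (forall i, smooth (G i)) -> smooth (rellich_weight f G).
Proof.
move=> sf f0 sG; rewrite /rellich_weight.
have sfi : smooth (fun x => (f x)^-1) by apply: smooth_inv => // x; rewrite gt_eqF.
have sL := smooth_laplacian sf.
by smooth_tac.
Qed.

(** Pointwise, [(Lap u)^2 - V u^2] is the divergence of
    [- 2 f u grad u + u^2 grad f - 2 u^2 G] plus the two squares
    [(Lap u + f u)^2] and [2 f |grad u + u G / f|^2]. *)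
Lemma integral_rellich_weight f (G : 'I_N -> 'rV[R]_N -> R) u :
  smooth f -> (forall x, 0 < f x) -> (forall i, smooth (G i)) -> test_function u ->
  (\int[lebesgue_rV R N]_x (rellich_weight f G x * u x ^+ 2)%:E <=
   \int[lebesgue_rV R N]_x (laplacian u x ^+ 2)%:E)%E.
Proof.
move=> sf f0 sG tu; have bu := test_function_bsupp tu; case: tu => su _.
pose X i x := u x * (- 2 * (f x * partial i u x) +
  (u x * partial i f x + - 2 * (u x * G i x))).
have sX i : smooth (X i).
  have su' := smooth_partial i su; have sf' := smooth_partial i sf; have sGi := sG i.
  by rewrite /X; smooth_tac.
have bX i : bsupp (X i) by apply: bsuppM.
have dXE i x : partial i (X i) x = - 2 * f x * partial i u x ^+ 2
    - 2 * f x * u x * partial i (partial i u) x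
    + u x ^+ 2 * partial i (partial i f) x - 4 * u x * partial i u x * G i x
    - 2 * u x ^+ 2 * partial i (G i) x.
  have su' := smooth_partial i su; have sf' := smooth_partial i sf; have sGi := sG i.
  have s1 := smoothM sf su'; have s2 := smoothM su sf'; have s3 := smoothM su sGi.
  have s4 := smoothM (smooth_cst (- 2)) s3; have s5 := smoothM (smooth_cst (- 2)) s1.
  rewrite /X (d_mul _ _ su (smoothD s5 (smoothD s2 s4))) (d_add _ _ s5 (smoothD s2 s4)).
  rewrite (d_add _ _ s2 s4) (d_scale _ _ _ s1) (d_scale _ _ _ s3).
  by rewrite (d_mul _ _ sf su') (d_mul _ _ su sf') (d_mul _ _ su sGi); generalize_partial; ring.
pose V := rellich_weight f G.
have sV : smooth V by exact: (smooth_rellich_weight sf f0 sG).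
have sL := smooth_laplacian su.
have divE x : \sum_(i < N) partial i (X i) x =
    - 2 * f x * gdot u u x - 2 * f x * u x * laplacian u x
    + u x ^+ 2 * laplacian f x - 4 * u x * (\sum_(i < N) partial i u x * G i x)
    - 2 * u x ^+ 2 * \sum_(i < N) partial i (G i) x.
  rewrite !laplacianE !mulr_sumr -!sumrN -!big_split/=; apply: eq_bigr => i _.
  by rewrite dXE; generalize_partial; ring.
have key x : V x * u x ^+ 2 + \sum_(i < N) partial i (X i) x <= laplacian u x ^+ 2.
  rewrite divE /V /rellich_weight.
  have sq : 0 <= f x * gdot u u x +
      2 * u x * (\sum_(i < N) partial i u x * G i x) +
      (\sum_(i < N) G i x ^+ 2) / f x * u x ^+ 2.
    rewrite mulr_suml mulr_suml !mulr_sumr -!big_split /=.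
    apply: sumr_ge0 => i _.
    rewrite (_ : _ + _ = f x * (partial i u x + G i x / f x * u x) ^+ 2).
      by rewrite mulr_ge0 ?sqr_ge0// ltW.
    by have := lt0r_neq0 (f0 x); generalize_partial => ?; field.
  have := sqr_ge0 (laplacian u x + f x * u x); move: sq.
    move: (laplacian u x) (laplacian f x) (gdot u u x) => Lu Lf g2.
    move: (\sum_i partial i u x * _) (\sum_i partial i (G i) x) (\sum_i G i x ^+ 2) => gG dG G2.
    move: (f x)^-1 => fi; nra.
have iV : (lebesgue_rV R N).-integrable setT (fun x => (V x * u x ^+ 2)%:E).
  apply: (@integrable_bsupp R N (fun x => V x * u x ^+ 2)).
    by apply: smooth_cont; smooth_tac.
  apply: bsuppMr; rewrite (_ : (fun x => u x ^+ 2) = fun x => u x * u x); first exact: bsuppM.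
  by apply/funext => x; rewrite expr2.
have iX : (lebesgue_rV R N).-integrable setT
    (fun x => (\sum_(i < N) partial i (X i) x)%:E).
  apply: (@integrable_bsupp R N (fun x => \sum_(i < N) partial i (X i) x)).
    by apply: smooth_cont; smooth_tac.
  exact: (bsupp_sum _ (F := fun i => partial i (X i))
    (fun i => bsupp_partial i (sX i) (bX i))).
rewrite -[leLHS]adde0 -[X in (_ + X)%E](integral_divergence sX bX).
rewrite -(integralD measurableT iV iX).
apply: le_integral => //.
- exact: integrableD.
- apply: (@integrable_bsupp R N (fun x => laplacian u x ^+ 2)).
    by apply: smooth_cont; smooth_tac.
  rewrite (_ : (fun x => laplacian u x ^+ 2) = fun x => laplacian u x * laplacian u x).
    by apply: bsuppM; exact: bsupp_laplacian.
  by apply/funext => x; rewrite expr2.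
- by move=> x _; rewrite -EFinD lee_fin; exact: key.
Qed.

End gradient.

(** * The regularised two-pole weight *)

Ltac generalize_gdot := repeat match goal with
  | |- context [gdot ?u ?v ?x] => move: (gdot u v x) => ?
  | |- context [laplacian ?u ?x] => move: (laplacian u x) => ?
  end.

(** [A] and [B] stand for the regularised squared distances to the poles.  The
    first term is the regularised two-pole weight.  The one linear in [tau] is the gain
    of the perturbed vector field, of which the part proportional to [eps] has no sign
    but fades out with [eps]; the last one is its cost. *)
Definition regularised_potential (R : realType) (n s tau eps d A B : R) :=
  16 * s ^+ 2 * (s + 1) ^+ 2 * (d + 2 * eps) ^+ 2 * (A^-1 * B^-1) ^+ 2
  + 2 * tau * (2 * (d + 2 * eps) * (A^-1 * B^-1) / (A + B) ^+ 2
     - 2 * eps * (A^-1 ^+ 2 + B^-1 ^+ 2) / (A + B) ^+ 2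
     + n * eps * (B^-1 / (A + B)) * (A^-1 ^+ 2 - B^-1 ^+ 2))
  - tau ^+ 2 * (A^-1 * B^-1) ^+ 2 / (2 * s ^+ 2).

Section bipolar.
Context (R : realType) (N : nat).
Implicit Types (a x : 'rV[R]_N) (i : 'I_N).

Definition sqdist a x : R := \sum_(i < N) (x ord0 i - a ord0 i) ^+ 2.

Lemma sqdist_ge0 a x : 0 <= sqdist a x.
Proof. by apply: sumr_ge0 => i _; exact: sqr_ge0. Qed.

Lemma sqdist_gt0 a x : x != a -> 0 < sqdist a x.
Proof.
move=> xa; rewrite lt_def sqdist_ge0 andbT; apply: contra xa => /eqP s0.
have /psumr_eq0P h : forall i, true -> 0 <= (x ord0 i - a ord0 i) ^+ 2.
  by move=> i _; exact: sqr_ge0.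
apply/eqP/rowP => i; apply/eqP; rewrite -subr_eq0 -sqrf_eq0.
by apply/eqP; exact: h.
Qed.

Lemma smooth_sqdist a : smooth (sqdist a).
Proof.
rewrite /sqdist; apply: (smooth_sum _ (F := fun i x => (x ord0 i - a ord0 i) ^+ 2)) => i.
apply: (smoothX 2 (u := fun x : 'rV[R]_N => x ord0 i - a ord0 i)).
exact: (smoothB (smooth_coord R i) (smooth_cst _)).
Qed.

Lemma d_sqdist a i x : partial i (sqdist a) x = 2 * (x ord0 i - a ord0 i).
Proof.
have s1 (j : 'I_N) : smooth (fun x : 'rV[R]_N => x ord0 j - a ord0 j).
  exact: (smoothB (smooth_coord R j) (smooth_cst _)).
have d1 (j : 'I_N) y : partial i (fun x : 'rV[R]_N => x ord0 j - a ord0 j) y = (i == j)%:R.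
  rewrite (d_sub _ _ (smooth_coord R j) (smooth_cst _)) partial_cst subr0.
  by rewrite (partialE (fun x => is_derive_coord i j x)).
have E : forall (r : seq 'I_N) y, partial i (fun x : 'rV[R]_N =>
    \sum_(j <- r) (x ord0 j - a ord0 j) ^+ 2) y =
    \sum_(j <- r) 2 * (y ord0 j - a ord0 j) * (i == j)%:R.
  elim=> [|j r IH] y.
    rewrite big_nil (_ : (fun x => _) = (fun x => 0)) ?partial_cst//.
    by apply/funext => z; rewrite big_nil.
  rewrite big_cons -IH -(d1 j y).
  rewrite (_ : (fun x => _) = (fun x : 'rV[R]_N =>
    (x ord0 j - a ord0 j) * (x ord0 j - a ord0 j) +
    \sum_(j <- r) (x ord0 j - a ord0 j) ^+ 2)).
    rewrite (d_add _ _ (smoothM (s1 j) (s1 j)) (smooth_sum r (fun j => smoothX 2 (s1 j)))).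
    by rewrite (d_mul _ _ (s1 j) (s1 j)); generalize_partial; ring.
  by apply/funext => z; rewrite big_cons expr2.
rewrite /sqdist E (bigD1 i)//= eqxx mulr1 big1 ?addr0// => j ji.
by rewrite eq_sym (negbTE ji) mulr0.
Qed.

Lemma gdot_sqdist a b x :
  gdot (sqdist a) (sqdist b) x = 2 * (sqdist a x + sqdist b x - sqdist a b).
Proof.
rewrite mulrBr mulrDr /sqdist !mulr_sumr -sumrN -!big_split; apply: eq_bigr => i _ /=.
by rewrite !d_sqdist; ring.
Qed.

Lemma lap_sqdist a x : laplacian (sqdist a) x = 2 * N%:R.
Proof.
rewrite laplacianE (eq_bigr (fun=> 2)) ?sumr_const ?card_ord ?mulr_natr// => i _.
have -> : partial i (sqdist a) = (fun x : 'rV[R]_N => 2 * (x ord0 i - a ord0 i)).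
  by apply/funext => y; rewrite d_sqdist.
rewrite (d_scale _ _ _ (smoothB (smooth_coord R i) (smooth_cst _))).
rewrite (d_sub _ _ (smooth_coord R i) (smooth_cst _)) partial_cst subr0.
by rewrite (partialE (fun x => is_derive_coord i i x)) eqxx mulr1.
Qed.

Lemma lap_ln (u : 'rV[R]_N -> R) x : smooth u -> (forall y, 0 < u y) ->
  laplacian (fun y => ln (u y)) x =
  (u x)^-1 * laplacian u x - (u x)^-1 ^+ 2 * gdot u u x.
Proof.
move=> su u0; have s1 := smooth_ln su u0.
have := @lap_expR R N _ x s1.
rewrite (_ : (fun y => expR (ln (u y))) = u); last first.
  by apply/funext => y; rewrite lnK// posrE.
rewrite lnK ?posrE// => ->.
have -> : gdot (fun y => ln (u y)) (fun y => ln (u y)) x = (u x)^-1 ^+ 2 * gdot u u x.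
  rewrite mulr_sumr; apply: eq_bigr => i _; rewrite (d_ln _ _ su u0).
  by generalize_partial; ring.
by have := lt0r_neq0 (u0 x) => ?; field.
Qed.

Lemma gdot_ln (u v : 'rV[R]_N -> R) x : smooth u -> (forall y, 0 < u y) ->
  gdot (fun y => ln (u y)) v x = (u x)^-1 * gdot u v x.
Proof.
move=> su u0; rewrite mulr_sumr; apply: eq_bigr => i _; rewrite (d_ln _ _ su u0).
by generalize_partial; ring.
Qed.

Section shift.
Variables (eps : R) (eps0 : 0 < eps).

Lemma sqdist_shift_gt0 a x : 0 < sqdist a x + eps.
Proof. by rewrite ltr_wpDl// sqdist_ge0. Qed.

Lemma smooth_sqdist_shift a : smooth (fun x => sqdist a x + eps).
Proof. exact: (smoothD (smooth_sqdist a) (smooth_cst eps)). Qed.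

Lemma d_sqdist_shift a i x : partial i (fun x => sqdist a x + eps) x = partial i (sqdist a) x.
Proof. by rewrite (d_add _ _ (smooth_sqdist a) (smooth_cst _)) partial_cst addr0. Qed.

Lemma gdot_sqdist_shift a b x :
  gdot (fun x => sqdist a x + eps) (fun x => sqdist b x + eps) x =
  2 * (sqdist a x + sqdist b x - sqdist a b).
Proof. by rewrite -gdot_sqdist; apply: eq_bigr => i _; rewrite !d_sqdist_shift. Qed.

Lemma lap_sqdist_shift a x : laplacian (fun x => sqdist a x + eps) x = 2 * N%:R.
Proof.
by rewrite (lapD _ (smooth_sqdist a) (smooth_cst _)) lap_sqdist laplacianE big1 ?addr0// => i _;
  rewrite partial_cst partial_cst.
Qed.

Lemma sqdistxx a : sqdist a a = 0.
Proof. by rewrite /sqdist big1// => i _; rewrite subrr expr0n. Qed.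

Lemma gdot_ln_sqdist a x :
  gdot (fun x => ln (sqdist a x + eps)) (fun x => ln (sqdist a x + eps)) x =
  4 * ((sqdist a x + eps)^-1 - eps * (sqdist a x + eps)^-1 ^+ 2).
Proof.
have s1 := smooth_sqdist_shift a; have s0 := sqdist_shift_gt0 a.
rewrite (gdot_ln _ _ s1 s0) gdotC (gdot_ln _ _ s1 s0) gdot_sqdist_shift sqdistxx.
by have := lt0r_neq0 (s0 x) => ?; field.
Qed.

Lemma lap_ln_sqdist a x : laplacian (fun x => ln (sqdist a x + eps)) x =
  2 * (N%:R - 2) * (sqdist a x + eps)^-1 + 4 * eps * (sqdist a x + eps)^-1 ^+ 2.
Proof.
have s1 := smooth_sqdist_shift a; have s0 := sqdist_shift_gt0 a.
rewrite (lap_ln _ s1 s0) gdot_sqdist_shift lap_sqdist_shift sqdistxx.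
by have := lt0r_neq0 (s0 x) => ?; field.
Qed.

End shift.

Variables (a1 a2 : 'rV[R]_N) (eps : R).
Hypothesis eps0 : 0 < eps.

Let rho1 x := sqdist a1 x + eps.
Let rho2 x := sqdist a2 x + eps.
Let S x := rho1 x + rho2 x.
Let l1 x := ln (rho1 x).
Let l2 x := ln (rho2 x).
Let L x := ln (S x).
Let D := sqdist a1 a2 + 2 * eps.

Let rho1_gt0 x : 0 < rho1 x. Proof. exact: sqdist_shift_gt0. Qed.
Let rho2_gt0 x : 0 < rho2 x. Proof. exact: sqdist_shift_gt0. Qed.
Let S_gt0 x : 0 < S x. Proof. by rewrite addr_gt0. Qed.
Let smooth_rho1 : smooth rho1.
Proof. exact: smooth_sqdist_shift. Qed.
Let smooth_rho2 : smooth rho2.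
Proof. exact: smooth_sqdist_shift. Qed.
Let smooth_S : smooth S. Proof. exact: (smoothD smooth_rho1 smooth_rho2). Qed.
Let smooth_l1 : smooth l1. Proof. exact: (smooth_ln smooth_rho1 rho1_gt0). Qed.
Let smooth_l2 : smooth l2. Proof. exact: (smooth_ln smooth_rho2 rho2_gt0). Qed.
Let smooth_L : smooth L. Proof. exact: (smooth_ln smooth_S S_gt0). Qed.

Let p x := (rho1 x)^-1.
Let q x := (rho2 x)^-1.

Let gdot11 x : gdot l1 l1 x = 4 * (p x - eps * p x ^+ 2).
Proof. exact: (gdot_ln_sqdist eps0). Qed.

Let gdot22 x : gdot l2 l2 x = 4 * (q x - eps * q x ^+ 2).
Proof. exact: (gdot_ln_sqdist eps0). Qed.

Let gdot12 x : gdot l1 l2 x = 2 * (p x + q x - D * (p x * q x)).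
Proof.
rewrite /l1 (gdot_ln _ _ smooth_rho1 rho1_gt0) gdotC.
rewrite /l2 (gdot_ln _ _ smooth_rho2 rho2_gt0) gdotC /rho1 /rho2 gdot_sqdist_shift /p /q /D.
have := lt0r_neq0 (rho1_gt0 x); have := lt0r_neq0 (rho2_gt0 x); rewrite /rho1 /rho2.
by move=> h1 h2; field; rewrite h1 h2.
Qed.

Let lap1 x : laplacian l1 x = 2 * (N%:R - 2) * p x + 4 * eps * p x ^+ 2.
Proof. exact: (lap_ln_sqdist eps0). Qed.

Let lap2 x : laplacian l2 x = 2 * (N%:R - 2) * q x + 4 * eps * q x ^+ 2.
Proof. exact: (lap_ln_sqdist eps0). Qed.

Let gdotL (w : 'rV[R]_N -> R) x : gdot L w x =
  (S x)^-1 * (rho1 x * gdot l1 w x + rho2 x * gdot l2 w x).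
Proof.
rewrite /L (gdot_ln _ _ smooth_S S_gt0) /S (gdotDl _ _ smooth_rho1 smooth_rho2).
rewrite /l1 /l2 (gdot_ln _ _ smooth_rho1 rho1_gt0) (gdot_ln _ _ smooth_rho2 rho2_gt0).
by rewrite !mulrA !divff ?mul1r// lt0r_neq0.
Qed.

(** The monomial [p ^ m * q ^ n] as an exponential, whose derivatives only involve the
    inner products of [grad l1] and [grad l2]. *)
Let E (m n : nat) x := expR (- (m%:R * l1 x + n%:R * l2 x)).

Let smooth_lin (m n : R) : smooth (fun x => m * l1 x + n * l2 x).
Proof. exact: (smoothD (smoothM (smooth_cst _) smooth_l1) (smoothM (smooth_cst _) smooth_l2)). Qed.

Let smooth_E m n : smooth (E m n).
Proof. exact: (smooth_expR (smoothN (smooth_lin _ _))). Qed.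

Let E_val m n x : E m n x = p x ^+ m * q x ^+ n.
Proof.
rewrite /E opprD expRD !expRN !expRM_natl !lnK ?posrE//.
by rewrite !exprVn.
Qed.

Let gdot_lin (m n : R) (w : 'rV[R]_N -> R) x :
  gdot (fun x => m * l1 x + n * l2 x) w x = m * gdot l1 w x + n * gdot l2 w x.
Proof.
rewrite (gdotDl _ _ (smoothM (smooth_cst m) smooth_l1) (smoothM (smooth_cst n) smooth_l2)).
by rewrite (gdotZl _ _ _ smooth_l1) (gdotZl _ _ _ smooth_l2).
Qed.

Let lap_lin (m n : R) x : laplacian (fun x => m * l1 x + n * l2 x) x =
  m * laplacian l1 x + n * laplacian l2 x.
Proof.
rewrite (lapD _ (smoothM (smooth_cst m) smooth_l1) (smoothM (smooth_cst n) smooth_l2)).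
by rewrite (lapZ _ _ smooth_l1) (lapZ _ _ smooth_l2).
Qed.

Let gdot_lin2 (m n m' n' : R) x :
  gdot (fun x => m * l1 x + n * l2 x) (fun x => m' * l1 x + n' * l2 x) x =
  m * m' * gdot l1 l1 x + (m * n' + n * m') * gdot l1 l2 x + n * n' * gdot l2 l2 x.
Proof.
rewrite gdot_lin (gdotC l1) (gdotC l2) !gdot_lin (gdotC l2 l1).
by generalize_gdot; ring.
Qed.

Let lap_E m n x : laplacian (E m n) x = E m n x *
  (m%:R ^+ 2 * gdot l1 l1 x + 2 * m%:R * n%:R * gdot l1 l2 x +
   n%:R ^+ 2 * gdot l2 l2 x - m%:R * laplacian l1 x - n%:R * laplacian l2 x).
Proof.
rewrite /E (lap_expR _ (smoothN (smooth_lin _ _))) (lapN _ (smooth_lin _ _)) lap_lin.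
rewrite (gdotNl _ _ (smooth_lin _ _)) gdotC (gdotNl _ _ (smooth_lin _ _)) gdot_lin2.
by move: (expR _); generalize_gdot => e; ring.
Qed.

Let gdot_E m n (m' n' : R) x : gdot (E m n) (fun x => m' * l1 x + n' * l2 x) x =
  - E m n x * (m%:R * m' * gdot l1 l1 x + (m%:R * n' + n%:R * m') * gdot l1 l2 x +
     n%:R * n' * gdot l2 l2 x).
Proof.
rewrite /E (gdot_expl _ _ (smoothN (smooth_lin _ _))) (gdotNl _ _ (smooth_lin _ _)) gdot_lin2.
by move: (expR _); generalize_gdot => e; ring.
Qed.

Variables (s tau : R).
Hypotheses (s0 : 0 < s) (sN : N%:R = 4 * s + 4).

(** Here [exp (- b)] is the regularised [Phi] and [f = Lap b - |grad b|^2] its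
    [- Lap Phi / Phi].  The field [f grad b] makes the square of the gradient vanish
    at [Phi]; [k grad c], with [k = q / S] and [c] proportional to [ln (rho1 / rho2)], is
    the perturbation that forbids extremals. *)
Let f x := 4 * s * E 1 0 x + (4 * s * E 0 1 x + (4 * s ^+ 2 * D * E 1 1 x +
  (4 * eps * s * (s + 1) * E 2 0 x + 4 * eps * s * (s + 1) * E 0 2 x))).
Let k x := expR (- (0 * l1 x + 1 * l2 x + L x)).
Let b x := s * l1 x + s * l2 x.
Let c x := tau / 2 * l1 x + - (tau / 2) * l2 x.
Let G i x := f x * partial i b x + k x * partial i c x.

Let D_gt0 : 0 < D.
Proof. by rewrite /D ltr_wpDl ?sqdist_ge0// mulr_gt0. Qed.

Let smooth_f : smooth f.
Proof.
do ![refine (smoothD (smoothM (smooth_cst _) (smooth_E _ _)) _)].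
exact: (smoothM (smooth_cst _) (smooth_E _ _)).
Qed.

Let smooth_k : smooth k.
Proof. exact: (smooth_expR (smoothN (smoothD (smooth_lin _ _) smooth_L))). Qed.

Let smooth_b : smooth b. Proof. exact: smooth_lin. Qed.
Let smooth_c : smooth c. Proof. exact: smooth_lin. Qed.

Let smooth_G i : smooth (G i).
Proof.
exact: (smoothD (smoothM smooth_f (smooth_partial i smooth_b))
  (smoothM smooth_k (smooth_partial i smooth_c))).
Qed.

Let f_gt0 x : 0 < f x.
Proof.
have e m n : 0 < E m n x by exact: expR_gt0.
have e2 : 0 < s + 1 by rewrite addr_gt0.
by rewrite /f !addr_gt0 ?mulr_gt0// ?exprn_gt0.
Qed.

Let lap_f x : laplacian f x = 4 * s * laplacian (E 1 0) x +
  (4 * s * laplacian (E 0 1) x + (4 * s ^+ 2 * D * laplacian (E 1 1) x +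
  (4 * eps * s * (s + 1) * laplacian (E 2 0) x +
   4 * eps * s * (s + 1) * laplacian (E 0 2) x))).
Proof.
have sZ c' m n : smooth (fun x => c' * E m n x).
  exact: (smoothM (smooth_cst c') (smooth_E m n)).
rewrite /f (lapD _ (sZ _ _ _) (smoothD (sZ _ _ _) (smoothD (sZ _ _ _) (smoothD (sZ _ _ _) (sZ _ _ _))))).
rewrite (lapD _ (sZ _ _ _) (smoothD (sZ _ _ _) (smoothD (sZ _ _ _) (sZ _ _ _)))).
rewrite (lapD _ (sZ _ _ _) (smoothD (sZ _ _ _) (sZ _ _ _))).
by rewrite (lapD _ (sZ _ _ _) (sZ _ _ _)) !(lapZ _ _ (smooth_E _ _)).
Qed.

Let gdot_f w x : gdot f w x = 4 * s * gdot (E 1 0) w x +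
  (4 * s * gdot (E 0 1) w x + (4 * s ^+ 2 * D * gdot (E 1 1) w x +
  (4 * eps * s * (s + 1) * gdot (E 2 0) w x +
   4 * eps * s * (s + 1) * gdot (E 0 2) w x))).
Proof.
have sZ c' m n : smooth (fun x => c' * E m n x).
  exact: (smoothM (smooth_cst c') (smooth_E m n)).
rewrite /f (gdotDl _ _ (sZ _ _ _) (smoothD (sZ _ _ _) (smoothD (sZ _ _ _) (smoothD (sZ _ _ _) (sZ _ _ _))))).
rewrite (gdotDl _ _ (sZ _ _ _) (smoothD (sZ _ _ _) (smoothD (sZ _ _ _) (sZ _ _ _)))).
rewrite (gdotDl _ _ (sZ _ _ _) (smoothD (sZ _ _ _) (sZ _ _ _))).
by rewrite (gdotDl _ _ (sZ _ _ _) (sZ _ _ _)) !(gdotZl _ _ _ (smooth_E _ _)).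
Qed.

Let k_val x : k x = q x * (S x)^-1.
Proof.
rewrite /k mul0r add0r mul1r opprD expRD !expRN !lnK ?posrE//; exact: addr_gt0.
Qed.

Let gdot_k x : gdot k c x = - k x * (0 * gdot l1 c x + 1 * gdot l2 c x +
   (S x)^-1 * (rho1 x * gdot l1 c x + rho2 x * gdot l2 c x)).
Proof.
rewrite /k (gdot_expl _ _ (smoothN (smoothD (smooth_lin _ _) smooth_L))).
rewrite (gdotNl _ _ (smoothD (smooth_lin _ _) smooth_L)).
by rewrite (gdotDl _ _ (smooth_lin _ _) smooth_L) gdot_lin gdotL mulrN mulNr.
Qed.

Let divG x : \sum_(i < N) partial i (G i) x =
  gdot f b x + f x * laplacian b x + (gdot k c x + k x * laplacian c x).
Proof.
rewrite !laplacianE !mulr_sumr -!big_split; apply: eq_bigr => i _ /=.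
have s1 := smooth_partial i smooth_b; have s2 := smooth_partial i smooth_c.
rewrite /G (d_add _ _ (smoothM smooth_f s1) (smoothM smooth_k s2)).
by rewrite (d_mul _ _ smooth_f s1) (d_mul _ _ smooth_k s2); generalize_partial; ring.
Qed.

Let sqrG x : \sum_(i < N) G i x ^+ 2 =
  f x ^+ 2 * gdot b b x + 2 * f x * k x * gdot b c x + k x ^+ 2 * gdot c c x.
Proof.
rewrite !mulr_sumr -!big_split; apply: eq_bigr => i _ /=.
by rewrite /G; generalize_partial; ring.
Qed.

Definition bipolar_potential x :=
  regularised_potential N%:R s tau eps (sqdist a1 a2) (rho1 x) (rho2 x).

(** The terms free of [tau] amount to [Lap (Lap Phi) / Phi]; their excess over the
    two-pole weight has nonnegative coefficients as a polynomial in [eps], [D], [p], [q].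
    The terms linear in [tau] are kept as they are, and the quadratic one is bounded
    by means of [f >= 4 s^2 D p q]. *)
Lemma rellich_weight_bipolar x : bipolar_potential x <= rellich_weight f G x.
Proof.
have p0 : 0 < p x by rewrite invr_gt0.
have q0 : 0 < q x by rewrite invr_gt0.
have fval : f x = 4 * s * (p x + q x) + 4 * s ^+ 2 * D * (p x * q x) +
    4 * eps * s * (s + 1) * (p x ^+ 2 + q x ^+ 2).
  by rewrite /f !E_val; move: (p x) (q x) => P Q; ring.
have cc : gdot c c x = tau ^+ 2 * (D * (p x * q x) - eps * (p x ^+ 2 + q x ^+ 2)).
  rewrite /c gdot_lin2 gdot11 gdot12 gdot22; move: (p x) (q x) D => P Q D'; by field.
have bb : gdot b b x = s ^+ 2 * (gdot l1 l1 x + 2 * gdot l1 l2 x + gdot l2 l2 x).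
  by rewrite /b gdot_lin2; generalize_gdot; ring.
have bc : gdot b c x = s * tau / 2 * (gdot l1 l1 x - gdot l2 l2 x).
  by rewrite /b /c gdot_lin2; generalize_gdot; field.
have kk : 2 * (k x ^+ 2 * gdot c c x) / f x <= tau ^+ 2 * (p x * q x) ^+ 2 / (2 * s ^+ 2).
  have kpq : k x <= p x * q x.
    rewrite k_val mulrC ler_wpM2r//; first exact: ltW.
    by rewrite /p lef_pV2 ?posrE// /S lerDl ltW.
  have k0 : 0 <= k x by exact: expR_ge0.
  rewrite ler_pdivrMr//.
  have pq0 : 0 < p x * q x by rewrite mulr_gt0.
  apply: (@le_trans _ _ (2 * (p x * q x) ^+ 2 * (tau ^+ 2 * (D * (p x * q x))))).
    rewrite cc -mulrA ler_wpM2l//; apply: (@le_trans _ _ (k x ^+ 2 * (tau ^+ 2 * (D * (p x * q x))))).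
      rewrite ler_wpM2l ?sqr_ge0// ler_wpM2l ?sqr_ge0// gerDl oppr_le0.
      by rewrite mulr_ge0 ?addr_ge0 ?sqr_ge0// ltW.
    rewrite ler_wpM2r//; last by rewrite ler_sqr ?nnegrE// ltW.
    by rewrite mulr_ge0 ?sqr_ge0// mulr_ge0 ?ltW.
  apply: (@le_trans _ _ (tau ^+ 2 * (p x * q x) ^+ 2 / (2 * s ^+ 2) * (4 * s ^+ 2 * D * (p x * q x)))).
    rewrite le_eqVlt; apply/orP; left; apply/eqP.
    by have := lt0r_neq0 s0; move: (p x) (q x) D => P Q D' hs; field.
  rewrite ler_wpM2l//.
    by apply: divr_ge0; apply: mulr_ge0; rewrite ?sqr_ge0.
  rewrite fval -addrA addrCA lerDl addr_ge0// ?mulr_ge0 ?addr_ge0 ?sqr_ge0 ?ltW//.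
have ap : rho1 x != 0 by exact: lt0r_neq0.
have aq : rho2 x != 0 by exact: lt0r_neq0.
have aS : S x != 0 by exact: lt0r_neq0.
have af : f x != 0 by exact: lt0r_neq0.
pose c1 := 16 * s ^+ 2 * (s + 1) ^+ 2 * D ^+ 2 * (p x * q x) ^+ 2.
pose V0 := f x ^+ 2 + 2 * gdot f b x - laplacian f x
  + 2 * f x * (laplacian b x - gdot b b x - f x).
have V0E : c1 <= V0.
  have bE : laplacian b x - gdot b b x = f x.
    rewrite bb /b lap_lin gdot11 gdot12 gdot22 lap1 lap2 fval sN.
    by move: (p x) (q x) D => P Q D'; ring.
  rewrite /V0 bE subrr mulr0 addr0 -subr_ge0.
  rewrite (_ : _ - c1 = 32 * eps * D * s ^+ 2 * (s + 1) * (s + 2) *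
      (p x ^+ 3 * q x + p x * q x ^+ 3) + 16 * eps ^+ 2 * s * (s + 1) *
      ((s + 2) * (s + 3) * (p x ^+ 4 + q x ^+ 4) +
       2 * s * (s + 1) * (p x * q x) ^+ 2)).
    by do ![apply: addr_ge0 | apply: mulr_ge0 | apply: exprn_ge0]; rewrite ?ler0n ?sqdist_ge0// ltW.
  rewrite gdot_f lap_f /b !gdot_E !lap_E !gdot11 !gdot12 !gdot22 !lap1 !lap2 !E_val fval sN /c1.
  by move: (p x) (q x) D => P Q D'; ring.
pose V1 := gdot k c x + k x * laplacian c x - 2 * k x * gdot b c x.
have V1E : V1 = tau * (2 * D * (p x * q x) / S x ^+ 2
     - 2 * eps * (p x ^+ 2 + q x ^+ 2) / S x ^+ 2
     + N%:R * eps * (q x / S x) * (p x ^+ 2 - q x ^+ 2)).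
  have g1 : gdot l1 c x = tau / 2 * gdot l1 l1 x + - (tau / 2) * gdot l1 l2 x.
    by rewrite gdotC /c gdot_lin (gdotC l2 l1).
  have g2 : gdot l2 c x = tau / 2 * gdot l1 l2 x + - (tau / 2) * gdot l2 l2 x.
    by rewrite gdotC /c gdot_lin.
  rewrite /V1 gdot_k bc g1 g2 /c lap_lin !gdot11 !gdot12 !gdot22 !lap1 !lap2 k_val sN.
  move: ap aq aS; rewrite /p /q /S; move: (rho1 x) (rho2 x) D => A B D' hA hB hS.
  by field; rewrite hA hB hS.
rewrite /rellich_weight divG sqrG.
have -> : 2 * (gdot f b x + f x * laplacian b x + (gdot k c x + k x * laplacian c x)) -
  2 * (f x ^+ 2 * gdot b b x + 2 * f x * k x * gdot b c x + k x ^+ 2 * gdot c c x) / f x -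
  f x ^+ 2 - laplacian f x = V0 + 2 * V1 - 2 * (k x ^+ 2 * gdot c c x) / f x.
  by rewrite /V0 /V1; move: af; generalize_gdot; move: (f x) (k x) => F K hF; field.
by rewrite V1E lerB// /bipolar_potential /regularised_potential -/c1 lerD// !mulrA.
Qed.

Lemma integral_bipolar_potential (u : 'rV[R]_N -> R) : test_function u ->
  (\int[lebesgue_rV R N]_x (regularised_potential N%:R s tau eps (sqdist a1 a2)
     (sqdist a1 x + eps) (sqdist a2 x + eps) * u x ^+ 2)%:E <=
   \int[lebesgue_rV R N]_x (laplacian u x ^+ 2)%:E)%E.
Proof.
move=> tu; apply: le_trans (integral_rellich_weight smooth_f f_gt0 smooth_G tu).
have smooth_p : smooth p by exact: (smooth_inv smooth_rho1 (fun x => lt0r_neq0 (rho1_gt0 x))).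
have smooth_q : smooth q by exact: (smooth_inv smooth_rho2 (fun x => lt0r_neq0 (rho2_gt0 x))).
have smooth_S2 : smooth (fun x => (S x)^-1).
  by exact: (smooth_inv smooth_S (fun x => lt0r_neq0 (S_gt0 x))).
have bu := test_function_bsupp tu; case: (tu) => su _.
have bu2 : bsupp (fun x => u x ^+ 2).
  rewrite (_ : (fun x => u x ^+ 2) = fun x => u x * u x); first exact: bsuppM.
  by apply/funext => x; rewrite expr2.
have int (g : 'rV[R]_N -> R) : smooth g ->
    (lebesgue_rV R N).-integrable setT (fun x => (g x * u x ^+ 2)%:E).
  move=> sg; apply: (@integrable_bsupp R N (fun x => g x * u x ^+ 2)).
    by apply: smooth_cont; exact: (smoothM sg (smoothX 2 su)).
  exact: bsuppMr.
apply: le_integral => //.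
- apply: (int bipolar_potential); rewrite (_ : bipolar_potential = fun x =>
  16 * s ^+ 2 * (s + 1) ^+ 2 * D ^+ 2 * (p x * q x) ^+ 2
  + 2 * tau * (2 * D * (p x * q x) * (S x)^-1 ^+ 2
     - 2 * eps * (p x ^+ 2 + q x ^+ 2) * (S x)^-1 ^+ 2
     + N%:R * eps * (q x * (S x)^-1) * (p x ^+ 2 - q x ^+ 2))
  - tau ^+ 2 * (p x * q x) ^+ 2 * (2 * s ^+ 2)^-1).
    smooth_tac.
  by apply/funext => x; rewrite /bipolar_potential /regularised_potential -!exprVn.
- by apply: int; exact: (smooth_rellich_weight smooth_f f_gt0 smooth_G).
- move=> x _; rewrite lee_fin ler_wpM2r ?sqr_ge0//.
  exact: rellich_weight_bipolar.
Qed.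

End bipolar.

(** * Removing the regularisation *)

Ltac pos := lazymatch goal with
  | |- is_true (0 <= _ * _) => apply: mulr_ge0; pos
  | |- is_true (0 < _ * _) => apply: mulr_gt0; pos
  | |- is_true (0 <= _ + - _) => first [done | exact: ltW]
  | |- is_true (0 < _ + - _) => done
  | |- is_true (0 <= _ + _) => apply: addr_ge0; pos
  | |- is_true (0 < _ + _) => apply: addr_gt0; pos
  | |- is_true (0 <= _ ^+ 2) => exact: sqr_ge0
  | |- is_true (0 <= _ ^+ _) => apply: exprn_ge0; pos
  | |- is_true (0 < _ ^+ _) => apply: exprn_gt0; pos
  | |- is_true (0 <= _^-1) => rewrite invr_ge0; pos
  | |- is_true (0 < _^-1) => rewrite invr_gt0; pos
  | |- is_true (0 <= _) => first [done | exact: ler0n | exact: sqdist_ge0 | apply: ltW; pos]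
  | |- is_true (0 < _) => done
  end.

Section measure_lemmas.
Context d (T : measurableType d) (R : realType) (mu : {measure set T -> \bar R}).

Lemma measurable_invr : measurable_fun setT (fun t : R => t^-1).
Proof.
rewrite -(setvU [set (0 : R)]); apply/measurable_funU => //; first exact: measurableC.
split; last exact: measurable_fun_set1.
apply: open_continuous_measurable_fun.
  by apply: closed_openC; exact/accessible_closed_set1/hausdorff_accessible/Rhausdorff.
by move=> t; rewrite inE => /= /eqP t0; exact: inv_continuous.
Qed.

(** Fatou's lemma where convergence holds off a null set and the integrals of the
    approximations obey a bound that itself converges. *)
Lemma fatou_ae (f : nat -> T -> R) (h : T -> R) (b : nat -> \bar R) (B : \bar R) :
  (forall m, measurable_fun setT (f m)) -> measurable_fun setT h ->
  (forall m x, 0 <= f m x) -> (forall x, 0 <= h x) ->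
  {ae mu, forall x, f m x @[m --> \oo] --> h x} ->
  (forall m, (\int[mu]_x (f m x)%:E <= b m)%E) -> (b m @[m --> \oo] --> B)%E ->
  (\int[mu]_x (h x)%:E <= B)%E.
Proof.
move=> mf mh f0 h0 fh fb bB.
have mf' m : measurable_fun setT (fun x => (f m x)%:E) by exact/measurable_EFinP.
have mh' : measurable_fun setT (fun x => (h x)%:E) by exact/measurable_EFinP.
have mlim : measurable_fun setT (fun x => limn_einf (fun m => (f m x)%:E)).
  apply: (measurableT_comp (f := -%E)) => //.
  apply: (measurable_fun_limn_esup (f := fun m x => (- (f m x)%:E)%E)) => m.
  exact: (measurableT_comp (f := -%E)).
rewrite (ae_eq_integral (fun x => limn_einf (fun m => (f m x)%:E)))//; last first.
  apply: filterS fh => x fx _; apply/esym; apply: (cvg_limn_einf_sup _).1.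
  by apply/cvg_EFin; [exact: nearW|exact: fx].
have := @fatou _ _ _ mu setT measurableT (fun m x => (f m x)%:E) mf'.
move=> /(_ (fun m x _ => f0 m x)) /le_trans; apply.
have [<- _] := cvg_limn_einf_sup bB.
rewrite !limn_einf_lim; apply: lee_lim; [exact: is_cvg_einfs|exact: is_cvg_einfs|].
apply: nearW => m; apply: le_ereal_inf_tmp => _ [k /= mk <-].
apply: (le_trans _ (fb k)); apply: ereal_inf_lbound; by exists k.
Qed.

End measure_lemmas.

Section real_sequences.
Context (R : realType).
Implicit Types (f g : nat -> R) (k l : R).

Lemma scvgD f g k l : f m @[m --> \oo] --> k -> g m @[m --> \oo] --> l ->
  f m + g m @[m --> \oo] --> k + l.
Proof. by move=> fk gl; exact: cvgD. Qed.

Lemma scvgB f g k l : f m @[m --> \oo] --> k -> g m @[m --> \oo] --> l ->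
  f m - g m @[m --> \oo] --> k - l.
Proof. by move=> fk gl; exact: cvgB. Qed.

Lemma scvgM f g k l : f m @[m --> \oo] --> k -> g m @[m --> \oo] --> l ->
  f m * g m @[m --> \oo] --> k * l.
Proof. by move=> fk gl; exact: cvgM. Qed.

Lemma scvgX f k n : f m @[m --> \oo] --> k -> f m ^+ n @[m --> \oo] --> k ^+ n.
Proof.
move=> fk; elim: n => [|n IH]; first exact: cvg_cst.
by rewrite exprS; under eq_cvg do rewrite exprS; exact: scvgM.
Qed.

Lemma scvgV f k : k != 0 -> f m @[m --> \oo] --> k -> (f m)^-1 @[m --> \oo] --> k^-1.
Proof. by move=> k0 fk; exact: cvgV. Qed.

End real_sequences.

Section limit.
Context (R : realType) (N : nat).
Hypothesis hN : (5 <= N)%N.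
Variables (a1 a2 : 'rV[R]_N).
Hypothesis ha : a1 <> a2.

Local Notation leb := (lebesgue_rV R N).

Let d := sqdist a1 a2.

Let d_gt0 : 0 < d. Proof. by apply: sqdist_gt0; rewrite eq_sym; apply/eqP. Qed.

Lemma enorm_sqr (x : 'rV[R]_N) : enorm x ^+ 2 = \sum_(i < N) x ord0 i ^+ 2.
Proof. by rewrite sqr_sqrtr// sumr_ge0// => i _; exact: sqr_ge0. Qed.

Lemma enorm_sub (x a : 'rV[R]_N) : enorm (x - a) ^+ 4 = sqdist a x ^+ 2.
Proof.
rewrite -[4%N]/(2 * 2)%N exprM enorm_sqr /sqdist; congr (_ ^+ 2).
by apply: eq_bigr => i _; rewrite !mxE.
Qed.

Lemma weightE x : weight a1 a2 x = d ^+ 2 * ((sqdist a1 x)^-1 * (sqdist a2 x)^-1) ^+ 2.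
Proof.
rewrite /weight !enorm_sub exprMn !exprVn -invfM; congr (_ ^+ 2 / _).
by apply: eq_bigr => i _; rewrite -sqrrN opprB.
Qed.

Lemma weight_ge0 x : 0 <= weight a1 a2 x.
Proof. by rewrite weightE mulr_ge0 ?sqr_ge0. Qed.

Lemma weight_gt0 x : x <> a1 -> x <> a2 -> 0 < weight a1 a2 x.
Proof.
move=> /eqP x1 /eqP x2; rewrite weightE mulr_gt0 ?exprn_gt0// mulr_gt0// invr_gt0;
  exact: sqdist_gt0.
Qed.

Lemma measurable_sqdist a : measurable_fun setT (@sqdist R N a).
Proof. by apply: continuous_measurable_rV; apply: smooth_cont; exact: smooth_sqdist. Qed.

Lemma measurable_inv_comp (g : 'rV[R]_N -> R) : measurable_fun setT g ->
  measurable_fun setT (fun x => (g x)^-1).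
Proof. by move=> mg; exact: (measurableT_comp (@measurable_invr R) mg). Qed.

Lemma measurable_weight : measurable_fun setT (weight a1 a2).
Proof.
rewrite (_ : weight a1 a2 = fun x => d ^+ 2 * ((sqdist a1 x)^-1 * (sqdist a2 x)^-1) ^+ 2).
  apply: measurable_funM => //; apply: measurable_funX.
  by apply: measurable_funM; apply: measurable_inv_comp; exact: measurable_sqdist.
by apply/funext => x; rewrite weightE.
Qed.

Lemma ae_off_poles (P : 'rV[R]_N -> Prop) :
  (forall x, x <> a1 -> x <> a2 -> P x) -> {ae leb, forall x, P x}.
Proof.
move=> h; have N0 : (0 < N)%N by apply: leq_trans hN.
exists ([set a1] `|` [set a2]); split.
- by apply: measurableU; exact: measurable_rV_set1.
- exact: (null_set_setU (measurable_rV_set1 _) (measurable_rV_set1 _)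
    (lebesgue_set1 N0 _) (lebesgue_set1 N0 _)).
- move=> x /= Px; apply: contrapT => /not_orP[x1 x2]; exact/Px/h.
Qed.

Let eps (m : nat) : R := m.+1%:R^-1.
Let eps_gt0 m : 0 < eps m. Proof. by rewrite invr_gt0. Qed.
Let eps_le1 m : eps m <= 1. Proof. by rewrite invf_le1// ler1n. Qed.
Let eps_cvg : eps m @[m --> \oo] --> (0 : R). Proof. exact: cvg_harmonic. Qed.

Let s : R := (N%:R - 4) / 4.
Let s_gt0 : 0 < s.
Proof. by rewrite divr_gt0// subr_gt0 ltr_nat. Qed.
Let sN : N%:R = 4 * s + 4. Proof. by rewrite /s; field. Qed.

Definition rellich_const : R := N%:R ^+ 2 * (N%:R - 4) ^+ 2 / 16.

Let CE : 16 * s ^+ 2 * (s + 1) ^+ 2 = rellich_const.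
Proof. by rewrite /rellich_const sN; field. Qed.

Lemma rellich_const_gt0 : 0 < rellich_const.
Proof. have s1 : 0 < s + 1 by rewrite addr_gt0.
by rewrite -CE; apply: mulr_gt0; [apply: mulr_gt0 => //|]; exact: exprn_gt0. Qed.

Let pot m tau x := regularised_potential N%:R s tau (eps m) d
  (sqdist a1 x + eps m) (sqdist a2 x + eps m).

Let pot0 tau x := regularised_potential N%:R s tau 0 d (sqdist a1 x) (sqdist a2 x).

Let sqdist_eps_gt0 (a x : 'rV[R]_N) m : 0 < sqdist a x + eps m.
Proof. by rewrite ltr_wpDl// sqdist_ge0. Qed.

Let measurable_regularised e tau : measurable_fun setT (fun x : 'rV[R]_N =>
  regularised_potential N%:R s tau e d (sqdist a1 x + e) (sqdist a2 x + e)).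
Proof.
have m1 a : measurable_fun setT (fun x : 'rV[R]_N => sqdist a x + e).
  by apply: measurable_funD => //; exact: measurable_sqdist.
have i1 := measurable_inv_comp (m1 a1); have i2 := measurable_inv_comp (m1 a2).
have m12 := measurable_funD (m1 a1) (m1 a2); have ip := measurable_funM i1 i2.
have i12 := measurable_inv_comp m12.
have i12' := measurable_inv_comp (measurable_funX 2 m12).
have cst (c : R) : measurable_fun setT (fun _ : 'rV[R]_N => c) by exact: measurable_cst.
have T2 := measurable_funM (measurable_funM (cst (2 * (d + 2 * e))) ip) i12'.
have T3 := measurable_funM (measurable_funM (cst (2 * e))
  (measurable_funD (measurable_funX 2 i1) (measurable_funX 2 i2))) i12'.
have T4 := measurable_funM (measurable_funM (cst (N%:R * e)) (measurable_funM i2 i12))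
  (measurable_funB (measurable_funX 2 i1) (measurable_funX 2 i2)).
have T1 := measurable_funM (cst (16 * s ^+ 2 * (s + 1) ^+ 2 * (d + 2 * e) ^+ 2))
  (measurable_funX 2 ip).
have T5 := measurable_funM (measurable_funM (cst (tau ^+ 2)) (measurable_funX 2 ip))
  (cst (2 * s ^+ 2)^-1).
exact: (measurable_funB (measurable_funD T1 (measurable_funM (cst (2 * tau))
  (measurable_funD (measurable_funB T2 T3) T4))) T5).
Qed.

Let cvg_eps_sqdist (a x : 'rV[R]_N) : sqdist a x + eps m @[m --> \oo] --> (sqdist a x : R).
Proof. by rewrite -[X in _ --> X]addr0; apply: cvgD => //; exact: cvg_cst. Qed.

Let cvg_pot tau x : x <> a1 -> x <> a2 -> pot m tau x @[m --> \oo] --> pot0 tau x.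
Proof.
move=> /eqP/sqdist_gt0 x1 /eqP/sqdist_gt0 x2.
have c1 := @cvg_eps_sqdist a1 x; have c2 := @cvg_eps_sqdist a2 x.
have c12 := scvgD c1 c2.
have i1 := scvgV (lt0r_neq0 x1) c1; have i2 := scvgV (lt0r_neq0 x2) c2.
have i12 := scvgV (lt0r_neq0 (addr_gt0 x1 x2)) c12.
have n0 : (sqdist a1 x + sqdist a2 x) ^+ 2 != 0 by apply: lt0r_neq0; pos.
have i12' := scvgV n0 (scvgX (n := 2) c12).
have cst (c : R) : c @[_ --> \oo] --> c by exact: cvg_cst.
have cd := scvgD (cst d) (scvgM (cst 2) eps_cvg).
have ip := scvgM i1 i2.
have T1 := scvgM (scvgM (cst (16 * s ^+ 2 * (s + 1) ^+ 2)) (scvgX (n := 2) cd)) (scvgX (n := 2) ip).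
have T2 := scvgM (scvgM (scvgM (cst 2) cd) ip) i12'.
have T3 := scvgM (scvgM (scvgM (cst 2) eps_cvg) (scvgD (scvgX (n := 2) i1) (scvgX (n := 2) i2))) i12'.
have T4 := scvgM (scvgM (scvgM (cst N%:R) eps_cvg) (scvgM i2 i12))
  (scvgB (scvgX (n := 2) i1) (scvgX (n := 2) i2)).
have T5 := scvgM (scvgM (cst (tau ^+ 2)) (scvgX (n := 2) ip)) (cst (2 * s ^+ 2)^-1).
exact: (scvgB (scvgD T1 (scvgM (cst (2 * tau)) (scvgD (scvgB T2 T3) T4))) T5).
Qed.

Let pot00 x : pot0 0 x = rellich_const * weight a1 a2 x.
Proof.
rewrite /pot0 /regularised_potential weightE -CE mulr0 addr0 mulr0 !mul0r addr0.
by rewrite expr0n /= !mul0r subr0 mulrA.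
Qed.

(** For [tau = 0] the regularised potential is nonnegative, so Fatou's lemma is enough
    to let [eps] tend to zero. *)
Lemma rellich_bipolar (u : 'rV[R]_N -> R) : test_function u ->
  (\int[leb]_x (rellich_const * (weight a1 a2 x * u x ^+ 2))%:E <=
   \int[leb]_x (laplacian u x ^+ 2)%:E)%E.
Proof.
move=> tu; have mu : measurable_fun setT u.
  by apply: continuous_measurable_rV; apply: smooth_cont; case: tu.
apply: (@fatou_ae _ _ _ leb (fun m x => pot m 0 x * u x ^+ 2) _
  (fun=> \int[leb]_x (laplacian u x ^+ 2)%:E)%E).
- by move=> m; apply: measurable_funM; [exact: measurable_regularised|exact: measurable_funX].
- apply: measurable_funM => //; apply: measurable_funM; first exact: measurable_weight.
  exact: measurable_funX.
- move=> m x; rewrite mulr_ge0 ?sqr_ge0// /pot /regularised_potential.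
  rewrite mulr0 !mul0r addr0 expr0n /= !mul0r subr0.
  by pos.
- by move=> x; have := weight_ge0 x; have := rellich_const_gt0 => ? ?; pos.
- apply: ae_off_poles => x x1 x2; rewrite mulrA -pot00.
  by apply: scvgM; [exact: cvg_pot|exact: cvg_cst].
- by move=> m; exact: integral_bipolar_potential.
- exact: cvg_cst.
Qed.

Let integrable_weight (u : 'rV[R]_N -> R) : test_function u ->
  leb.-integrable setT (fun x => (rellich_const * (weight a1 a2 x * u x ^+ 2))%:E).
Proof.
move=> tu; have bu := test_function_bsupp tu; have := rellich_bipolar tu.
case: tu => su _ h; apply/integrableP; split.
  apply/measurable_EFinP; apply: measurable_funM => //; apply: measurable_funM.
    exact: measurable_weight.
  by apply: measurable_funX; apply: continuous_measurable_rV; exact: smooth_cont.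
have hL : leb.-integrable setT (EFin \o (fun x => laplacian u x ^+ 2)).
  apply: integrable_bsupp.
    by apply: smooth_cont; exact: (smoothX 2 (smooth_laplacian su)).
  rewrite (_ : (fun x => _) = fun x => laplacian u x * laplacian u x).
    by apply: bsuppM; exact: bsupp_laplacian.
  by apply/funext => x; rewrite expr2.
have /integrableP[_ hoo] := hL.
apply: (le_lt_trans _ hoo); under eq_integral.
  move=> x _; rewrite gee0_abs; last first.
    by rewrite lee_fin; have := weight_ge0 x; have := rellich_const_gt0 => ? ?; pos.
  over.
apply: (le_trans h); under [leRHS]eq_integral do rewrite /= ger0_norm ?sqr_ge0//.
exact: lexx.
Qed.

(** For [tau > 0] the potential changes sign and dominated convergence takes over.
    On a bounded set, where [A] and [B] are at most [M], every term is dominated by the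
    two-pole weight uniformly in [e]: each power of [e] compensates one factor
    [A^-1] or [B^-1], and [(A + B)^-1 (A^-1 + B^-1) = A^-1 B^-1]. *)
Let pot_bound M tau A B e : 0 < e -> e <= 1 -> e <= A -> e <= B -> A <= M -> B <= M ->
  0 <= tau ->
  `|regularised_potential N%:R s tau e d A B| <=
    (16 * s ^+ 2 * (s + 1) ^+ 2 * (d + 2) ^+ 2
     + 2 * tau * (2 * (d + 2) + 4 * M + N%:R * M) + tau ^+ 2 / (2 * s ^+ 2))
    * (A^-1 * B^-1) ^+ 2.
Proof.
move=> e0 e1 eA eB AM BM t0.
have A0 : 0 < A by exact: lt_le_trans eA.
have B0 : 0 < B by exact: lt_le_trans eB.
have S0 : 0 < A + B by rewrite addr_gt0.
have pA : A^-1 * A = 1 by rewrite mulVf ?gt_eqF.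
have qB : B^-1 * B = 1 by rewrite mulVf ?gt_eqF.
have kS : (A + B)^-1 * (A + B) = 1 by rewrite mulVf ?gt_eqF.
have p0 : 0 < A^-1 by rewrite invr_gt0.
have q0 : 0 < B^-1 by rewrite invr_gt0.
have k0 : 0 < (A + B)^-1 by rewrite invr_gt0.
have kp : (A + B)^-1 <= A^-1 by rewrite lef_pV2 ?posrE// lerDl ltW.
have kq : (A + B)^-1 <= B^-1 by rewrite lef_pV2 ?posrE// lerDr ltW.
have ep : e * A^-1 <= 1 by rewrite ler_pdivrMr ?mul1r.
have eq : e * B^-1 <= 1 by rewrite ler_pdivrMr ?mul1r.
rewrite /regularised_potential -!exprVn.
move: pA qB kS p0 q0 k0 kp kq ep eq.
move: (A^-1) (B^-1) ((A + B)^-1) => p q k pA qB kS p0 q0 k0 kp kq ep eq.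
have pq0 : 0 <= p * q by rewrite mulr_ge0// ltW.
have epp : e * p ^+ 2 <= p by rewrite expr2 mulrA ger_pMl.
have eqq : e * q ^+ 2 <= q by rewrite expr2 mulrA ger_pMl.
have ep0 : 0 <= e * p ^+ 2 by rewrite mulr_ge0 ?sqr_ge0// ltW.
have eq0 : 0 <= e * q ^+ 2 by rewrite mulr_ge0 ?sqr_ge0// ltW.
have kk : k ^+ 2 <= p * q by rewrite expr2 ler_pM// ltW.
have kpq : k * (p + q) = p * q.
  transitivity (k * (A + B) * (p * q)); last by rewrite kS mul1r.
  transitivity (k * (p * (q * B) + q * (p * A))); first by rewrite pA qB !mulr1.
  by ring.
have pqA : p * q ^+ 2 <= M * (p * q) ^+ 2.
  rewrite -[leLHS]mul1r -pA (_ : p * A * _ = A * (p * q) ^+ 2); last by ring.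
  by rewrite ler_wpM2r ?sqr_ge0.
have pqB : p ^+ 2 * q <= M * (p * q) ^+ 2.
  rewrite -[leLHS]mul1r -qB (_ : q * B * _ = B * (p * q) ^+ 2); last by ring.
  by rewrite ler_wpM2r ?sqr_ge0.
set X := (p * q) ^+ 2 in pqA pqB *.
have X0 : 0 <= X by rewrite sqr_ge0.
have de : 0 <= d + 2 * e by rewrite addr_ge0 ?mulr_ge0// ltW.
have de2 : d + 2 * e <= d + 2 by rewrite lerD2l ger_pMr.
have s2 : 0 <= s ^+ 2 by exact: sqr_ge0.
have h1 : 0 <= 16 * s ^+ 2 * (s + 1) ^+ 2 * (d + 2 * e) ^+ 2 * X
    <= 16 * s ^+ 2 * (s + 1) ^+ 2 * (d + 2) ^+ 2 * X.
  have c0 : 0 <= 16 * s ^+ 2 * (s + 1) ^+ 2 by pos.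
  apply/andP; split; first by pos.
  by rewrite ler_wpM2r// ler_wpM2l// ler_sqr ?nnegrE// (le_trans de).
have h2 : 0 <= 2 * (d + 2 * e) * (p * q) * k ^+ 2 <= 2 * (d + 2) * X.
  apply/andP; split; first by apply: mulr_ge0; [apply: mulr_ge0 => //; apply: mulr_ge0|exact: sqr_ge0].
  rewrite -(mulrA (2 * _)); apply: ler_pM; [by apply: mulr_ge0| |by rewrite ler_wpM2l|].
    by apply: mulr_ge0 => //; exact: sqr_ge0.
  by rewrite /X [leRHS]expr2 ler_wpM2l.
have h3 : 0 <= 2 * e * (p ^+ 2 + q ^+ 2) * k ^+ 2 <= 4 * M * X.
  have a1' : e * p ^+ 2 * k ^+ 2 <= p * q ^+ 2.
    by apply: ler_pM; rewrite ?sqr_ge0// ler_sqr ?nnegrE// ltW.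
  have a2' : e * q ^+ 2 * k ^+ 2 <= p ^+ 2 * q.
    by rewrite [leRHS]mulrC; apply: ler_pM; rewrite ?sqr_ge0// ler_sqr ?nnegrE// ltW.
  apply/andP; split; first by pos.
  rewrite (_ : 2 * e * _ * _ = 2 * (e * p ^+ 2 * k ^+ 2 + e * q ^+ 2 * k ^+ 2)); last by ring.
  lra.
have h4 : `|N%:R * e * (q * k) * (p ^+ 2 - q ^+ 2)| <= N%:R * M * X.
  rewrite (_ : N%:R * e * (q * k) * (p ^+ 2 - q ^+ 2) =
    N%:R * (q * (k * (e * p ^+ 2 - e * q ^+ 2)))); last by ring.
  rewrite normrM normr_nat -mulrA ler_wpM2l// normrM gtr0_norm// normrM gtr0_norm//.
  apply: (le_trans _ pqA); rewrite [leRHS](_ : _ = q * (p * q)); last by ring.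
  rewrite ler_pM2l// -kpq ler_pM2l//.
  by rewrite ler_norml; apply/andP; split; lra.
have h5 : 0 <= tau ^+ 2 * X / (2 * s ^+ 2) <= tau ^+ 2 / (2 * s ^+ 2) * X.
  apply/andP; split; last by rewrite mulrAC.
  by apply: mulr_ge0; pos.
move: h1 h2 h3 h4 h5.
set Y1 := 16 * _ * _ * (d + 2 * e) ^+ 2 * X; set Y1' := 16 * _ * _ * _ * X.
set Y2 := 2 * (d + 2 * e) * _ * _; set Y3 := 2 * e * _ * _.
set Y4 := N%:R * e * _ * _; set Y5 := tau ^+ 2 * X / _.
move=> /andP[h1 h1'] /andP[h2 h2'] /andP[h3 h3']; rewrite ler_norml => /andP[h4 h4'] /andP[h5 h5'].
rewrite [leRHS](_ : _ = Y1' + 2 * tau * (2 * (d + 2) * X + 4 * M * X + N%:R * M * X) +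
  tau ^+ 2 / (2 * s ^+ 2) * X); last by rewrite /Y1'; ring.
have b1 : - (2 * (d + 2) * X + 4 * M * X + N%:R * M * X) <= Y2 - Y3 + Y4 by lra.
have b2 : Y2 - Y3 + Y4 <= 2 * (d + 2) * X + 4 * M * X + N%:R * M * X by lra.
have t2 : 0 <= 2 * tau by rewrite mulr_ge0.
have := ler_wpM2l t2 b1; have := ler_wpM2l t2 b2; rewrite mulrN ler_norml.
by move=> c1 c2; apply/andP; split; lra.
Qed.

(** The coefficient of [tau] in the potential once [eps] is gone.  It is positive off the
    poles, which is what rules out extremal functions. *)
Definition gain x : R :=
  4 * d * ((sqdist a1 x)^-1 * (sqdist a2 x)^-1) / (sqdist a1 x + sqdist a2 x) ^+ 2.

Lemma gain_gt0 x : x <> a1 -> x <> a2 -> 0 < gain x.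
Proof.
move=> /eqP/sqdist_gt0 x1 /eqP/sqdist_gt0 x2.
by apply: divr_gt0; pos.
Qed.

Lemma gain_ge0 x : 0 <= gain x.
Proof.
by rewrite /gain; pos.
Qed.

Lemma measurable_gain : measurable_fun setT gain.
Proof.
have m1 a := measurable_sqdist a; have i1 a := measurable_inv_comp (m1 a).
exact: (measurable_funM (measurable_funM (@measurable_cst _ _ _ _ _ (4 * d))
  (measurable_funM (i1 a1) (i1 a2)))
  (measurable_inv_comp (measurable_funX 2 (measurable_funD (m1 a1) (m1 a2))))).
Qed.

(** The term of the potential quadratic in [tau] is this multiple of [tau ^ 2] times
    the sharp two-pole weight, hence is controlled by the energy. *)
Definition gain_loss : R := (2 * s ^+ 2 * d ^+ 2 * rellich_const)^-1.

Lemma gain_loss_ge0 : 0 <= gain_loss.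
Proof. by have := rellich_const_gt0 => ?; rewrite /gain_loss; pos. Qed.

Let pot0E tau x : rellich_const * weight a1 a2 x + tau * gain x =
  pot0 tau x + gain_loss * tau ^+ 2 * (rellich_const * weight a1 a2 x).
Proof.
rewrite /pot0 /regularised_potential CE weightE /gain /gain_loss.
have C0 := lt0r_neq0 rellich_const_gt0; have s0 := lt0r_neq0 s_gt0.
have d0 := lt0r_neq0 d_gt0.
move: ((sqdist a1 x)^-1 * _) ((_ + _) ^- 2) (rellich_const) C0 => X Y C C0.
have key (e r t n P Q U : R) : C != 0 -> r != 0 -> e != 0 ->
    C * (e ^+ 2 * X ^+ 2) + t * (4 * e * X * Y) =
    C * (e + 2 * 0) ^+ 2 * X ^+ 2 + 2 * t * (2 * (e + 2 * 0) * X * Y -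
      2 * 0 * P * Y + n * 0 * Q * U) - t ^+ 2 * X ^+ 2 / (2 * r ^+ 2) +
    (2 * r ^+ 2 * e ^+ 2 * C)^-1 * t ^+ 2 * (C * (e ^+ 2 * X ^+ 2)).
  move=> C1 r1 e1; by field; rewrite C1 e1 r1.
exact: key.
Qed.

(** The loss is quadratic in [tau] whereas the gain is linear: this is what
    forbids equality. *)
Lemma rellich_bipolar_improved tau (u : 'rV[R]_N -> R) : 0 <= tau -> test_function u ->
  (\int[leb]_x ((rellich_const * weight a1 a2 x + tau * gain x) * u x ^+ 2)%:E <=
   (1 + gain_loss * tau ^+ 2)%:E * \int[leb]_x (laplacian u x ^+ 2)%:E)%E.
Proof.
move=> t0 tu; have iW := integrable_weight tu; have hW := rellich_bipolar tu.
have [M0 hM0] := test_function_bsupp tu.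
have su : smooth u by case: tu.
have mu : measurable_fun setT u by apply: continuous_measurable_rV; exact: smooth_cont.
have [M1 hM1] := continuous_bounded_cube M0 (smooth_cont (smooth_sqdist a1)).
have [M2 hM2] := continuous_bounded_cube M0 (smooth_cont (smooth_sqdist a2)).
pose M := Num.max M1 M2 + 1.
pose K := 16 * s ^+ 2 * (s + 1) ^+ 2 * (d + 2) ^+ 2
     + 2 * tau * (2 * (d + 2) + 4 * M + N%:R * M) + tau ^+ 2 / (2 * s ^+ 2).
pose g x := K / (d ^+ 2 * rellich_const) * (rellich_const * (weight a1 a2 x * u x ^+ 2)).
have ig : leb.-integrable setT (EFin \o g).
  have := integrableZl measurableT (K / (d ^+ 2 * rellich_const)) iW.
  by apply: eq_integrable => // x _; rewrite /= -EFinM.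
have mpot : measurable_fun setT (pot0 tau).
  have := measurable_regularised 0 tau; rewrite /pot0.
  by under eq_fun do rewrite !addr0.
have hg m x : x <> a1 -> x <> a2 -> `|pot m tau x * u x ^+ 2| <= g x.
  move=> /eqP/sqdist_gt0 x1 /eqP/sqdist_gt0 x2.
  have gE : g x = K * ((sqdist a1 x)^-1 * (sqdist a2 x)^-1) ^+ 2 * u x ^+ 2.
    rewrite /g weightE; have := lt0r_neq0 d_gt0; have := lt0r_neq0 rellich_const_gt0.
    by move: (_ ^-1 * _) => Z h1 h2; field; rewrite h1 h2.
  have [cx|/hM0 u0] := pselect (cube M0 x); last by rewrite gE u0 expr0n /= !mulr0 normr0.
  rewrite gE normrM [`|u x ^+ 2|]ger0_norm ?sqr_ge0// ler_wpM2r ?sqr_ge0//.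
  have Ma1 : sqdist a1 x + eps m <= M.
    rewrite lerD// (le_trans (ler_norm _))// (le_trans (hM1 _ cx))//.
    by rewrite le_max lexx.
  have Ma2 : sqdist a2 x + eps m <= M.
    rewrite lerD// (le_trans (ler_norm _))// (le_trans (hM2 _ cx))//.
    by rewrite le_max lexx orbT.
  have M_ge0 : 0 <= M by apply: le_trans Ma1; exact: ltW.
  apply: (le_trans (pot_bound (eps_gt0 m) (eps_le1 m) _ _ Ma1 Ma2 t0)).
  - by rewrite lerDr sqdist_ge0.
  - by rewrite lerDr sqdist_ge0.
  - rewrite ler_wpM2l//.
      by pos.
    rewrite ler_sqr ?nnegrE; [|by pos; exact: ltW|by pos].
    apply: ler_pM; [by pos; exact: ltW|by pos; exact: ltW| |].
      by rewrite lef_pV2 ?posrE// lerDl ltW.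
    by rewrite lef_pV2 ?posrE// lerDl ltW.
have [|||||ip _ cp] := @dominated_convergence _ _ _ leb setT measurableT
  (fun m x => (pot m tau x * u x ^+ 2)%:E) (fun x => (pot0 tau x * u x ^+ 2)%:E) (EFin \o g).
- move=> m; apply/measurable_EFinP; apply: measurable_funM; last exact: measurable_funX.
  exact: measurable_regularised.
- by apply/measurable_EFinP; apply: measurable_funM => //; exact: measurable_funX.
- apply: ae_off_poles => x x1 x2 _; apply/cvg_EFin; first exact: nearW.
  by apply: scvgM; [exact: cvg_pot|exact: cvg_cst].
- exact: ig.
- by apply: ae_off_poles => x x1 x2 m _; rewrite lee_fin; exact: hg.
have hp : (\int[leb]_x (pot0 tau x * u x ^+ 2)%:E <= \int[leb]_x (laplacian u x ^+ 2)%:E)%E.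
  apply: (cvge_le _ cp); apply: nearW => m.
  exact: (@integral_bipolar_potential R N a1 a2 _ (eps_gt0 m) s tau s_gt0 sN u tu).
have iW' := integrableZl measurableT (gain_loss * tau ^+ 2) iW.
rewrite (_ : (fun x => _) = (fun x => (pot0 tau x * u x ^+ 2)%:E +
   (gain_loss * tau ^+ 2)%:E * (rellich_const * (weight a1 a2 x * u x ^+ 2))%:E)%E); last first.
  by apply/funext => x; rewrite pot0E -EFinM -EFinD; congr EFin; ring.
rewrite (integralD measurableT ip iW') (integralZl measurableT iW).
have gl0 : 0 <= gain_loss * tau ^+ 2 by apply: mulr_ge0; [exact: gain_loss_ge0|exact: sqr_ge0].
rewrite EFinD ge0_muleDl// ?lee_fin// mul1e; apply: leeD => //.
by rewrite lee_wpmul2l// lee_fin.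
Qed.

End limit.

(** * Passage to the completion *)

Section almost_everywhere.
Context d (T : measurableType d) (R : realType) (mu : {measure set T -> \bar R}).

(** The sum of the [g k] has a finite integral, so it is finite almost everywhere and
    its terms tend to zero there. *)
Lemma ae_cvg0_summable (g : nat -> T -> R) :
  (forall k, measurable_fun setT (g k)) -> (forall k x, 0 <= g k x) ->
  (forall k, (\int[mu]_x (g k x)%:E <= (1 / (2 ^ k.+1)%:R)%:E)%E) ->
  {ae mu, forall x, g k x @[k --> \oo] --> (0 : R)}.
Proof.
move=> mg g0 hg.
have mg' k : measurable_fun setT (fun x => (g k x)%:E) by exact/measurable_EFinP.
have sumE : (\int[mu]_x (\sum_(k <oo) (g k x)%:E) <= 1%:E)%E.
  rewrite integral_nneseries//; last by move=> k x _; rewrite lee_fin.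
  apply: (le_trans _ (epsilon_trick0 xpredT ler01)); apply: lee_nneseries => // k _ _.
  by apply: integral_ge0 => x _; rewrite lee_fin.
have ms : measurable_fun setT (fun x => \sum_(k <oo) (g k x)%:E)%E.
  by apply: ge0_emeasurable_sum => // k x _; rewrite lee_fin.
have s0 x : (0 <= \sum_(k <oo) (g k x)%:E)%E.
  by apply: nneseries_ge0 => k _ _; rewrite lee_fin.
have /integrable_ae : mu.-integrable setT (fun x => \sum_(k <oo) (g k x)%:E)%E.
  apply/integrableP; split => //; under eq_integral do rewrite gee0_abs//.
  exact: le_lt_trans sumE (ltry _).
move=> /(_ measurableT); apply: filterS => x /(_ I) fx.
apply: cvg_series_cvg_0; apply: nondecreasing_is_cvgn.
  by apply/nondecreasing_seqP => k; rewrite /series /= big_nat_recr//= lerDl.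
exists (fine (\sum_(k <oo) (g k x)%:E)%E) => _ [k _ <-].
rewrite -lee_fin fineK// /series /= -sumEFin.
by apply: nneseries_lim_ge => j _ _; rewrite lee_fin.
Qed.

End almost_everywhere.

Section completion.
Context (R : realType) (N : nat).
Implicit Types (u w : 'rV[R]_N -> R).
Local Notation leb := (lebesgue_rV R N).

(** The [k]-th function is chosen so close to [u] in [L^1] of the cube of size [k] that
    the errors are summable; the rate for the Laplacians keeps the sharp constant in the limit
    taken by [D22_weighted]. *)
Lemma D22_ae_subsequence u w : D22 u w -> exists phi : nat -> 'rV[R]_N -> R,
  [/\ forall k, test_function (phi k),
      {ae leb, forall x, phi k x @[k --> \oo] --> u x} &
      forall k, (\int[leb]_x (`|laplacian (phi k) x - w x| ^+ 2)%:E
                 <= (k.+1%:R^-1 ^+ 2)%:E)%E].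
Proof.
move=> [mu mw [phi [tphi locphi lapphi]]].
have /choice[n hn] : forall k, exists n,
    (\int[leb]_(x in cube k%:R) (`|phi n x - u x|)%:E <= (1 / (2 ^ k.+1)%:R)%:E)%E /\
    (\int[leb]_x (`|laplacian (phi n) x - w x| ^+ 2)%:E <= (k.+1%:R^-1 ^+ 2)%:E)%E.
  move=> k; near \oo => n; exists n; split.
    apply: ltW; near: n; apply: ((locphi _ (@compact_cube R N k%:R)) [set z | (z < _)%E]).
    by apply: open_nbhs_nbhs; split; [exact: open_ereal_lt_ereal|rewrite /= lte_fin divr_gt0].
  apply: ltW; near: n; apply: (lapphi [set z | (z < _)%E]).
  by apply: open_nbhs_nbhs; split; [exact: open_ereal_lt_ereal|rewrite /= lte_fin exprn_gt0].
exists (phi \o n); split=> [k||k]; [exact: tphi| |by have [] := hn k].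
pose g k x : R := `|phi (n k) x - u x| * \1_(cube k%:R) x.
have mphi k : measurable_fun setT (phi k).
  by apply: continuous_measurable_rV; apply: smooth_cont; case: (tphi k).
have mg k : measurable_fun setT (g k).
  apply: measurable_funM.
    by apply: measurableT_comp => //; exact: measurable_funB.
  by apply: measurable_indic; exact: measurable_cube.
have g0 k x : 0 <= g k x by rewrite mulr_ge0.
have hg k : (\int[leb]_x (g k x)%:E <= (1 / (2 ^ k.+1)%:R)%:E)%E.
  have [+ _] := hn k; apply: le_trans.
  rewrite [leRHS]integral_mkcond le_eqVlt; apply/orP; left; apply/eqP.
  apply: eq_integral => x _; rewrite patchE /g indicE.
  by case: ifPn; rewrite ?mulr1 ?mulr0.
have := ae_cvg0_summable mg g0 hg; apply: filterS => x gx.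
rewrite -[X in _ --> X]add0r.
have : (fun k => phi (n k) x - u x) @ \oo --> (0 : R).
  apply: norm_cvg0; apply: cvg_trans gx; apply: near_eq_cvg.
  have [K hK] : exists K : nat, `|x| <= K%:R.
    by exists (Num.bound `|x|); apply/ltW/archi_boundP.
  exists K => // k /= Kk; rewrite /g indicE mem_set ?mulr1// => i.
  by rewrite (le_trans (coord_le_norm _ _))// (le_trans hK)// ler_nat.
move=> h; have hc : (fun _ : nat => u x) @ \oo --> u x by exact: cvg_cst.
by have := scvgD h hc; under eq_cvg do rewrite subrK.
Unshelve. all: by end_near. Qed.

Lemma norm2E w : norm2 w = (\int[leb]_x (w x ^+ 2)%:E)%E.
Proof. by apply: eq_integral => x _; rewrite real_normK// num_real. Qed.

(** The triangle inequality in the form [(a + b)^2 <= (1 + eta) a^2 + (1 + 1/eta) b^2]: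
    the first factor can be taken arbitrarily close to [1]. *)
Lemma norm2_le_add w v (eta : R) : 0 < eta -> measurable_fun setT w ->
  measurable_fun setT v ->
  (norm2 v <= (1 + eta)%:E * norm2 w +
     (1 + eta^-1)%:E * \int[leb]_x (`|v x - w x| ^+ 2)%:E)%E.
Proof.
move=> eta0 mw mv; have eV0 : 0 < eta^-1 by rewrite invr_gt0.
have mv2 : measurable_fun setT (fun x => (`|v x - w x| ^+ 2)%:E).
  apply/measurable_EFinP; apply: measurable_funX; apply: measurableT_comp => //.
  exact: measurable_funB.
have mw2 : measurable_fun setT (fun x => (`|w x| ^+ 2)%:E).
  by apply/measurable_EFinP; apply: measurable_funX; exact: measurableT_comp.
rewrite /norm2 -!ge0_integralZl_EFin//; try by move=> *; rewrite ?lee_fin ?sqr_ge0.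
all: try by rewrite addr_ge0// ltW.
rewrite -ge0_integralD//.
- apply: ge0_le_integral => //.
  + by apply/measurable_EFinP; apply: measurable_funX; exact: measurableT_comp.
  + by apply: emeasurable_funD; exact: measurable_funeM.
  + move=> x _; rewrite -!EFinM -EFinD lee_fin !real_normK ?num_real//.
    have ee : eta^-1 * eta = 1 by rewrite mulVf// gt_eqF.
    rewrite -subr_ge0 (_ : _ - _ = eta^-1 * (eta * w x - (v x - w x)) ^+ 2).
      by rewrite mulr_ge0 ?sqr_ge0// ltW.
    have e0 := lt0r_neq0 eta0.
    by field.
- by move=> x _; rewrite mule_ge0 ?lee_fin ?sqr_ge0// addr_ge0// ltW.
- exact: measurable_funeM.
- by move=> x _; rewrite mule_ge0 ?lee_fin ?sqr_ge0// addr_ge0// ltW.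
- exact: measurable_funeM.
Qed.

Lemma test_function_norm2_lty u : test_function u -> (norm2 (laplacian u) < +oo)%E.
Proof.
move=> tu; have bu := test_function_bsupp tu; case: tu => su _; rewrite norm2E.
have /integrableP[_] : leb.-integrable setT (EFin \o (fun x => laplacian u x ^+ 2)).
  apply: integrable_bsupp.
    by apply: smooth_cont; exact: (smoothX 2 (smooth_laplacian su)).
  rewrite (_ : (fun x => _) = fun x => laplacian u x * laplacian u x).
    by apply: bsuppM; exact: bsupp_laplacian.
  by apply/funext => x; rewrite expr2.
apply: le_lt_trans; rewrite le_eqVlt; apply/orP; left; apply/eqP.
by apply: eq_integral => x _; rewrite /= ger0_norm ?sqr_ge0.
Qed.

Lemma D22_norm2_fin_num u w : D22 u w -> norm2 w \is a fin_num.
Proof.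
move=> Duw; have [phi [tphi _ hphi]] := D22_ae_subsequence Duw.
have [_ mw _] := Duw.
have mL : measurable_fun setT (laplacian (phi 0%N)).
  apply: continuous_measurable_rV; apply: smooth_cont; apply: smooth_laplacian.
  by case: (tphi 0%N).
rewrite ge0_fin_numE; last by apply: integral_ge0 => x _; rewrite lee_fin sqr_ge0.
apply: (le_lt_trans (norm2_le_add ltr01 mL mw)); apply: lte_add_pinfty.
  by rewrite lte_mul_pinfty// ?lee_fin// test_function_norm2_lty.
rewrite lte_mul_pinfty ?lee_fin//.
under eq_integral do rewrite distrC.
exact: le_lt_trans (hphi 0%N) (ltry _).
Qed.

(** Fatou's lemma along an almost everywhere convergent subsequence. *)
Lemma D22_weighted (Om : 'rV[R]_N -> R) (A : R) : 0 <= A ->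
  measurable_fun setT Om -> (forall x, 0 <= Om x) ->
  (forall phi, test_function phi ->
    (\int[leb]_x (Om x * phi x ^+ 2)%:E <= A%:E * norm2 (laplacian phi))%E) ->
  forall u w, D22 u w -> (\int[leb]_x (Om x * u x ^+ 2)%:E <= A%:E * norm2 w)%E.
Proof.
move=> A0 mOm Om0 hA u w Duw; have [phi [tphi aephi hphi]] := D22_ae_subsequence Duw.
have [mu mw _] := Duw.
have mphi k : measurable_fun setT (phi k).
  by apply: continuous_measurable_rV; apply: smooth_cont; case: (tphi k).
have mL k : measurable_fun setT (laplacian (phi k)).
  apply: continuous_measurable_rV; apply: smooth_cont; apply: smooth_laplacian.
  by case: (tphi k).
have Xfin := D22_norm2_fin_num Duw; pose X := fine (norm2 w).
pose e k : R := k.+1%:R^-1.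
have e0 k : 0 < e k by rewrite invr_gt0.
pose b k := A * ((1 + e k) * X + (1 + (e k)^-1) * e k ^+ 2).
apply: (@fatou_ae _ _ _ leb (fun k x => Om x * phi k x ^+ 2) _ (EFin \o b)).
- by move=> k; apply: measurable_funM => //; exact: measurable_funX.
- by apply: measurable_funM => //; exact: measurable_funX.
- by move=> k x; rewrite mulr_ge0 ?sqr_ge0.
- by move=> x; rewrite mulr_ge0 ?sqr_ge0.
- apply: filterS aephi => x hx; apply: scvgM; first exact: cvg_cst.
  exact: scvgX.
- move=> k; apply: (le_trans (hA _ (tphi k))); rewrite /= /b EFinM lee_wpmul2l ?lee_fin//.
  apply: (le_trans (norm2_le_add (e0 k) mw (mL k))).
  rewrite [leRHS](_ : _ = (1 + e k)%:E * X%:E + (1 + (e k)^-1)%:E * (e k ^+ 2)%:E)%E.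
    rewrite /X fineK// leeD2l//; apply: lee_wpmul2l; last exact: hphi.
    by rewrite lee_fin addr_ge0// invr_ge0 ltW.
  by rewrite -!EFinM -EFinD.
- have eb : e k @[k --> \oo] --> (0 : R) by exact: cvg_harmonic.
  rewrite -(fineK Xfin) -/X -EFinM; apply/cvg_EFin; first exact: nearW.
  have -> : fine \o (EFin \o b) = fun k => A * ((1 + e k) * X + (e k ^+ 2 + e k)).
    apply/funext => k; rewrite /b /=; congr (_ * (_ + _)).
    by have := lt0r_neq0 (e0 k); move: (e k) => t t0; field.
  have cst (c : R) : c @[_ --> \oo] --> c by exact: cvg_cst.
  have := scvgM (cst A) (scvgD (scvgM (scvgD (cst 1) eb) (cst X)) (scvgD (scvgX (n := 2) eb) eb)).
  by rewrite !addr0 expr0n /= addr0 mul1r.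
Qed.

End completion.

(** * A smooth cutoff *)

Section flat.
Context (R : realType).
Implicit Types (t : R) (k : nat).

(** The family [t^-k exp(-1/t)], extended by [0] to [t <= 0], is stable under
    differentiation, which makes each of its members smooth. *)
Definition flat k t : R := if 0 < t then t^-1 ^+ k * expR (- t^-1) else 0.

Lemma flat_le0 k t : t <= 0 -> flat k t = 0.
Proof. by rewrite /flat leNgt => /negbTE ->. Qed.

Lemma flat_gt0 k t : 0 < t -> flat k t = t^-1 ^+ k * expR (- t^-1).
Proof. by rewrite /flat => ->. Qed.

Lemma flat_pos k t : 0 < t -> 0 < flat k t.
Proof. by move=> t0; rewrite flat_gt0// mulr_gt0 ?expR_gt0// exprn_gt0// invr_gt0. Qed.

Lemma flat_ge0 k t : 0 <= flat k t.
Proof. by have [/flat_le0 ->|/flat_pos/ltW] := leP t 0. Qed.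

Lemma flat0_homo t t' : t <= t' -> flat 0 t <= flat 0 t'.
Proof.
have [/flat_le0 -> _|t0 tt'] := leP t 0; first exact: flat_ge0.
have t'0 := lt_le_trans t0 tt'.
by rewrite !flat_gt0// !expr0 !mul1r ler_expR lerN2 lef_pV2.
Qed.

Lemma flatS k t : t != 0 -> flat k.+1 t = t^-1 * flat k t.
Proof.
move=> t0; have [h|h] := leP t 0; first by rewrite !flat_le0// mulr0.
by rewrite !flat_gt0// exprS mulrA.
Qed.

(** From [exp (1/t) >= (1 / ((k + 1) t))^(k + 1)]: the linear bound makes every member
    of the family differentiable at [0]. *)
Lemma flat_le_norm k t : `|flat k t| <= k.+1%:R ^+ k.+1 * `|t|.
Proof.
have [h|t0] := leP t 0; first by rewrite flat_le0// normr0 mulr_ge0// exprn_ge0.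
rewrite !gtr0_norm ?flat_pos// flat_gt0// expRN.
rewrite ler_pdivrMr ?expR_gt0// -ler_pdivrMl; last by rewrite mulr_gt0 ?exprn_gt0.
rewrite (_ : _ * _ = (k.+1%:R^-1 * t^-1) ^+ k.+1).
  rewrite (_ : expR _ = expR (k.+1%:R^-1 * t^-1) ^+ k.+1).
    rewrite lerXn2r ?nnegrE ?expR_ge0//; first by rewrite mulr_ge0// ltW// invr_gt0.
    by apply: le_trans (expR_ge1Dx _); rewrite lerDr.
  by rewrite -expRM_natl mulrA divff ?mul1r.
by rewrite invfM exprMn -exprVn -mulrA -exprS.
Qed.

Lemma is_derive_flat_gt0 k t : 0 < t ->
  is_derive t 1 (flat k) (- k%:R * flat k.+1 t + flat k.+2 t).
Proof.
move=> t0; have tn0 := lt0r_neq0 t0.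
have Dinv : is_derive t 1 (fun y : R => y^-1) (- t ^- 2) by exact: is_derive1_inv.
have nt : \forall y \near t, 0 < y by exact: lt_nbhsr.
elim: k => [|k IH].
  have D0 : is_derive t 1 (expR \o (fun y : R => - y^-1)) (expR (- t^-1) * - (- t ^- 2)).
    by apply: is_derive1_comp; exact: is_deriveN.
  rewrite oppr0 mul0r add0r (_ : flat 2 t = expR (- t^-1) * - (- t ^- 2)); last first.
    by rewrite flat_gt0// opprK mulrC exprVn.
  apply: near_eq_is_derive D0; apply: filterS nt => y y0 /=.
  by rewrite flat_gt0// expr0 mul1r.
have DM := is_deriveM Dinv IH.
rewrite (_ : _ + _ = t^-1 *: (- k%:R * flat k.+1 t + flat k.+2 t) + flat k t *: - t ^- 2).
  apply: near_eq_is_derive DM; apply: filterS nt => y y0 /=.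
  by rewrite flatS// lt0r_neq0.
rewrite /GRing.scale /= (flatS k.+2)// (flatS k.+1)// (flatS k)// -natr1.
by field.
Qed.

Lemma is_derive_flat k t :
  is_derive t 1 (flat k) (- k%:R * flat k.+1 t + flat k.+2 t).
Proof.
have [t0|t0|->] := ltgtP t 0; last 1 first.
- rewrite !flat_le0// mulr0 addr0.
  have h : (fun h : R => h^-1 *: ((flat k \o shift 0) (h *: 1) - flat k 0)) @ 0^' --> (0 : R).
    apply/cvgr0Pnorm_le => e e0; near=> h.
    have h0 : h != 0 by near: h; exact: nbhs_dnbhs_neq.
    rewrite /= [h *: 1]mulr1 addr0 (flat_le0 k (lexx 0)) subr0.
    rewrite [_ *: _](_ : _ = flat k.+1 h); last by rewrite flatS.
    apply: (le_trans (flat_le_norm _ _)).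
    rewrite -ler_pdivlMl ?exprn_gt0//; near: h; apply: dnbhs0_le.
    by rewrite mulr_gt0// invr_gt0 exprn_gt0.
  by split; [apply/cvg_ex; exists 0; exact: h|apply: cvg_lim => //; exact: h].
- rewrite !flat_le0 ?ltW// mulr0 addr0.
  have D0 : is_derive t 1 (cst (0 : R)) 0 by exact: is_derive_cst.
  apply: near_eq_is_derive D0; apply: filterS (lt_nbhsl t0) => y y0 /=.
  by rewrite flat_le0// ltW.
- exact: is_derive_flat_gt0.
Unshelve. all: by end_near. Qed.

Lemma smooth_flat (N k : nat) (u : 'rV[R]_N -> R) : smooth u -> smooth (fun x => flat k (u x)).
Proof.
move=> /smoothP hu; apply/smoothP => m; have := hu m.
have D j x : is_derive (u x) 1 (flat j) (- j%:R * flat j.+1 (u x) + flat j.+2 (u x)).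
  exact: is_derive_flat.
have D' j := continuous_comp_real (dh := fun t => - j%:R * flat j.+1 t + flat j.+2 t) (D j).
elim: m k => [|m IH] k h; first by split=> //; apply: D'; case: h.
move: (h) => [cu [du h']]; split; first exact: D'.
split=> [|i]; first exact: (pderivable_comp (dh := fun t => - k%:R * flat k.+1 t + flat k.+2 t) (D k)).
rewrite (partial_comp (dh := fun t => - k%:R * flat k.+1 t + flat k.+2 t) (D k))//.
apply: CkM; last exact: h'.
by apply: CkD; [apply: CkM; [exact: Ck_cst|]|]; exact/IH/CkW.
Qed.

Lemma d_flat (N k : nat) (u : 'rV[R]_N -> R) i x : smooth u ->
  partial i (fun x => flat k (u x)) x =
  (- k%:R * flat k.+1 (u x) + flat k.+2 (u x)) * partial i u x.
Proof.
move=> su; have D y : is_derive (u y) 1 (flat k) (- k%:R * flat k.+1 (u y) + flat k.+2 (u y)).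
  exact: is_derive_flat.
by rewrite (partial_comp (dh := fun t => - k%:R * flat k.+1 t + flat k.+2 t) D)//;
  exact: smooth_pderivable.
Qed.

End flat.

Section cutoff.
Context (R : realType) (N : nat) (a : 'rV[R]_N) (dl : R).
Hypothesis dl0 : 0 < dl.

Let sq := @sqdist R N a.

Let smooth_arg : smooth (fun x => sq x - dl).
Proof. exact: (smoothB (smooth_sqdist a) (smooth_cst dl)). Qed.

Let smooth_arg2 : smooth (fun x => 1 - expR dl^-1 * flat 0 (sq x - dl)).
Proof.
exact: (smoothB (smooth_cst 1) (smoothM (smooth_cst _) (smooth_flat 0 smooth_arg))).
Qed.

(** A nonincreasing function of the distance to [a], constant on the ball of
    squared radius [dl] and zero outside that of squared radius [2 dl]. *)
Definition cutoff x := flat 0 (1 - expR dl^-1 * flat 0 (sq x - dl)).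

Lemma smooth_cutoff : smooth cutoff.
Proof. exact: (smooth_flat 0 smooth_arg2). Qed.

Lemma cutoff_ge0 x : 0 <= cutoff x. Proof. exact: flat_ge0. Qed.

Lemma cutoff_near x : sq x <= dl -> cutoff x = flat 0 1.
Proof. by move=> h; rewrite /cutoff (@flat_le0 _ 0 (sq x - dl)) ?subr_le0// mulr0 subr0. Qed.

Let arg2_far x : 2 * dl <= sq x -> 1 - expR dl^-1 * flat 0 (sq x - dl) <= 0.
Proof.
move=> h; rewrite subr_le0 mulrC -ler_pdivrMr ?expR_gt0// mul1r.
rewrite -expRN -[leLHS]mul1r -[in leLHS](expr0 dl^-1) -flat_gt0//.
by apply: flat0_homo; rewrite lerBrDl -mulr2n -mulr_natl.
Qed.

Lemma cutoff_far x : 2 * dl <= sq x -> cutoff x = 0.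
Proof. by move=> h; rewrite /cutoff flat_le0// arg2_far. Qed.

Lemma bsupp_far (f : 'rV[R]_N -> R) : (forall x, 2 * dl <= sq x -> f x = 0) -> bsupp f.
Proof.
move=> hf; exists (\sum_(i < N) `|a ord0 i| + (2 * dl + 1)) => x /existsNP[i /negP].
rewrite -ltNge => hi; apply: hf.
have h1 : 2 * dl + 1 <= `|x ord0 i - a ord0 i|.
  have := ler_distD 0 (x ord0 i) (a ord0 i); have := lerB_dist (x ord0 i) (a ord0 i).
  rewrite !subr0 sub0r normrN => h _; apply: le_trans h.
  rewrite lerBrDr; apply: (le_trans _ (ltW hi)); rewrite [leRHS]addrC lerD2l.
  by rewrite (bigD1 i)//= lerDl sumr_ge0.
have h2 : (2 * dl + 1) ^+ 2 <= sq x.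
  rewrite /sq /sqdist (bigD1 i)//= -[leLHS]addr0 lerD ?sumr_ge0//; last by move=> *; exact: sqr_ge0.
  by rewrite -[leRHS]real_normK ?num_real// ler_sqr ?nnegrE// addr_ge0// mulr_ge0// ltW.
by apply: le_trans h2; move: dl0 => ?; nra.
Qed.

Lemma bsupp_cutoff : bsupp cutoff. Proof. exact/bsupp_far/cutoff_far. Qed.

(** Minus the derivative of the cutoff with respect to [sq]. *)
Definition cutoff_slope x :=
  expR dl^-1 * (flat 2 (1 - expR dl^-1 * flat 0 (sq x - dl)) * flat 2 (sq x - dl)).

Lemma d_cutoff i x : partial i cutoff x = - cutoff_slope x * partial i sq x.
Proof.
rewrite /cutoff (d_flat _ _ _ smooth_arg2) (d_sub _ _ (smooth_cst 1)
  (smoothM (smooth_cst _) (smooth_flat 0 smooth_arg))) partial_cst.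
rewrite (d_scale _ _ _ (smooth_flat 0 smooth_arg)) (d_flat _ _ _ smooth_arg).
rewrite (d_sub _ _ (smooth_sqdist a) (smooth_cst dl)) partial_cst /cutoff_slope /sq.
by generalize_partial; ring.
Qed.

Lemma cutoff_slope_ge0 x : 0 <= cutoff_slope x.
Proof. by rewrite mulr_ge0 ?expR_ge0// mulr_ge0// flat_ge0. Qed.

Lemma smooth_cutoff_slope : smooth cutoff_slope.
Proof.
exact: (smoothM (smooth_cst _) (smoothM (smooth_flat 2 smooth_arg2) (smooth_flat 2 smooth_arg))).
Qed.

Lemma bsupp_cutoff_slope : bsupp cutoff_slope.
Proof.
apply: bsupp_far => x h.
by rewrite /cutoff_slope (flat_le0 2 (arg2_far h)) mul0r mulr0.
Qed.

Lemma cutoff_slope_near x : sq x <= dl -> cutoff_slope x = 0.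
Proof. by move=> h; rewrite /cutoff_slope (flat_le0 2 (t := sq x - dl)) ?mulr0// subr_le0. Qed.

Lemma gdot_cutoff x : gdot cutoff sq x = - (4 * sq x * cutoff_slope x).
Proof.
have -> : gdot cutoff sq x = - cutoff_slope x * gdot sq sq x.
  rewrite mulr_sumr; apply: eq_bigr => i _; rewrite d_cutoff.
  by generalize_partial; ring.
rewrite gdot_sqdist [sqdist a a]big1; last by move=> i _; rewrite subrr expr0n.
by rewrite -/sq; ring.
Qed.

Lemma lap_cutoff_near x : sq x < dl -> laplacian cutoff x = 0.
Proof.
move=> h; rewrite laplacianE big1// => i _.
have oO : open [set y | sq y < dl].
  apply: (@open_comp _ _ sq [set t | t < dl]); last exact: open_lt.
  by move=> y _; exact: (smooth_cont (smooth_sqdist a)).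
have n0 : \forall y \near x, cst (0 : R) y = partial i cutoff y.
  apply: filterS (open_nbhs_nbhs (conj oO h)) => y /= hy.
  by rewrite d_cutoff cutoff_slope_near ?oppr0 ?mul0r// ltW.
have D0 : is_derive x (delta_mx ord0 i : 'rV[R]_N) (cst (0 : R)) 0 by exact: is_derive_cst.
by have [_ E] := near_eq_is_derive n0 D0.
Qed.

End cutoff.

(** * Sharpness *)

Section integral_bsupp.
Context (R : realType) (N : nat).
Implicit Types (f g : 'rV[R]_N -> R).
Local Notation leb := (lebesgue_rV R N).

Definition integ f : R := fine (\int[leb]_x (f x)%:E)%E.

Definition smooth_bsupp f := smooth f /\ bsupp f.

Lemma smooth_bsupp_integrable f : smooth_bsupp f -> leb.-integrable setT (EFin \o f).
Proof. by move=> [sf bf]; apply: integrable_bsupp => //; exact: smooth_cont. Qed.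

Lemma integE f : smooth_bsupp f -> (\int[leb]_x (f x)%:E = (integ f)%:E)%E.
Proof.
by move=> hf; rewrite fineK//; exact: (integrable_fin_num measurableT (smooth_bsupp_integrable hf)).
Qed.

Lemma le_integ f g : smooth_bsupp f -> smooth_bsupp g -> (forall x, f x <= g x) -> integ f <= integ g.
Proof.
move=> hf hg fg; rewrite -lee_fin -!integE//; apply: le_integral => //.
- exact: smooth_bsupp_integrable.
- exact: smooth_bsupp_integrable.
- by move=> x _; rewrite lee_fin.
Qed.

Lemma smooth_bsuppD f g : smooth_bsupp f -> smooth_bsupp g -> smooth_bsupp (fun x => f x + g x).
Proof. by move=> [sf bf] [sg bg]; split; [exact: (smoothD sf sg)|exact: (bsuppD bf bg)]. Qed.

Lemma smooth_bsuppM f g : smooth f -> smooth_bsupp g -> smooth_bsupp (fun x => f x * g x).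
Proof. by move=> sf [sg bg]; split; [exact: (smoothM sf sg)|exact: (bsuppMr _ bg)]. Qed.

Lemma smooth_bsupp_sqr f : smooth_bsupp f -> smooth_bsupp (fun x => f x ^+ 2).
Proof.
move=> [sf bf]; split; first exact: (smoothX 2 sf).
rewrite (_ : (fun x => _) = fun x => f x * f x); first exact: (bsuppM _ bf).
by apply/funext => x; rewrite expr2.
Qed.

Lemma smooth_bsuppZ (c : R) f : smooth_bsupp f -> smooth_bsupp (fun x => c * f x).
Proof. exact: (smooth_bsuppM (smooth_cst c)). Qed.

Lemma integD f g : smooth_bsupp f -> smooth_bsupp g -> integ (fun x => f x + g x) = integ f + integ g.
Proof.
move=> hf hg; apply: EFin_inj; rewrite EFinD -(integE (smooth_bsuppD hf hg)) -(integE hf) -(integE hg).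
rewrite -(integralD measurableT (smooth_bsupp_integrable hf) (smooth_bsupp_integrable hg)).
by apply: eq_integral.
Qed.

Lemma integZ (c : R) f : smooth_bsupp f -> integ (fun x => c * f x) = c * integ f.
Proof.
move=> hf; apply: EFin_inj; rewrite EFinM -(integE (smooth_bsuppZ c hf)) -(integE hf).
rewrite -(integralZl measurableT (smooth_bsupp_integrable hf)).
by apply: eq_integral.
Qed.

Lemma integ_ge0 f : (forall x, 0 <= f x) -> 0 <= integ f.
Proof. by move=> h; apply/fine_ge0/integral_ge0 => x _; rewrite lee_fin. Qed.

(** Near [x0] the function exceeds [f x0 / 2] on a box, whose volume is known. *)
Lemma integ_gt0 f x0 : smooth_bsupp f -> (forall x, 0 <= f x) -> 0 < f x0 -> 0 < integ f.
Proof.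
move=> hf f0 fx0; have cf := smooth_cont hf.1.
have [e e0 he] : exists2 e : R, 0 < e & forall x, ball x0 e x -> f x0 / 2 < f x.
  have nb : nbhs x0 [set x | f x0 / 2 < f x].
    apply: (cf x0 [set t | f x0 / 2 < t]); apply: open_nbhs_nbhs; split.
      exact: open_gt.
    by rewrite /= ltr_pdivrMr// mulr_natr mulr2n ltrDl.
  by have /nbhs_ballP[e /= e0 h] := nb; exists e.
pose B := [set x : 'rV[R]_N | forall i, (x0 - const_mx (e / 2)) ord0 i <= x ord0 i
  <= (x0 + const_mx (e / 2)) ord0 i].
have BE : B = [set x | cube (e / 2) (x - x0)].
  by apply/seteqP; split=> x h i; have := h i; rewrite !mxE ler_norml => /andP[? ?];
    apply/andP; split; lra.
have mB : measurable B.
  rewrite (_ : B = (fun x => x - x0) @^-1` (cube (e / 2))) ?BE//.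
  rewrite -[X in measurable X]setTI; apply: measurable_fun_rV => //; last exact: measurable_cube.
  move=> i; under eq_fun do rewrite !mxE.
  by apply: measurable_funB => //; exact: measurable_coord.
have Bf x : B x -> f x0 / 2 <= f x.
  rewrite BE => hx; apply/ltW/he; rewrite mx_norm_ball /ball_ /= distrC.
  apply: (@le_lt_trans _ _ (e / 2)); last by rewrite ltr_pdivrMr// mulr_natr mulr2n ltrDl.
  by apply: norm_le_coord => //; rewrite divr_ge0// ltW.
have vol : leb B = (\prod_(i < N) e)%:E.
  rewrite lebesgue_rV_box; last first.
    by move=> i; rewrite !mxE lerBlDr -addrA lerDl addr_ge0// divr_ge0// ltW.
  congr (_%:E); apply: eq_bigr => i _; rewrite !mxE; by field.
rewrite -lte_fin -integE//.
apply: (@lt_le_trans _ _ ((f x0 / 2)%:E * leb B)%E).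
  by rewrite vol -EFinM lte_fin mulr_gt0 ?divr_gt0// prodr_gt0.
rewrite -integral_cst//; apply: (@le_trans _ _ (\int[leb]_(x in B) (f x)%:E)%E).
  apply: ge0_le_integral => //.
  - by move=> x _; rewrite lee_fin divr_ge0.
  - apply/measurable_EFinP; apply: measurable_funTS; exact: continuous_measurable_rV.
apply: ge0_subset_integral => //.
- by apply/measurable_EFinP; exact: continuous_measurable_rV.
- by move=> x _; rewrite lee_fin.
Qed.

End integral_bsupp.

Section concentration.
Context (R : realType) (N : nat) (a : 'rV[R]_N) (dl : R).
Hypotheses (hN : (5 <= N)%N) (dl0 : 0 < dl).

Let sq := @sqdist R N a.
Let s : R := (N%:R - 4) / 4.
Let h : R := 2 * s + 2.
Let sN : N%:R = 4 * s + 4. Proof. by rewrite /s; field. Qed.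
Let s_gt0 : 0 < s. Proof. by rewrite divr_gt0// subr_gt0 ltr_nat. Qed.
Let h_ge1 : 1 <= h. Proof. by rewrite /h; have := s_gt0; lra. Qed.
Let CE : 16 * s ^+ 2 * (s + 1) ^+ 2 = rellich_const R N.
Proof. by rewrite /rellich_const sN; field. Qed.

Let chi := cutoff a dl.
Let slope := cutoff_slope a dl.

(** [F e t = (|x - a|^2 + e)^(- t)] and [p e = (|x - a|^2 + e)^-1]; the concentrated
    functions are [F e s * chi]. *)
Let ell e x := ln (sq x + e).
Let p e x := (sq x + e)^-1.
Let F e t x := expR (- (t * ell e x)).

Let sq_ge0 x : 0 <= sq x. Proof. exact: sqdist_ge0. Qed.
Let smooth_sq : smooth sq. Proof. exact: smooth_sqdist. Qed.
Let smooth_chi : smooth chi. Proof. exact: smooth_cutoff. Qed.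
Let bsupp_chi : bsupp chi. Proof. exact: bsupp_cutoff. Qed.
Let chi_ge0 x : 0 <= chi x. Proof. exact: cutoff_ge0. Qed.
Let slope_ge0 x : 0 <= slope x. Proof. exact: cutoff_slope_ge0. Qed.
Let smooth_slope : smooth slope. Proof. exact: smooth_cutoff_slope. Qed.
Let bsupp_slope : bsupp slope. Proof. exact: bsupp_cutoff_slope. Qed.

(** As [h = N / 2], the integrand is [(p e * F e s * chi) ^ 2]: up to the factor due to the
    second pole, a lower bound for the weight times the square of [F e s * chi]. *)
Let mass e := integ (fun x => F e h x * chi x ^+ 2).

(** [h * flux e] is the derivative of [mass] with respect to [- ln e]. *)
Let flux e := integ (fun x => e * (p e x * (F e h x * chi x ^+ 2))).

Let cs : R := expR (- (s * ln dl)).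

(** Bounds the terms of the Laplacian that live where the cutoff varies, hence
    away from the pole and uniformly in [e]. *)
Let tail x := 3 * cs ^+ 2 * ((4 * s * (s + 1)) ^+ 2 * (2 / dl) ^+ 2 * chi x ^+ 2
  + laplacian chi x ^+ 2 + (8 * s) ^+ 2 * slope x ^+ 2).

Let bsupp_tail : smooth_bsupp tail.
Proof.
have sL : smooth_bsupp (laplacian chi).
  by split; [exact: smooth_laplacian|exact: bsupp_laplacian].
have t1 := smooth_bsupp_sqr (conj smooth_chi bsupp_chi).
have t3 := smooth_bsupp_sqr (conj smooth_slope bsupp_slope).
exact: (smooth_bsuppZ _ (smooth_bsuppD
  (smooth_bsuppD (smooth_bsuppZ _ t1) (smooth_bsupp_sqr sL)) (smooth_bsuppZ _ t3))).
Qed.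

Section fixed_eps.
Variables (e : R) (e0 : 0 < e).

Let sqe_gt0 x : 0 < sq x + e. Proof. exact: sqdist_shift_gt0. Qed.
Let p_gt0 x : 0 < p e x. Proof. by rewrite invr_gt0. Qed.
Let smooth_sqe : smooth (fun x => sq x + e). Proof. exact: smooth_sqdist_shift. Qed.
Let smooth_ell : smooth (ell e). Proof. exact: (smooth_ln smooth_sqe sqe_gt0). Qed.
Let smooth_p : smooth (p e).
Proof. exact: (smooth_inv smooth_sqe (fun x => lt0r_neq0 (sqe_gt0 x))). Qed.
Let smooth_F t : smooth (F e t).
Proof. exact: (smooth_expR (smoothN (smoothM (smooth_cst t) smooth_ell))). Qed.
Let F_gt0 t x : 0 < F e t x. Proof. exact: expR_gt0. Qed.

Let ep x : e * p e x = 1 - p e x * sq x.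
Proof. by rewrite /p; have := lt0r_neq0 (sqe_gt0 x) => ?; field. Qed.
Let ep_le1 x : e * p e x <= 1.
Proof. by rewrite ep gerBl mulr_ge0// ltW. Qed.

Let gdot_ell w x : gdot (ell e) w x = p e x * gdot sq w x.
Proof.
rewrite /ell (gdot_ln _ _ smooth_sqe sqe_gt0); congr (_ * _).
by apply: eq_bigr => i _; rewrite d_sqdist_shift.
Qed.

Let gdot_F t w x : gdot (F e t) w x = - t * F e t x * p e x * gdot sq w x.
Proof.
have s1 := smoothM (smooth_cst t) smooth_ell.
rewrite /F (gdot_expl _ _ (smoothN s1)) (gdotNl _ _ s1) (gdotZl _ _ _ smooth_ell) gdot_ell.
by move: (expR _); generalize_gdot => E; ring.
Qed.

Let lap_F x : laplacian (F e s) x = - (4 * s * (s + 1)) * F e s x * (p e x + e * p e x ^+ 2).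
Proof.
have s1 := smoothM (smooth_cst s) smooth_ell.
rewrite /F (lap_expR _ (smoothN s1)) (lapN _ s1) (lapZ _ _ smooth_ell).
rewrite (gdotNl _ _ s1) (gdotZl _ _ _ smooth_ell) gdotC (gdotNl _ _ s1) (gdotZl _ _ _ smooth_ell).
rewrite /ell (gdot_ln_sqdist e0) (lap_ln_sqdist e0) sN -/sq /p.
by move: (expR _) ((sq x + e)^-1) => E P; ring.
Qed.

Let u x := F e s x * chi x.

Lemma bsupp_concentrated : smooth_bsupp u.
Proof. exact: (smooth_bsuppM (smooth_F s) (conj smooth_chi bsupp_chi)). Qed.

Lemma concentrated_test_function : test_function u.
Proof.
apply: bsupp_test_function; last exact: bsuppMr.
exact: (smoothM (smooth_F s) smooth_chi).
Qed.

Let lap_u x : laplacian u x = F e s x * (- (4 * s * (s + 1)) * chi x * (p e x + e * p e x ^+ 2)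
  + laplacian chi x + 8 * s * (p e x * sq x) * slope x).
Proof.
rewrite /u (lapM _ (smooth_F s) smooth_chi) lap_F gdot_F gdotC gdot_cutoff -/sq -/slope.
by generalize_gdot; ring.
Qed.

Let FF x : F e h x = F e s x ^+ 2 * p e x ^+ 2.
Proof.
have -> : p e x = expR (- ell e x) by rewrite expRN lnK ?posrE.
by rewrite /F -!expRM_natl -expRD; congr expR; rewrite /h; ring.
Qed.

Let F_far t x : 0 <= t -> dl <= sq x -> F e t x <= expR (- (t * ln dl)).
Proof.
move=> t0 hx; rewrite ler_expR lerN2 ler_wpM2l// ler_ln ?posrE//.
by rewrite (le_trans hx)// lerDl ltW.
Qed.

(** Where the cutoff is constant, only [Lap (F e s)] contributes, and
    [(1 + e p)^2 <= 1 + 3 e p] as [e p <= 1]; elsewhere [F e s] is bounded uniformly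
    in [e]. *)
Lemma concentrated_laplacian_le x : laplacian u x ^+ 2 <=
  rellich_const R N * (F e h x * chi x ^+ 2) +
  (3 * rellich_const R N * (e * (p e x * (F e h x * chi x ^+ 2))) + tail x).
Proof.
have Fh0 := F_gt0 h x; have Fs0 := F_gt0 s x; have P0 := p_gt0 x; have E1 := ep_le1 x.
have T0 : 0 <= tail x.
  by rewrite /tail; pos.
have C0 : 0 <= rellich_const R N by apply: ltW; exact: rellich_const_gt0.
have EP0 : 0 <= e * p e x by rewrite mulr_ge0// ltW.
have [hx|hx] := ltP (sq x) dl.
  have sl0 : slope x = 0 by apply: cutoff_slope_near; exact: ltW.
  rewrite lap_u (lap_cutoff_near hx) addr0 sl0 mulr0 addr0.
  rewrite -/chi FF -CE addrA -[X in X <= _]addr0; apply: lerD => //.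
  rewrite (_ : (_ * _) ^+ 2 = 16 * s ^+ 2 * (s + 1) ^+ 2 *
    (F e s x ^+ 2 * p e x ^+ 2 * chi x ^+ 2) * (1 + e * p e x) ^+ 2); last by ring.
  rewrite [X in _ <= X](_ : _ = 16 * s ^+ 2 * (s + 1) ^+ 2 *
    (F e s x ^+ 2 * p e x ^+ 2 * chi x ^+ 2) * (1 + 3 * (e * p e x))); last by ring.
  apply: ler_wpM2l; first by pos.
  by move: EP0 E1; move: (e * p e x) => z z0 z1; nra.
apply: (@le_trans _ _ (tail x)); last by rewrite addrA lerDr; pos.
have Fle : F e s x <= cs by apply: F_far => //; exact: ltW.
have pdl : p e x <= dl^-1.
  by rewrite lef_pV2 ?posrE// (le_trans hx)// lerDl ltW.
have psq : 0 <= p e x * sq x <= 1.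
  apply/andP; split; first by pos.
  by rewrite -subr_ge0 -ep.
rewrite lap_u exprMn /tail (mulrC 3) -[X in _ <= X]mulrA.
apply: ler_pM; [exact: sqr_ge0|exact: sqr_ge0|by rewrite ler_sqr ?nnegrE ?expR_ge0|].
have -> : (4 * s * (s + 1)) ^+ 2 * (2 / dl) ^+ 2 * chi x ^+ 2 =
  (4 * s * (s + 1) * chi x * (2 / dl)) ^+ 2 by ring.
have -> : (8 * s) ^+ 2 * slope x ^+ 2 = (8 * s * slope x) ^+ 2 by ring.
have A1 : (- (4 * s * (s + 1)) * chi x * (p e x + e * p e x ^+ 2)) ^+ 2 <=
    (4 * s * (s + 1) * chi x * (2 / dl)) ^+ 2.
  rewrite !mulNr sqrrN ler_sqr ?nnegrE; [|by pos|by pos].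
  apply: ler_wpM2l; first by pos.
  rewrite expr2 mulrA (_ : _ + _ = (1 + e * p e x) * p e x); last by ring.
  by apply: ler_pM; [pos|exact: ltW|lra|exact: pdl].
have A3 : (8 * s * (p e x * sq x) * slope x) ^+ 2 <= (8 * s * slope x) ^+ 2.
  case/andP: psq => ps0 ps1.
  rewrite ler_sqr ?nnegrE; [|by pos|by pos].
  apply: ler_wpM2r; first exact: slope_ge0.
  by rewrite ger_pMr//; pos.
move: A1 A3.
move: (- _ * chi x * _) (_ * (2 / dl)) (8 * s * _ * slope x) (8 * s * slope x) (laplacian chi x).
move=> a1 b1 a3 b3 a2 A1 A3.
apply: (@le_trans _ _ (3 * (a1 ^+ 2 + a2 ^+ 2 + a3 ^+ 2))); last by lra.
by have := sqr_ge0 (a1 - a2); have := sqr_ge0 (a1 - a3); have := sqr_ge0 (a2 - a3); nra.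
Qed.

Let smooth_mass_density : smooth (fun x => F e h x * chi x ^+ 2).
Proof. exact: (smoothM (smooth_F h) (smoothX 2 smooth_chi)). Qed.

Lemma bsupp_mass_density : smooth_bsupp (fun x => F e h x * chi x ^+ 2).
Proof. exact: (smooth_bsuppM (smooth_F h) (smooth_bsupp_sqr (conj smooth_chi bsupp_chi))). Qed.

Lemma bsupp_flux_density : smooth_bsupp (fun x => e * (p e x * (F e h x * chi x ^+ 2))).
Proof. exact: (smooth_bsuppZ e (smooth_bsuppM smooth_p bsupp_mass_density)). Qed.

Let bsupp_edge : smooth_bsupp (fun x => chi x * sq x * slope x).
Proof.
split; last exact: (bsuppMr _ bsupp_slope).
exact: (smoothM (smoothM smooth_chi smooth_sq) smooth_slope).
Qed.

Lemma bsupp_edge_density : smooth_bsupp (fun x => chi x * sq x * slope x * F e h x).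
Proof.
split; first exact: (smoothM bsupp_edge.1 (smooth_F h)).
exact: (bsuppM _ bsupp_edge.2).
Qed.

(** Divergence theorem for the field [F e h * chi^2 * grad |x - a|^2]: as [2 N = 4 h], the
    terms with [F e h * chi^2] combine to [4 h (1 - p |x - a|^2) = 4 h e p]. *)
Lemma flux_identity : 4 * h * flux e = 8 * integ (fun x => chi x * sq x * slope x * F e h x).
Proof.
pose X i x := F e h x * chi x ^+ 2 * partial i sq x.
have sX i : smooth (X i) by exact: (smoothM smooth_mass_density (smooth_partial i smooth_sq)).
have bX i : bsupp (X i) by exact: (bsuppM _ bsupp_mass_density.2).
have divX x : \sum_(i < N) partial i (X i) x =
    4 * h * (e * (p e x * (F e h x * chi x ^+ 2))) + - 8 * (chi x * sq x * slope x * F e h x).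
  have -> : \sum_(i < N) partial i (X i) x =
      F e h x * chi x ^+ 2 * laplacian sq x + gdot (fun y => F e h y * chi y ^+ 2) sq x.
    rewrite laplacianE mulr_sumr -big_split; apply: eq_bigr => i _ /=.
    by rewrite (d_mul _ _ smooth_mass_density (smooth_partial i smooth_sq)).
  rewrite (gdotMl _ _ (smooth_F h) (smoothX 2 smooth_chi)) gdot_F.
  rewrite (_ : (fun y => chi y ^+ 2) = fun y => chi y * chi y); last first.
    by apply/funext => y; rewrite expr2.
  rewrite (gdotMl _ _ smooth_chi smooth_chi) gdot_cutoff -/sq -/slope lap_sqdist.
  rewrite gdot_sqdist sqdistxx subr0 -/sq sN (_ : e * _ = e * p e x * (F e h x * chi x ^+ 2)); last first.
    by ring.
  by rewrite ep /h; ring.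
apply/eqP; rewrite -subr_eq0; apply/eqP.
rewrite -mulNr -(integZ _ bsupp_flux_density) -(integZ _ bsupp_edge_density).
rewrite -(integD (smooth_bsuppZ _ bsupp_flux_density) (smooth_bsuppZ _ bsupp_edge_density)).
rewrite /integ; under eq_integral do rewrite -divX.
by rewrite (integral_divergence sX bX).
Qed.

(** The slope of the cutoff vanishes near the pole, where [F e h] would be unbounded. *)
Lemma flux_le : flux e <= 2 / h * (expR (- (h * ln dl)) * integ (fun x => chi x * sq x * slope x)).
Proof.
have h0 : 0 < h by exact: lt_le_trans h_ge1.
rewrite -(ler_pM2l (x := 4 * h)) ?mulr_gt0// flux_identity mulrA.
have -> : 4 * h * (2 / h) = 8 by have := lt0r_neq0 h0; move: h => t t0; field.
rewrite ler_wpM2l// -(integZ _ bsupp_edge); apply: (le_integ bsupp_edge_density (smooth_bsuppZ _ bsupp_edge)).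
move=> x; rewrite mulrC; have [hx|/ltW hx] := leP (sq x) dl.
  by rewrite /slope cutoff_slope_near// !mulr0.
apply: ler_wpM2r; first by pos.
by apply: F_far => //; exact: ltW.
Qed.

Lemma integ_concentrated_laplacian : integ (fun x => laplacian u x ^+ 2) <=
  rellich_const R N * mass e + (3 * rellich_const R N * flux e + integ tail).
Proof.
have sL : smooth_bsupp (laplacian u).
  split; first exact: (smooth_laplacian bsupp_concentrated.1).
  exact: (bsupp_laplacian bsupp_concentrated.1 bsupp_concentrated.2).
have sF := smooth_bsuppZ (3 * rellich_const R N) bsupp_flux_density.
have sT := smooth_bsuppD sF bsupp_tail; have sW := smooth_bsuppZ (rellich_const R N) bsupp_mass_density.
rewrite -(integZ _ bsupp_mass_density) -(integZ _ bsupp_flux_density) -(integD sF bsupp_tail) -(integD sW sT).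
exact: (le_integ (smooth_bsupp_sqr sL) (smooth_bsuppD sW sT) concentrated_laplacian_le).
Qed.

Lemma mass_density_le x : x != a -> F e h x * chi x ^+ 2 <= (sq x)^-1 ^+ 2 * u x ^+ 2.
Proof.
move=> /sqdist_gt0 x0; rewrite FF /u exprMn mulrAC mulrC ler_wpM2r//.
  by apply: mulr_ge0; exact: sqr_ge0.
rewrite ler_sqr ?nnegrE ?invr_ge0//; last exact: ltW.
by rewrite lef_pV2 ?posrE// lerDl ltW.
Qed.

Lemma flux_gt0 : 0 < flux e.
Proof.
have chi0 : 0 < chi a.
  by rewrite /chi cutoff_near ?flat_pos// sqdistxx ltW.
apply: (integ_gt0 (x0 := a) bsupp_flux_density).
  by move=> x; have := F_gt0 h x; have := p_gt0 x => ? ?; pos.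
by have := F_gt0 h a; have := p_gt0 a => ? ?; pos.
Qed.

End fixed_eps.

Let F_nincr e e' x : 0 < e -> e <= e' -> F e' h x <= F e h x.
Proof.
move=> e0 ee; have h0 : 0 < h by exact: lt_le_trans h_ge1.
have l0 : 0 < sq x + e by exact: sqdist_shift_gt0.
rewrite ler_expR lerN2; apply: ler_wpM2l; first exact: ltW.
by rewrite ler_ln ?posrE ?lerD2l//; apply: (lt_le_trans l0); rewrite lerD2l.
Qed.

Lemma flux_ge e : 0 < e -> e <= 1 -> flux 1 <= flux e.
Proof.
move=> e0 e1; have h0 : 0 < h by exact: lt_le_trans h_ge1.
have h4 : 0 < 4 * h by apply: mulr_gt0; [exact: ltr0Sn|exact: h0].
have I1 := flux_identity ltr01; have Ie := flux_identity e0.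
suff : 4 * h * flux 1 <= 4 * h * flux e by rewrite (ler_pM2l h4).
rewrite I1 Ie.
apply: ler_wpM2l; first exact: ler0n.
apply: (le_integ (bsupp_edge_density ltr01) (bsupp_edge_density e0)) => x.
by apply: ler_wpM2l; [pos|exact: F_nincr].
Qed.

(** Halving [e] multiplies the density [F e h] by
    [exp (h (ell e - ell (e / 2)))], and [ell e - ell (e / 2) >= e p / 2]. *)
Lemma mass_half e : 0 < e -> mass e + 2^-1 * flux e <= mass (e / 2).
Proof.
move=> e0; have e2 : 0 < e / 2 by rewrite divr_gt0.
have m1 := bsupp_mass_density e0; have f1 := bsupp_flux_density e0.
rewrite -(integZ _ f1) -(integD m1 (smooth_bsuppZ _ f1)).
apply: (le_integ (smooth_bsuppD m1 (smooth_bsuppZ _ f1)) (bsupp_mass_density e2)) => x.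
have l0 : 0 < sq x + e by exact: sqdist_shift_gt0.
have l2 : 0 < sq x + e / 2 by exact: sqdist_shift_gt0.
have p0 : 0 < p e x by rewrite invr_gt0.
have ep1 : e * p e x <= 1.
  by rewrite -ler_pdivlMr// invrK mul1r lerDr.
have -> : F e h x * chi x ^+ 2 + 2^-1 * (e * (p e x * (F e h x * chi x ^+ 2))) =
  F e h x * (1 + e * p e x / 2) * chi x ^+ 2 by field.
apply: ler_wpM2r; first exact: sqr_ge0.
have -> : F (e / 2) h x = F e h x * expR (h * (ell e x - ell (e / 2) x)).
  by rewrite /F -expRD; congr expR; ring.
apply: ler_wpM2l; first exact: expR_ge0.
apply: le_trans (expR_ge1Dx _); rewrite lerD2l.
have lnle : e * p e x / 2 <= ell e x - ell (e / 2) x.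
  rewrite lerBrDl -lerBrDr /ell; have -> : sq x + e / 2 = (sq x + e) * (1 - e * p e x / 2).
    by rewrite /p; have := lt0r_neq0 l0 => ?; field.
  have y0 : 0 < 1 - e * p e x / 2 by lra.
  by rewrite lnM ?posrE// lerD2l; apply: le_ln1Dx; lra.
apply: (le_trans lnle); rewrite ler_peMl//; apply: le_trans lnle.
by rewrite divr_ge0// mulr_ge0// ltW.
Qed.

(** Each halving of [e] adds at least [flux 1 / 2]. *)
Lemma mass_unbounded T : exists e, [/\ 0 < e, e <= 1 & T <= mass e].
Proof.
have f0 : 0 < 2^-1 * flux 1 by rewrite mulr_gt0 ?invr_gt0// flux_gt0.
have en0 n : 0 < (2^-1 : R) ^+ n by rewrite exprn_gt0// invr_gt0.
have en1 n : (2^-1 : R) ^+ n <= 1.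
  by rewrite exprn_ile1// ?invr_ge0// invf_le1// ler1n.
have hn n : n%:R * (2^-1 * flux 1) <= mass (2^-1 ^+ n).
  elim: n => [|n IH].
    by rewrite mul0r; apply: integ_ge0 => x; apply: mulr_ge0; [exact: expR_ge0|exact: sqr_ge0].
  rewrite exprSr; apply: le_trans (mass_half (en0 n)).
  rewrite -natr1 mulrDl mul1r; apply: lerD; [exact: IH|].
  apply: ler_wpM2l; [by rewrite invr_ge0|exact: (flux_ge (en0 n) (en1 n))].
pose n := Num.bound `|T / (2^-1 * flux 1)|.
exists (2^-1 ^+ n); split => //; apply: le_trans (hn n).
rewrite -ler_pdivrMr//; apply/ltW; apply: le_lt_trans (ler_norm _) _.
exact: (archi_boundP (normr_ge0 _)).
Qed.

(** [phi] is the concentrated test function and [g] a lower bound, finite at the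
    pole, for its density in the bipolar Rellich integral.  The excess of the energy
    over the sharp value stays bounded while the integral of [g] diverges. *)
Lemma concentrating_family : exists K, forall T, exists phi g : 'rV[R]_N -> R,
  [/\ test_function phi, smooth_bsupp g, forall x, 0 <= g x,
     forall x, 2 * dl <= sqdist a x -> g x = 0 &
     forall x, x != a -> g x <= (sqdist a x)^-1 ^+ 2 * phi x ^+ 2] /\
  (T <= integ g /\ (norm2 (laplacian phi) <= (rellich_const R N * integ g + K)%:E)%E).
Proof.
exists (3 * rellich_const R N * (2 / h * (expR (- (h * ln dl)) *
  integ (fun x => chi x * sq x * slope x))) + integ tail) => T.
have [e [e0 e1 Te]] := mass_unbounded T.
exists (fun x => F e s x * chi x), (fun x => F e h x * chi x ^+ 2); split; first split.
- exact: concentrated_test_function.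
- exact: bsupp_mass_density.
- by move=> x; apply: mulr_ge0; [exact: expR_ge0|exact: sqr_ge0].
- by move=> x hx; rewrite /chi cutoff_far// expr0n mulr0.
- by move=> x xa; exact: mass_density_le.
split=> //.
have [su bu] := bsupp_concentrated e0.
have sL : smooth_bsupp (laplacian (fun x => F e s x * chi x)).
  by split; [exact: smooth_laplacian|exact: bsupp_laplacian].
rewrite norm2E (integE (smooth_bsupp_sqr sL)) lee_fin; apply: (le_trans (integ_concentrated_laplacian e0)).
rewrite lerD2l lerD2r; apply: ler_wpM2l; last exact: flux_le.
by apply: mulr_ge0 => //; apply: ltW; exact: rellich_const_gt0.
Qed.

End concentration.

(** * The infimum and its non-attainment *)

Section quotient.
Context (R : realType) (N : nat).
Hypothesis hN : (5 <= N)%N.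
Variables (a1 a2 : 'rV[R]_N).
Hypothesis ha : a1 <> a2.
Implicit Types (u w : 'rV[R]_N -> R).

Local Notation leb := (lebesgue_rV R N).
Let d := sqdist a1 a2.
Let d_gt0 : 0 < d. Proof. by apply: sqdist_gt0; rewrite eq_sym; apply/eqP. Qed.
Let C := rellich_const R N.
Let C_gt0 : 0 < C. Proof. exact: rellich_const_gt0. Qed.

Lemma weighted_norm2E u : weighted_norm2 a1 a2 u = (\int[leb]_x (weight a1 a2 x * u x ^+ 2)%:E)%E.
Proof. by apply: eq_integral => x _; rewrite real_normK// num_real. Qed.

Lemma weighted_norm2_ge0 u : (0 <= weighted_norm2 a1 a2 u)%E.
Proof.
rewrite weighted_norm2E; apply: integral_ge0 => x _; rewrite lee_fin.
by apply: mulr_ge0; [exact: weight_ge0|exact: sqr_ge0].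
Qed.

Let measurable_weighted (Om u : 'rV[R]_N -> R) : measurable_fun setT Om -> measurable_fun setT u ->
  measurable_fun setT (fun x : 'rV[R]_N => (Om x * u x ^+ 2)%:E).
Proof.
by move=> mO mu; apply/measurable_EFinP; apply: measurable_funM => //; exact: measurable_funX.
Qed.

Lemma integral_rellich_weighted u : measurable_fun setT u ->
  (\int[leb]_x (C * (weight a1 a2 x * u x ^+ 2))%:E = C%:E * weighted_norm2 a1 a2 u)%E.
Proof.
move=> mu; rewrite weighted_norm2E -ge0_integralZl_EFin ?(ltW C_gt0)//.
- by move=> x _; rewrite lee_fin; apply: mulr_ge0; [exact: weight_ge0|exact: sqr_ge0].
- exact: (measurable_weighted (@measurable_weight R N a1 a2) mu).
Qed.

Lemma test_function_measurable u : test_function u -> measurable_fun setT u.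
Proof. by move=> [su _]; apply: continuous_measurable_rV; exact: smooth_cont. Qed.

Lemma rellich_bipolar_weighted u : test_function u ->
  (C%:E * weighted_norm2 a1 a2 u <= norm2 (laplacian u))%E.
Proof.
move=> tu; rewrite norm2E -(integral_rellich_weighted (test_function_measurable tu)).
exact: rellich_bipolar.
Qed.

Lemma D22_rellich u w : D22 u w -> (C%:E * weighted_norm2 a1 a2 u <= norm2 w)%E.
Proof.
move=> Duw; have [mu _ _] := Duw; rewrite -(integral_rellich_weighted mu).
under eq_integral do rewrite mulrA.
rewrite -[norm2 w]mul1e; apply: (D22_weighted ler01 _ _ _ Duw).
- by apply: measurable_funM => //; exact: measurable_weight.
- by move=> x; apply: mulr_ge0; [exact: ltW|exact: weight_ge0].
- move=> phi tphi; rewrite mul1e; under eq_integral do rewrite -mulrA.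
  rewrite integral_rellich_weighted; first exact: rellich_bipolar_weighted.
  exact: test_function_measurable.
Qed.

Lemma D22_weighted_norm2_fin_num u w : D22 u w -> weighted_norm2 a1 a2 u \is a fin_num.
Proof.
move=> Duw; rewrite ge0_fin_numE ?weighted_norm2_ge0//.
have := D22_norm2_fin_num Duw; rewrite fin_numElt => /andP[_ h].
have := le_lt_trans (D22_rellich Duw) h.
have := weighted_norm2_ge0 u; case: (weighted_norm2 a1 a2 u) => [r|//|//] _; first by move=> _; exact: ltry.
by rewrite gt0_muley ?lte_fin.
Qed.

(** Two densities matter: the bipolar weight itself, and the density gained by the
    improved inequality; neither can annihilate a nonzero function. *)
Lemma nonzero_weighted_gt0 (Om : 'rV[R]_N -> R) u : measurable_fun setT Om ->
  (forall x, 0 <= Om x) -> (forall x, x <> a1 -> x <> a2 -> 0 < Om x) ->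
  measurable_fun setT u -> nonzero u -> (0 < \int[leb]_x (Om x * u x ^+ 2)%:E)%E.
Proof.
move=> mO O0 Opos mu nz; have pos0 x : 0 <= Om x * u x ^+ 2.
  by apply: mulr_ge0; [exact: O0|exact: sqr_ge0].
rewrite lt0e integral_ge0 ?andbT; last by move=> x _; rewrite lee_fin.
apply/eqP => I0; apply: nz.
have /(ae_eq_integral_abs leb measurableT) := measurable_weighted mO mu.
move=> [+ _]; rewrite (_ : (\int[_]_(x in _) `| _ |)%E = 0%E); last first.
  by rewrite -[RHS]I0; apply: eq_integral => x _; rewrite /= ger0_norm.
move=> /(_ erefl) h.
have ho := ae_off_poles hN (a1 := a1) (a2 := a2) (P := fun x => 0 < Om x) Opos.
apply: filterS2 h ho => x /(_ I) /= [+] O1 => /eqP.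
by rewrite mulf_eq0 gt_eqF//= sqrf_eq0 => /eqP.
Qed.

Lemma rayleigh_ge u w : D22 u w -> nonzero u -> (C%:E <= rayleigh a1 a2 u w)%E.
Proof.
move=> Duw nz; have [mu _ _] := Duw.
have := nonzero_weighted_gt0 (@measurable_weight R N a1 a2) (@weight_ge0 R N a1 a2)
  (@weight_gt0 R N a1 a2 ha) mu nz.
rewrite -weighted_norm2E /rayleigh.
have := D22_rellich Duw; have := D22_weighted_norm2_fin_num Duw.
case: (weighted_norm2 a1 a2 u) => [X|//|//] _ h X0; rewrite lte_fin in X0.
by rewrite inver gt_eqF// lee_pdivlMr.
Qed.

(** An extremal function makes the main terms of the improved inequality cancel. What
    is left says that [tau] times the gained density is at most of order [tau ^ 2],
    hence that the gained density integrates to zero. *)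
Lemma rayleigh_neq u w : D22 u w -> nonzero u -> rayleigh a1 a2 u w <> C%:E.
Proof.
move=> Duw nz; have [mu mw _] := Duw.
have mgain := @measurable_gain R N a1 a2.
have W0 := nonzero_weighted_gt0 (@measurable_weight R N a1 a2) (@weight_ge0 R N a1 a2)
  (@weight_gt0 R N a1 a2 ha) mu nz.
have G0 := nonzero_weighted_gt0 mgain (@gain_ge0 R N a1 a2) (@gain_gt0 R N a1 a2 ha) mu nz.
set G := (X in (0 < X)%E) in G0.
have improved tau : 0 <= tau -> (C%:E * weighted_norm2 a1 a2 u + tau%:E * G <=
    (1 + gain_loss a1 a2 * tau ^+ 2)%:E * norm2 w)%E.
  move=> t0; rewrite -(integral_rellich_weighted mu) /G -ge0_integralZl_EFin//; last 2 first.
  - by move=> x _; rewrite lee_fin; apply: mulr_ge0; [exact: gain_ge0|exact: sqr_ge0].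
  - exact: measurable_weighted.
  rewrite -ge0_integralD//; last 4 first.
  - move=> x _; rewrite lee_fin; apply: mulr_ge0; first exact: ltW.
    by apply: mulr_ge0; [exact: weight_ge0|exact: sqr_ge0].
  - apply/measurable_EFinP; apply: measurable_funM => //; apply/measurable_EFinP.
    exact: (measurable_weighted (@measurable_weight R N a1 a2) mu).
  - move=> x _; rewrite mule_ge0 ?lee_fin//.
    by apply: mulr_ge0; [exact: gain_ge0|exact: sqr_ge0].
  - by apply: measurable_funeM; exact: measurable_weighted.
  rewrite (eq_integral (fun x => ((C * weight a1 a2 x + tau * gain a1 a2 x) * u x ^+ 2)%:E));
    last by move=> x _; rewrite -EFinM -EFinD; congr (_%:E); ring.
  apply: (D22_weighted _ _ _ _ Duw).
  - by apply: addr_ge0 => //; apply: mulr_ge0; [exact: gain_loss_ge0|exact: sqr_ge0].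
  - apply: measurable_funD; apply: measurable_funM => //; exact: measurable_weight.
  - move=> x; apply: addr_ge0; apply: mulr_ge0 => //; first exact: ltW.
      exact: weight_ge0.
    exact: gain_ge0.
  - by move=> phi tphi; rewrite norm2E; exact: rellich_bipolar_improved.
move=> E; have := D22_weighted_norm2_fin_num Duw; have := D22_norm2_fin_num Duw.
move: W0 improved E; rewrite -weighted_norm2E /rayleigh.
case: (weighted_norm2 a1 a2 u) => [X|//|//]; case: (norm2 w) => [Y|//|//] X0.
rewrite lte_fin in X0; rewrite inver gt_eqF// -EFinM => improved [YX] _ _.
have {}YX : Y = C * X by rewrite -YX mulfVK// gt_eqF.
move: G0 improved; rewrite YX; case: G => [g|//|//]; last first.
  by move=> _ /(_ 1 ler01); rewrite mul1e addey// -EFinM leye_eq.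
rewrite lte_fin => g0 improved.
pose B := gain_loss a1 a2 * (C * X).
have B0 : 0 <= B by apply: mulr_ge0; [exact: gain_loss_ge0|apply: mulr_ge0; exact: ltW].
have small tau : 0 <= tau -> tau * g <= tau ^+ 2 * B.
  move=> /improved; rewrite -!EFinM -EFinD lee_fin mulrDl mul1r lerD2l => h.
  by apply: (le_trans h); rewrite /B le_eqVlt; apply/orP; left; apply/eqP; ring.
have := small (g / (2 * (B + 1))).
have b0 : 0 < 2 * (B + 1) by rewrite mulr_gt0// ltr_wpDl.
have t0 : 0 < g / (2 * (B + 1)) by rewrite divr_gt0.
move=> /(_ (ltW t0)); rewrite expr2 -mulrA ler_pM2l// mulrAC ler_pdivlMr//.
by apply/negP; rewrite -ltNge mulrC; nra.
Qed.

Lemma D22_test_function u : test_function u -> D22 u (laplacian u).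
Proof.
move=> tu; split; first exact: test_function_measurable.
  by apply: continuous_measurable_rV; apply: smooth_cont; apply: smooth_laplacian; case: tu.
exists (fun=> u); split=> //.
  move=> K _; rewrite [X in X @ _ --> _](_ : _ = cst 0%E); first exact: cvg_cst.
  by apply/funext => k; rewrite integral0_eq// => x _; rewrite subrr normr0.
rewrite [X in X @ _ --> _](_ : _ = cst 0%E); first exact: cvg_cst.
by apply/funext => k; rewrite integral0_eq// => x _; rewrite subrr normr0 expr0n.
Qed.

Lemma weighted_gt0_nonzero u : measurable_fun setT u -> (0 < weighted_norm2 a1 a2 u)%E -> nonzero u.
Proof.
move=> mu + u0; rewrite weighted_norm2E (ae_eq_integral (cst 0%E))//.
- by rewrite integral_cst//= mul0e ltxx.
- exact: (measurable_weighted (@measurable_weight R N a1 a2) mu).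
- by apply: filterS u0 => x ux _; rewrite ux expr0n mulr0.
Qed.

(** The triangle inequality for the distance, squared with a weight [theta]. *)
Lemma sqdist_le theta x : 0 < theta ->
  sqdist a2 x <= (1 + theta^-1) * sqdist a1 x + (1 + theta) * d.
Proof.
move=> t0; rewrite /d /sqdist !mulr_sumr -big_split; apply: ler_sum => i _ /=.
rewrite -subr_ge0 (_ : _ - _ = theta^-1 * (x ord0 i - a1 ord0 i - theta * (a1 ord0 i - a2 ord0 i)) ^+ 2).
  by apply: mulr_ge0; [rewrite invr_ge0 ltW|exact: sqr_ge0].
by have := lt0r_neq0 t0 => ?; field.
Qed.

(** With [theta = eta / 4] in [sqdist_le], the part of the bound coming from the
    first pole stays below [eta / 4 * d] while [sqdist a1 x < 2 * radius eta]. *)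
Let radius eta := eta / 4 * d / (2 * (1 + 4 / eta)).

Let radius_gt0 eta : 0 < eta -> 0 < radius eta.
Proof.
by move=> e0; rewrite divr_gt0// mulr_gt0// ?divr_gt0// addr_gt0// divr_gt0.
Qed.

(** Close to the first pole, the factor of the weight due to the second one is
    almost constant. *)
Lemma second_pole_near eta x : 0 < eta -> eta < 1 -> sqdist a1 x < 2 * radius eta ->
  (1 - eta) * sqdist a2 x ^+ 2 <= d ^+ 2.
Proof.
move=> e0 e1 hx; have k0 : 0 < 1 + 4 / eta by rewrite addr_gt0// divr_gt0.
have h1 : (1 + 4 / eta) * sqdist a1 x <= eta / 4 * d.
  rewrite mulrC -ler_pdivlMr//; apply: (le_trans (ltW hx)).
  rewrite /radius le_eqVlt; apply/orP; left; apply/eqP.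
  by have := lt0r_neq0 k0; move: (1 + 4 / eta) => k hk; field.
have := @sqdist_le (eta / 4) x; rewrite divr_gt0// => /(_ isT).
rewrite invf_div => h2; have {h1}h2 : sqdist a2 x <= (1 + eta / 2) * d.
  by apply: (le_trans h2); move: h1; lra.
apply: (@le_trans _ _ ((1 - eta) * ((1 + eta / 2) * d) ^+ 2)).
  apply: ler_wpM2l; first by lra.
  by rewrite ler_sqr ?nnegrE ?sqdist_ge0// mulr_ge0 ?(ltW d_gt0)//; lra.
rewrite exprMn mulrA ler_piMl ?sqr_ge0//.
by nra.
Qed.

(** If [1 - eta] is the proportion of the weight retained near the first pole, the
    concentrated functions have quotients at most [(C J + K) / ((1 - eta) J)] with [J]
    arbitrarily large; the value of [eta] gives [(C + e) (1 - eta) = C + e / 2], and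
    [J >= 2 K / e] does the rest. *)
Lemma rayleigh_inf_le : (rayleigh_inf a1 a2 <= C%:E)%E.
Proof.
apply/lee_addgt0Pr => e e0; rewrite -EFinD.
pose eta := e / (2 * (C + e)).
have Ce0 : 0 < C + e by rewrite addr_gt0.
have eta0 : 0 < eta by rewrite divr_gt0// mulr_gt0.
have eta1 : eta < 1.
  by rewrite ltr_pdivrMr ?mulr_gt0//; move: C_gt0 => ?; lra.
have [K HK] := concentrating_family a1 hN (radius_gt0 eta0).
have [phi [g [[tphi sbg g0 gfar gphi] [Tg hK]]]] := HK (1 + 2 * `|K| / e).
have mphi := test_function_measurable tphi.
pose J := integ g.
have J0 : 0 < J.
  by apply: lt_le_trans Tg; rewrite ltr_pwDl// divr_ge0// ?mulr_ge0// ltW.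
have JK : K <= e / 2 * J.
  apply: le_trans (ler_norm _) _.
  apply: (@le_trans _ _ (e / 2 * (1 + 2 * `|K| / e))); last by rewrite ler_wpM2l// divr_ge0// ltW.
  have -> : e / 2 * (1 + 2 * `|K| / e) = e / 2 + `|K| by have := lt0r_neq0 e0 => ?; field.
  by rewrite lerDr divr_ge0// ltW.
have lower : (((1 - eta) * J)%:E <= weighted_norm2 a1 a2 phi)%E.
  rewrite -(integZ _ sbg) -(integE (smooth_bsuppZ _ sbg)) weighted_norm2E.
  apply: ae_ge0_le_integral => //.
  - by move=> x _; rewrite lee_fin mulr_ge0// subr_ge0 ltW.
  - apply/measurable_EFinP; apply: continuous_measurable_rV; apply: smooth_cont.
    exact: (smooth_bsuppZ _ sbg).1.
  - by move=> x _; rewrite lee_fin; apply: mulr_ge0; [exact: weight_ge0|exact: sqr_ge0].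
  - exact: (measurable_weighted (@measurable_weight R N a1 a2) mphi).
  apply: (ae_off_poles hN (a1 := a1) (a2 := a2)) => x x1 x2 _; rewrite lee_fin.
  have [hx|hx] := leP (2 * radius eta) (sqdist a1 x).
    by rewrite gfar// mulr0; apply: mulr_ge0; [exact: weight_ge0|exact: sqr_ge0].
  apply: (@le_trans _ _ ((1 - eta) * ((sqdist a1 x)^-1 ^+ 2 * phi x ^+ 2))).
    by rewrite ler_wpM2l ?subr_ge0 ?(ltW eta1)//; apply: gphi; apply/eqP.
  rewrite mulrA; apply: ler_wpM2r; first exact: sqr_ge0.
  rewrite weightE -/d exprMn [X in _ <= X]mulrCA [X in X <= _]mulrC; apply: ler_wpM2l; first exact: sqr_ge0.
  have q0 : 0 < sqdist a2 x by apply: sqdist_gt0; apply/eqP.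
  by rewrite exprVn ler_pdivlMr ?exprn_gt0//; exact: second_pole_near.
have Dphi := D22_test_function tphi.
have W0 : (0 < weighted_norm2 a1 a2 phi)%E.
  by apply: lt_le_trans lower; rewrite lte_fin mulr_gt0// subr_gt0.
apply: (@le_trans _ _ (rayleigh a1 a2 phi (laplacian phi))).
  apply: ereal_inf_lbound; exists phi, (laplacian phi); split=> //.
  exact: weighted_gt0_nonzero.
rewrite /rayleigh; have := D22_weighted_norm2_fin_num Dphi.
move: lower W0; case: (weighted_norm2 a1 a2 phi) => [X|//|//]; rewrite lte_fin lee_fin => lower X0 _.
rewrite inver gt_eqF// lee_pdivrMr//; apply: (le_trans hK); rewrite -EFinM lee_fin -/J.
apply: (@le_trans _ _ ((C + e) * ((1 - eta) * J))); last by rewrite ler_wpM2l// ltW.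
have -> : (C + e) * ((1 - eta) * J) = C * J + e / 2 * J.
  by rewrite /eta; have := lt0r_neq0 Ce0 => ?; field.
by rewrite lerD2l.
Qed.

Lemma rayleigh_infE : rayleigh_inf a1 a2 = C%:E.
Proof.
apply/eqP; rewrite eq_le rayleigh_inf_le /=; apply: le_ereal_inf_tmp => _ [u [w [Duw nz ->]]].
exact: rayleigh_ge.
Qed.

End quotient.

Theorem corollary1p4 (R : realType) (N : nat) (a1 a2 : 'rV[R]_N)
    (hN : (5 <= N)%N) (ha : a1 <> a2) :
  let C : R := N%:R ^+ 2 * (N%:R - 4) ^+ 2 / 16 in
  [/\ forall u : 'rV[R]_N -> R, test_function u ->
        (C%:E * weighted_norm2 a1 a2 u <= norm2 (laplacian u))%E,
      rayleigh_inf a1 a2 = C%:E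
    & ~ exists u w : 'rV[R]_N -> R,
        [/\ D22 u w, nonzero u & rayleigh a1 a2 u w = rayleigh_inf a1 a2]].
Proof.
split.
- exact: rellich_bipolar_weighted.
- exact: rayleigh_infE.
- by move=> [u [w [Duw nz]]]; rewrite rayleigh_infE//; exact: rayleigh_neq.
Qed.
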